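(* Let $K \subset \mathbb{R}^n$ be a convex body. Suppose that the smooth, convex function $\psi: \mathbb{R}^n \rightarrow \mathbb{R}$ induces a log-concave transportation to $K$. Assume further that $\psi$ is regular at infinity. Then, for any Lipschitz function $f: K \rightarrow \mathbb{R}$, $$\int_K f = 0 \quad \Rightarrow \quad \int_K f^2 \leq \int_K Q_{\psi,x}(\nabla f(x)) \, dx.$$
   Context: A convex body is a bounded, open convex set; smooth means $C^\infty$. A function is log-concave if it has the form $\exp(-H)$ with $H:\mathbb{R}^n\to(-\infty,\infty]$ convex. Log-concave transportation: a smooth convex $\psi:\mathbb{R}^n\to\mathbb{R}$ induces a log-concave transportation to $K$ if (i) $\rho_\psi(x) = \det \nabla^2\psi(x)$ is positive and log-concave on $\mathbb{R}^n$, and (ii) $\nabla\psi(\mathbb{R}^n) = \{\nabla\psi(x) ; x\in\mathbb{R}^n\} = K$. Notation: subscripts denote partial derivatives, e.g. $\psi_i = \partial\psi/\partial x_i$, $\psi_{ij}$, $\psi_{ijk}$; $(\psi^{ij})_{i,j}$ is the inverse matrix of the Hessian $(\psi_{ij})_{i,j}$. The Legendre transform is $\psi^*(x)=\sup_{y\in\mathbb{R}^n}[\langle x,y\rangle-\psi(y)]$ for $x \in K$; $\nabla\psi^*:K\to\mathbb{R}^n$ is the inverse map of $\nabla\psi$. Quadratic forms: for $x\in K$ and $V=(V^1,\ldots,V^n)\in\mathbb{R}^n$ set $$Q^*_{\psi,x}(V)=\sum_{i,j,k,\ell,m,p=1}^n V^iV^j\psi^{\ell m}\psi_{jkm}\psi^{kp}\psi_{i\ell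 p},$$ and for $U\in\mathbb{R}^n$ set $$Q_{\psi,x}(U)=\sup\Big\{4\Big(\sum_{i,j=1}^n\psi_{ij}U^iV^j\Big)^2 \ ;\ V\in\mathbb{R}^n,\ Q^*_{\psi,x}(V)\le 1\Big\}\in[0,\infty],$$ where in both formulas the functions $\psi_{ij},\psi^{\ell m},\psi_{jkm}$, etc. are evaluated at the point $\nabla\psi^*(x)$. Regularity at infinity: for smooth $u:\mathbb{R}^n\to\mathbb{R}$ write $\triangle^\psi u=\sum_{i,j}\psi^{ij}u_{ij}$, $\langle\nabla^\psi u,\nabla^\psi h\rangle=\sum_{i,j}\psi^{ij}u_ih_j$ and $|\nabla^\psi u|^2=\langle\nabla^\psi u,\nabla^\psi u\rangle$. Let $\mu$ be the finite measure on $\mathbb{R}^n$ with density $e^{-1}\rho_\psi(x)$. The function $\psi$ is regular at infinity if there exists a linear space $X$ of smooth functions $u:\mathbb{R}^n\to\mathbb{R}$ such that: (a) For any $u,h\in X$, the functions $h\,\triangle^\psi u$ and $\langle\nabla^\psi u,\nabla^\psi h\rangle$ belong to $L^1(\mu)$ and $$\int h(\triangle^\psi u)\,d\mu=-\int\langle\nabla^\psi u,\nabla^\psi h\rangle\,d\mu.$$ The same holds also when $u\in X$ and $h:\mathbb{R}^n\to\mathbb{R}$ is such that $x\mapsto h(\nabla\psi^*(x))$ is a Lipschitz function on $K$. (b) The constant functions belong to $X$; and if $u\in X$ then also $\triangle^\psi u\in X$ and $|\nabla^\psi u|^2\in X$. (c) The space $\{\triangle^\psi u\,;\,u\in X\}$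 is dense, in the topology of $L^2(\mu)$, in the space $\mathcal{H}$ of all $f\in L^2(\mu)$ with $\int f\,d\mu=0$. *)

(* Defs.v *)
From HB Require Import structures.
From mathcomp Require Import all_boot all_order all_algebra.
From mathcomp Require Import all_classical all_reals all_analysis.

Set Implicit Arguments.
Unset Strict Implicit.
Unset Printing Implicit Defensive.
Import Order.TTheory GRing.Theory Num.Theory.
Import numFieldNormedType.Exports.

Local Open Scope classical_set_scope.
Local Open Scope ring_scope.

Fact rV_display : measure_display. Proof. exact: default_measure_display. Qed.

(* Same construction as the library's instance on n.-tuple T.  The generated
   sigma-algebra is the Borel sigma-algebra of 'rV[R]_n. *)
Section measurable_rV.
Context {R : realType} {n : nat}.

Let coors : 'I_n -> 'rV[R]_n -> R := fun i v => v ord0 i.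

Let rV_set0 : g_sigma_preimage coors set0.
Proof. exact: sigma_algebra0. Qed.

Let rV_setC A : g_sigma_preimage coors A -> g_sigma_preimage coors (~` A).
Proof. exact: sigma_algebraC. Qed.

Let rV_bigcup (F : _^nat) : (forall i, g_sigma_preimage coors (F i)) ->
  g_sigma_preimage coors (\bigcup_i (F i)).
Proof. exact: sigma_algebra_bigcup. Qed.

HB.instance Definition _ := @isMeasurable.Build rV_display
  'rV[R]_n (g_sigma_preimage coors) rV_set0 rV_setC rV_bigcup.

Lemma measurable_coord (i : 'I_n) :
  measurable_fun [set: 'rV[R]_n] (fun v : 'rV[R]_n => v ord0 i).
Proof.
move=> _ Y mY; rewrite setTI; apply: sub_sigma_algebra => /=.
rewrite -bigcup_seq/=; exists i => /=; first by rewrite mem_index_enum.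
by exists Y => //; rewrite setTI.
Qed.

Lemma measurable_fun_rVP d (T : measurableType d) (f : T -> 'rV[R]_n) :
  measurable_fun setT f <->
  forall i, measurable_fun setT (fun x => f x ord0 i).
Proof.
split=> [mf i|mf].
  exact: (measurableT_comp (measurable_coord i) mf).
apply: (@measurability _ _ _ _ _ _
  (\big[setU/set0]_(i < n) preimage_set_system setT (coors i) measurable)) => //.
move=> _ [B + <-]; rewrite -bigcup_seq/= => -[i _ [A mA <-]].
by rewrite !setTI -comp_preimage -[X in measurable X]setTI; apply: mf.
Qed.

End measurable_rV.


Section lebesgue_rV.
Context {R : realType}.

Definition consrV n (p : R * 'rV[R]_n) : 'rV[R]_n.+1 := row_mx p.1%:M p.2.

Definition unconsrV n (v : 'rV[R]_n.+1) : R * 'rV[R]_n :=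
  (v ord0 ord0, \row_j v ord0 (lift ord0 j)).

Lemma consrV0 n (p : R * 'rV[R]_n) : consrV p ord0 ord0 = p.1.
Proof.
have -> : (ord0 : 'I_n.+1) = lshift n (ord0 : 'I_1) by apply: val_inj.
by rewrite /consrV (@row_mxEl _ 1 1 n) mxE eqxx mulr1n.
Qed.

Lemma consrVS n (p : R * 'rV[R]_n) j :
  consrV p ord0 (lift ord0 j) = p.2 ord0 j.
Proof.
have -> : lift ord0 j = rshift 1 j :> 'I_(1 + n) by apply: val_inj.
by rewrite /consrV (@row_mxEr _ 1 1 n).
Qed.

Lemma consrVK n : cancel (@consrV n) (@unconsrV n).
Proof.
move=> [x v]; rewrite /unconsrV consrV0; congr pair.
by apply/rowP => j; rewrite mxE consrVS.
Qed.

Lemma measurable_consrV n : measurable_fun setT (@consrV n).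
Proof.
apply/measurable_fun_rVP => i.
case: (unliftP ord0 i) => [j|] ->.
  under eq_fun do rewrite consrVS.
  exact: (measurableT_comp (measurable_coord j) measurable_snd).
by under eq_fun do rewrite consrV0; exact: measurable_fst.
Qed.

Lemma measurable_unconsrV n : measurable_fun setT (@unconsrV n).
Proof.
apply/measurable_fun_pairP; split; first exact: measurable_coord.
apply/measurable_fun_rVP => j /=.
under eq_fun do rewrite mxE.
exact: measurable_coord.
Qed.

Section step.
Variables (n : nat) (m : {sigma_finite_measure set 'rV[R]_n -> \bar R}).

Definition lebesgue_rV_step : set 'rV[R]_n.+1 -> \bar R :=
  pushforward (@lebesgue_measure R \x m)%E (@consrV n).

Let step0 : lebesgue_rV_step set0 = 0%E.
Proof. by rewrite /lebesgue_rV_step /pushforward preimage_set0 measure0. Qed.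

Let step_ge0 A : (0 <= lebesgue_rV_step A)%E.
Proof. exact: (measure_ge0 (lebesgue_measure \x m)%E). Qed.

Let step_sigma_additive : semi_sigma_additive lebesgue_rV_step.
Proof.
by apply: measure_semi_sigma_additive; exact: measurable_consrV.
Qed.

HB.instance Definition _ := isMeasure.Build _ _ _
  lebesgue_rV_step step0 step_ge0 step_sigma_additive.

Let step_sigma_finite : sigma_finite setT lebesgue_rV_step.
Proof.
have /sigma_finiteP[F [FT ndF Foo]] := sigma_finiteT (@lebesgue_measure R).
have /sigma_finiteP[G [GT ndG Goo]] := sigma_finiteT m.
exists (fun k => @unconsrV n @^-1` (F k `*` G k)).
  apply/seteqP; split => // v _ /=.
  have : [set: R] (v ord0 ord0) by [].
  rewrite FT => -[i _ Fi].
  have : [set: 'rV[R]_n] (unconsrV v).2 by [].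
  rewrite GT => -[j _ Gj].
  exists (maxn i j) => //; split => /=.
    by move: Fi; exact/subsetPset/ndF/leq_maxl.
  by move: Gj; exact/subsetPset/ndG/leq_maxr.
move=> k; have [mFk Fkoo] := Foo k; have [mGk Gkoo] := Goo k; split.
  rewrite -[X in measurable X]setTI; apply: measurable_unconsrV => //.
  exact: measurableX.
rewrite /lebesgue_rV_step /pushforward -comp_preimage.
rewrite (_ : _ \o _ = id) ?preimage_id; last exact/funext/consrVK.
by rewrite product_measure1E// lte_mul_pinfty// ge0_fin_numE.
Qed.

HB.instance Definition _ := Measure_isSigmaFinite.Build _ _ _
  lebesgue_rV_step step_sigma_finite.

End step.

Fixpoint lebesgue_rV n : {sigma_finite_measure set 'rV[R]_n -> \bar R} :=
  match n with
  | 0 => \d_(0 : 'rV[R]_0)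
  | n.+1 => lebesgue_rV_step (lebesgue_rV n)
  end.

Lemma lebesgue_rV_box n (A : 'I_n -> set R) : (forall i, measurable (A i)) ->
  lebesgue_rV n [set v | forall i, A i (v ord0 i)] =
  (\prod_(i < n) lebesgue_measure (A i))%E.
Proof.
elim: n A => [|n IH] A mA.
  rewrite big_ord0 /= diracE mem_set//=.
  by case.
have mB : measurable [set v : 'rV[R]_n | forall i, A (lift ord0 i) (v ord0 i)].
  rewrite (_ : [set _ | _] = \bigcap_(i in [set: 'I_n])
    ((fun v : 'rV[R]_n => v ord0 i) @^-1` A (lift ord0 i))); last first.
    by apply/seteqP; split => v /= h i; [move=> _; exact: h|exact: h].
  apply: fin_bigcap_measurable => // i _.
  by rewrite -[X in measurable X]setTI; apply: measurable_coord.
rewrite big_ord_recl -(IH (fun i => A (lift ord0 i)))//=.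
rewrite -product_measure1E//; last exact: mA.
rewrite /lebesgue_rV_step /pushforward.
congr (_ _); apply/seteqP; split => -[x v] /=.
  move=> h; split; first by have := h ord0; rewrite consrV0.
  by move=> i; have := h (lift ord0 i); rewrite consrVS.
move=> [h0 h] i; case: (unliftP ord0 i) => [j|] ->; first by rewrite consrVS.
by rewrite consrV0.
Qed.

End lebesgue_rV.
Arguments lebesgue_rV {R} n.

Section calculus.
Context {R : realType} {n : nat}.
Implicit Types (f u h psi : 'rV[R]_n -> R) (x y U V : 'rV[R]_n).

Definition partial (i : 'I_n) f : 'rV[R]_n -> R :=
  fun x => 'D_(delta_mx ord0 i) f x.

(* Where a partial derivative does not exist, 'D takes a default value; for a
   locally Lipschitz f this happens on a null set only. *)
Definition grad f x : 'rV[R]_n := \row_i partial i f x.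

Definition hess f x : 'M[R]_n := \matrix_(i, j) partial j (partial i f) x.

(* s lists the directions of an iterated partial derivative, innermost last *)
Definition partials (s : seq 'I_n) f := foldr partial f s.

Definition smooth f := forall s : seq 'I_n,
  continuous (partials s f) /\
  forall i x, derivable (partials s f) x (delta_mx ord0 i).

Definition dotrV x y : R := \sum_(i < n) x ord0 i * y ord0 i.

(* Meaningful only where the supremum is finite, e.g. on the range of grad psi
   when psi is convex. *)
Definition legendre psi x : R := sup [set dotrV x y - psi y | y in setT].

End calculus.

Section convexity.
Context {R : realType} {n : nat}.

Definition convex_body (K : set 'rV[R]_n) :=
  [/\ bounded_set K, open K & convex_set K].

Definition convex_ereal (H : 'rV[R]_n -> \bar R) :=
  forall (x y : 'rV[R]_n) (t : R), 0 <= t -> t <= 1 ->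
    (H (t *: x + (1 - t) *: y)%R <= t%:E * H x + (1 - t)%R%:E * H y)%E.

Definition log_concave (g : 'rV[R]_n -> R) :=
  exists H : 'rV[R]_n -> \bar R,
    [/\ forall x, (-oo < H x)%E, convex_ereal H
      & forall x, (g x)%:E = expeR (- H x)%E].

End convexity.

Section transportation.
Context {R : realType} {n : nat}.
Variables (psi : 'rV[R]_n -> R).
Implicit Types (u h : 'rV[R]_n -> R) (x y U V : 'rV[R]_n).

Definition rho x : R := \det (hess psi x).

Definition logconcave_transport (K : set 'rV[R]_n) :=
  [/\ forall x, 0 < rho x, log_concave rho & grad psi @` setT = K].

Local Notation "'psi2_' y i j" := (partial j (partial i psi) y)
  (at level 10, y, i, j at level 9).
Local Notation "'psi3_' y i j k" := (partial k (partial j (partial i psi)) y)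
  (at level 10, y, i, j, k at level 9).
Local Notation "'psiI_' y i j" := (invmx (hess psi y) i j)
  (at level 10, y, i, j at level 9).

Definition Qstar x V : R :=
  let y := grad (legendre psi) x in
  \sum_(i < n) \sum_(j < n) \sum_(k < n) \sum_(l < n) \sum_(m < n) \sum_(p < n)
    V ord0 i * V ord0 j * psiI_ y l m * psi3_ y j k m
      * psiI_ y k p * psi3_ y i l p.

Definition Q x U : \bar R :=
  let y := grad (legendre psi) x in
  ereal_sup [set (4 * (\sum_(i < n) \sum_(j < n)
                    psi2_ y i j * U ord0 i * V ord0 j) ^+ 2)%:E
            | V in [set V | Qstar x V <= 1]].

Definition laplacian u x : R :=
  \sum_(i < n) \sum_(j < n) psiI_ x i j * partial j (partial i u) x.

Definition gradprod u h x : R :=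
  \sum_(i < n) \sum_(j < n) psiI_ x i j * partial i u x * partial j h x.

(* Countably additive on measurable sets when rho is continuous and nonnegative;
   integrals against mu only use its values on such sets. *)
Definition mu (A : set 'rV[R]_n) : \bar R :=
  (\int[lebesgue_rV n]_(x in A) (expR (-1) * rho x)%:E)%E.

Definition integration_by_parts u h :=
  [/\ mu.-integrable setT (fun x => (h x * laplacian u x)%:E),
      mu.-integrable setT (fun x => (gradprod u h x)%:E)
    & (\int[mu]_x (h x * laplacian u x)%:E
       = - \int[mu]_x (gradprod u h x)%:E)%E].

Definition L2_mean0 : set ('rV[R]_n -> R) :=
  [set f : 'rV[R]_n -> R | [/\ measurable_fun setT f,
               (\int[mu]_x (f x ^+ 2)%:E < +oo)%E
             & (\int[mu]_x (f x)%:E = 0)%E]].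

Definition regular_at_infinity (K : set 'rV[R]_n) :=
  exists X : set ('rV[R]_n -> R),
  [/\ (forall u, X u -> smooth u)
      /\ (forall (a : R) u v, X u -> X v -> X (fun x => a * u x + v x)),
      (forall u h, X u -> X h -> integration_by_parts u h)
      /\ (forall u h, X u ->
            [lipschitz h (grad (legendre psi) x) | x in K] ->
            integration_by_parts u h),
      (forall c : R, X (cst c))
      /\ (forall u, X u -> X (laplacian u) /\ X (gradprod u u))
    & laplacian @` X `<=` L2_mean0
      /\ (forall f, L2_mean0 f -> forall e : R, 0 < e ->
            exists2 u, X u &
              (\int[mu]_x ((laplacian u x - f x) ^+ 2)%:E < (e ^+ 2)%:E)%E)].

End transportation.

(* Main.v *)
(* The change of variables x = grad psi y turns dx on K into rho_psi(y) dy. Put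
   F = f o grad psi, L = the operator laplacian, and for u in X set
   Gamma2(u) = L(|grad u|^2) / 2 - <grad u, grad (L u)>. Bochner's formula and
   the log-concavity of rho_psi give Gamma2(u) >= Qstar(V) / 4 for V the
   Riemannian gradient of u; testing the supremum defining Q on multiples of V
   yields Q(grad f) >= - 2 A - Gamma2(u) at grad psi y, where
   A(y) = sum_j (d_j f)(grad psi y) (d_j u)(y).
   Integrating against mu, the integral of A is that of <grad u, grad F>, hence
   - int F L u, and the integral of Gamma2(u) is int (L u)^2. So the integral of
   Q(grad f) is at least int F^2 - int (F - L u)^2, up to the factor e, and by
   density of the range of L the last term is arbitrarily small.
   The integrals of A and <grad u, grad F> are compared without a chain rule for
   the nonsmooth f: after multiplication by a cutoff chi both are integrated by
   parts, the first on K against the compactly supported fields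
   (chi d_j u) o (grad psi)^-1, the second on R^n by the hypothesis on X. This
   only needs partial derivatives of f and F almost everywhere. *)

Require Import Defs.
From HB Require Import structures.
From mathcomp Require Import all_boot all_order all_algebra.
From mathcomp Require Import all_classical all_reals all_analysis.
From mathcomp Require Import measurable_realfun perm ring lra.
Import Order.TTheory GRing.Theory Num.Theory.
Import numFieldNormedType.Exports.
Local Open Scope classical_set_scope.
Local Open Scope ring_scope.
Set Implicit Arguments.
Unset Strict Implicit.
Unset Printing Implicit Defensive.

(** * Differential calculus on row vectors *)

(** The constants 1/4 and 4 are dual. Let S be the inverse Hessian of [psi], W the Hessian of u and
    T the third derivative of [psi] contracted with V. Bochner's formula reads Gamma2 = tr(SWSW) -
    tr(SWST) + tr(STST) minus half a trace of fourth derivatives of [psi]. Convexity of - log rho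
    bounds that trace by tr(STST) = Qstar(V), and completing the square at W - T/2 leaves
    Qstar(V)/4. Three obstacles shape the rest. No measurability of Q is available, so every
    measurable quantity is placed below it. The change of variables rests on convexity: the
    gradients of all slices of [psi] have the same range, so that Fubini on a product domain reduces
    it to dimension one. Finally, the hypothesis on X controls <grad u, grad F> but not A. With a
    cutoff chi, F chi read on K is Lipschitz and chi d_j u carried to K extends by zero to a
    compactly supported C^1 function, so both integrations by parts are legitimate; when chi is
    removed, A survives only inside a positive part. *)

Section norm_rV.
Context {R : realType} {n : nat}.
Implicit Types x : 'rV[R]_n.

Lemma coord_le_norm x i : `|x ord0 i| <= `|x|.
Proof. by rewrite [leRHS]/Num.norm /= mx_normrE; apply/bigmax_geP; right => /=;
  exists (ord0, i). Qed.

Lemma norm_le_coord x (M : R) : 0 <= M -> (forall i, `|x ord0 i| <= M) -> `|x| <= M.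
Proof.
move=> M0 h; rewrite [leLHS]/Num.norm /= mx_normrE.
apply/bigmax_leP; split => //= -[i j] _ /=.
by rewrite ord1.
Qed.

End norm_rV.

Section line.
Context {R : realType} {V : normedModType R}.
Implicit Types (f : V -> R) (x v : V).

Lemma is_derive_line f x v (t : R) : derivable f (x + t *: v) v ->
  is_derive t 1 (fun s : R => f (x + s *: v)) ('D_v f (x + t *: v)).
Proof.
move=> df.
have E : (fun h : R => h^-1 *: (((fun s : R => f (x + s *: v)) \o shift t) (h *: 1) - f (x +
  t *: v)))
  = (fun h : R => h^-1 *: ((f \o shift (x + t *: v)) (h *: v) - f (x + t *: v))).
  apply/funext => h /=; congr (_ *: (f _ - _)).
  by rewrite scalerDl [h *: 1]mulr1 addrCA.
by apply: DeriveDef; rewrite /derivable /derive E.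
Qed.

Lemma is_derive_of_line f x v (d : R) :
  is_derive (0 : R) 1 (fun s : R => f (x + s *: v)) d -> is_derive x v f d.
Proof.
move=> [].
have E : (fun h : R => h^-1 *: (((fun s : R => f (x +
  s *: v)) \o shift (0:R)) (h *: 1) - f (x + 0 *: v)))
  = (fun h : R => h^-1 *: ((f \o shift x) (h *: v) - f x)).
  apply/funext => h /=; rewrite scale0r !addr0; congr (_ *: (f _ - _)).
  by rewrite [h *: 1]mulr1 addrC.
by rewrite /derivable /derive E => d1 d2; apply: DeriveDef.
Qed.

Lemma is_derive_scale f x v (s : R) : derivable f x v ->
  is_derive x (s *: v) f (s * 'D_v f x).
Proof.
move=> df; apply: is_derive_of_line.
have h0 : is_derive (s * 0) 1 (fun s : R => f (x + s *: v)) ('D_v f x).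
  by have := @is_derive_line f x v (s * 0); rewrite mulr0 scale0r addr0; apply.
have h1 : is_derive (0:R) (1:R) (fun t : R => s * t) s.
  have := @is_deriveZ R R R id s 0 1 1 (is_derive_id _ _).
  by rewrite [s *: 1]mulr1.
have := @is_derive1_comp R _ _ 0 _ _ h0 h1.
rewrite mulrC; congr is_derive; apply/funext => t /=.
by rewrite scalerA mulrC.
Qed.

Lemma MVT_line f x v : (forall t : R, 0 <= t <= 1 -> derivable f (x + t *: v) v) ->
  exists2 t : R, 0 <= t <= 1 & f (x + v) - f x = 'D_v f (x + t *: v).
Proof.
move=> df.
have d (t : R) : 0 <= t <= 1 -> is_derive t 1 (fun s : R => f (x + s *: v)) ('D_v f (x + t *: v)).
  by move=> t01; apply: is_derive_line; exact: df.
have [||c c01 E] := @MVT_segment R (fun s : R => f (x + s *: v))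
  (fun t => 'D_v f (x + t *: v)) 0 1 ler01.
- by move=> t /[!in_itv]/= /andP[t0 t1]; apply: d; rewrite !ltW.
- apply: derivable_within_continuous => t /[!in_itv]/= t01.
  by have [] := d _ t01.
- exists c; first by move: c01; rewrite in_itv.
  by move: E; rewrite scale1r scale0r addr0 subr0 mulr1.
Qed.

End line.

Lemma is_derive_translate {R : realType} (V : normedModType R) (f : V -> R) (c x v : V) (d : R) :
  is_derive (x + c) v f d -> is_derive x v (fun y => f (y + c)) d.
Proof.
move=> [].
have E : (fun h : R => h^-1 *: ((f \o shift (x + c)) (h *: v) - f (x + c)))
  = (fun h : R => h^-1 *: (((fun y => f (y + c)) \o shift x) (h *: v) - f (x + c))).
  by apply/funext => h /=; rewrite addrA.
by rewrite /derivable /derive E => d1 d2; apply: DeriveDef.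
Qed.

Section C1.
Context {R : realType} {n : nat}.
Implicit Types (f : 'rV[R]_n -> R) (x y v h : 'rV[R]_n).

Local Notation e_ i := (delta_mx (ord0 : 'I_1) i : 'rV[R]_n).

Definition C1 f := forall i, (forall x, derivable f x (e_ i)) /\ continuous (partial i f).

(** The points x + [head h k] form a path from x to x + h that changes one coordinate at a time. *)
Let head h (k : nat) : 'rV[R]_n := \row_i (if (i < k)%N then h ord0 i else 0).

Let head_norm h k : `|head h k| <= `|h|.
Proof.
apply: norm_le_coord => // i; rewrite mxE; case: ifP => _; first exact: coord_le_norm.
by rewrite normr0.
Qed.

Let headS h (k : 'I_n) : head h k.+1 = head h k + h ord0 k *: e_ k.
Proof.
apply/rowP => i; rewrite !mxE eqxx /= ltnS.
case: (ltngtP i k) => ik.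
- have /negbTE-> : i != k by apply: contraTneq ik => ->; rewrite ltnn.
  by rewrite mulr0 addr0.
- have /negbTE-> : i != k by apply: contraTneq ik => ->; rewrite ltnn.
  by rewrite mulr0 addr0.
- have -> : i = k by apply: val_inj.
  by rewrite eqxx mulr1 add0r.
Qed.

(** The increment telescopes along the path [head h k]. Each piece is given by the mean value
    theorem along one axis, at a point no farther from x than [|h|], where the partial derivative is
    within [e'] of its value at x. *)
Lemma C1_estimate f x : C1 f -> forall e : R, 0 < e ->
  exists2 d : R, 0 < d & forall h, `|h| < d ->
    `|f (x + h) - f x - dotrV h (grad f x)| <= e * `|h|.
Proof.
move=> Cf e e0.
(* The n errors add up to at most e; [n.+1] keeps the divisor nonzero in dimension 0. *)
pose e' := e / n.+1%:R.
have e'0 : 0 < e' by rewrite divr_gt0.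
have : \forall y \near x, forall i, `|partial i f y - partial i f x| < e'.
  apply: (@filter_forall _ 'I_n (fun i y => `|partial i f y - partial i f x| < e') (nbhs x)) => i.
  by have [_ /(_ x) /cvgrPdist_lt/(_ _ e'0)] := Cf i; apply: filterS => y; rewrite distrC.
move=> /nbhs_ballP[d /= d0 dP]; exists d => // h hd.
have Fh : f (x + h) - f x = \sum_(k < n) (f (x + head h k.+1) - f (x + head h k)).
  rewrite -(big_mkord xpredT (fun k => f (x + head h k.+1) - f (x + head h k))).
  rewrite (telescope_sumr (fun k => f (x + head h k)))//; congr (f (_ + _) - f _).
    by apply/rowP => i; rewrite mxE ltn_ord.
  have -> : head h 0 = 0 by apply/rowP => i; rewrite !mxE.
  by rewrite addr0.
rewrite Fh /dotrV -sumrB.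
apply: le_trans (ler_norm_sum _ _ _) _.
apply: (@le_trans _ _ (\sum_(k < n) e' * `|h|)); last first.
  rewrite sumr_const card_ord -mulr_natr mulrAC ler_wpM2r// /e' -mulrA ler_piMr ?(ltW e0)//.
  by rewrite mulrC ler_pdivrMr ?ltr0n// mul1r ler_nat.
apply: ler_sum => k _.
rewrite headS addrA mxE.
set z := x + head h k.
have [t t01 ->] : exists2 t : R, 0 <= t <= 1 &
   f (z + h ord0 k *: e_ k) - f z = 'D_(h ord0 k *: e_ k) f (z + t *: (h ord0 k *: e_ k)).
  apply: MVT_line => t _.
  by have [dk _] := Cf k; have [] := @is_derive_scale _ _ _ _ _ (h ord0 k) (dk (z +
    t *: (h ord0 k *: e_ k))).
have [dk _] := Cf k.
have [_ ->] := @is_derive_scale _ _ _ _ _ (h ord0 k) (dk (z + t *: (h ord0 k *: e_ k))).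
rewrite -/(partial k f _) -mulrBr normrM mulrC ler_pM//; last exact: coord_le_norm.
apply/ltW/dP; rewrite -ball_normE /=.
rewrite /z -addrA opprD addrA subrr add0r normrN.
apply: le_lt_trans hd.
apply: norm_le_coord => // i; rewrite !mxE eqxx /=.
have [<-|_] := eqVneq i k; last first.
  rewrite !mulr0 addr0; case: ifP => _; first exact: coord_le_norm.
  by rewrite normr0.
rewrite ltnn add0r mulr1 normrM; apply: le_trans (coord_le_norm h i).
move: t01 => /andP[t0 t1].
by rewrite ler_piMl// ger0_norm.
Qed.

Let dlin f x : 'rV[R]_n -> R := fun h => dotrV h (grad f x).
Let dlin_is_linear f x : linear (dlin f x).
Proof.
move=> a u v; rewrite /dlin /dotrV scaler_sumr -big_split /=; apply: eq_bigr => i _.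
by rewrite !mxE /= [_ *: _]mulrA mulrDl.
Qed.
HB.instance Definition _ f x := GRing.isLinear.Build R 'rV[R]_n R _ (dlin f x) (dlin_is_linear f x).

Lemma C1_diff f x : C1 f -> differentiable f x /\ (forall v, 'd f x v = dotrV v (grad f x)).
Proof.
move=> Cf.
have cd : continuous (dlin f x).
  have -> : dlin f x = fun h => \sum_(i < n) h ord0 i * grad f x ord0 i by [].
  apply: (continuous_big add_continuous) => i _ y.
  apply: (@continuousM R _ (fun h : 'rV[R]_n => h ord0 i) (cst (grad f x ord0 i))).
    exact: coord_continuous.
  exact: cst_continuous.
have dE : f \o shift x = cst (f x) + dlin f x +o_ (0 : 'rV[R]_n) id.
  apply/eqaddoP => e e0; have [d d0 dP] := C1_estimate x Cf e0.
  near=> h; rewrite -[X in `|X| <= _]/(f (h + x) - (f x + dlin f x h)).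
  rewrite [h + x]addrC opprD addrA; apply: dP; near: h.
  by apply/nbhs_ballP; exists d => // y; rewrite -ball_normE /= sub0r normrN.
have := @diff_unique R _ _ f (dlin f x) x cd dE => E.
split; last by move=> v; rewrite E.
by apply/diff_locallyP; rewrite E; split.
Unshelve. all: by end_near. Qed.

Lemma C1_is_derive f x v : C1 f -> is_derive x v f (dotrV v (grad f x)).
Proof.
move=> Cf; have [df dE] := C1_diff x Cf; apply: DeriveDef; first exact: diff_derivable.
by rewrite deriveE.
Qed.

Lemma C1_continuous f : C1 f -> continuous f.
Proof. by move=> Cf x; have [/differentiable_continuous] := C1_diff x Cf. Qed.

Lemma C1_MVT f x v : C1 f -> exists2 t : R, 0 <= t <= 1 &
  f (x + v) - f x = dotrV v (grad f (x + t *: v)).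
Proof.
move=> Cf; have [|t t01 E] := @MVT_line R _ f x v.
  by move=> t _; have [] := C1_is_derive (x + t *: v) v Cf.
by exists t => //; rewrite E; have [_ ->] := C1_is_derive (x + t *: v) v Cf.
Qed.

End C1.

Section chain.
Context {R : realType} {m n : nat}.

(** On the line x + s v the map T becomes a curve whose coordinates are derivable at 0, hence a
    differentiable curve, and the chain rule for total derivatives applies to it. *)
Lemma C1_chain (V : normedModType R) (u : 'rV[R]_n -> R) (T : V -> 'rV[R]_n) x v (d : 'rV[R]_n) :
  C1 u -> (forall i, is_derive x v (fun y => T y ord0 i) (d ord0 i)) ->
  is_derive x v (u \o T) (dotrV d (grad u (T x))).
Proof.
move=> Cu dT; apply: is_derive_of_line.
have dT' i : is_derive (0:R) 1 (fun s : R => T (x + s *: v) ord0 i) (d ord0 i).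
  have := @is_derive_line R V (fun y => T y ord0 i) x v 0.
  rewrite scale0r addr0; by case: (dT i) => di dE; rewrite dE; apply.
pose c := fun s : R => T (x + s *: v).
have dc : derivable c 0 1 by apply/derivable_mxP => i j; rewrite ord1; case: (dT' j).
have c0 : c 0 = T x by rewrite /c scale0r addr0.
have [du duE] := C1_diff (c 0) Cu.
have diffc : differentiable c 0 by apply/derivable1_diffP.
apply: DeriveDef.
  by apply/derivable1_diffP; exact: (differentiable_comp diffc du).
rewrite -[LHS]/('D_1 (u \o c) 0) deriveE; last exact: differentiable_comp.
rewrite diff_comp//= duE c0; congr (dotrV _ _).
rewrite -deriveE//; apply/rowP => i.
by rewrite derive_mx// mxE; case: (dT' i).
Qed.

End chain.

Lemma partialE {R : realType} {n} (i : 'I_n) (f : 'rV[R]_n -> R) x :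
  partial i f x = 'D_(delta_mx ord0 i) f x.
Proof. by []. Qed.

(* Unification would otherwise unfold these constants down to limits of filters. *)
Opaque partial derive.

Section is_derive_ext.
Context {R : realType} {V : normedModType R}.
Implicit Types (f g : V -> R) (x v : V).

Lemma is_deriveDE f g x v (df dg : R) : is_derive x v f df -> is_derive x v g dg ->
  is_derive x v (fun y => f y + g y) (df + dg).
Proof. by move=> d1 d2; exact: is_deriveD. Qed.

Lemma is_deriveBE f g x v (df dg : R) : is_derive x v f df -> is_derive x v g dg ->
  is_derive x v (fun y => f y - g y) (df - dg).
Proof. by move=> d1 d2; exact: is_deriveB. Qed.

Lemma is_deriveME f g x v (df dg : R) : is_derive x v f df -> is_derive x v g dg ->
  is_derive x v (fun y => f y * g y) (df * g x + f x * dg).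
Proof.
by move=> d1 d2; apply: is_derive_eq (is_deriveM d1 d2) _; rewrite addrC [g x *: _]mulrC.
Qed.

Lemma is_deriveCE f (c : R) x v (df : R) : is_derive x v f df ->
  is_derive x v (fun y => c * f y) (c * df).
Proof. by move=> d1; exact: (@is_deriveZ R V R f c x v df d1). Qed.

Lemma is_derive_sumE n (F : 'I_n -> V -> R) x v (d : 'I_n -> R) :
  (forall i, is_derive x v (F i) (d i)) ->
  is_derive x v (fun y => \sum_(i < n) F i y) (\sum_(i < n) d i).
Proof. by move=> dF; have := @is_derive_sum R V R n F x v d dF; rewrite fct_sumE. Qed.

End is_derive_ext.

Section continuity.
Context {R : realType} {T : topologicalType}.
Implicit Types f g : T -> R.

Lemma contD f g : continuous f -> continuous g -> continuous (fun x => f x + g x).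
Proof. by move=> cf cg x; exact: (continuousD (cf x) (cg x)). Qed.
Lemma contB f g : continuous f -> continuous g -> continuous (fun x => f x - g x).
Proof. by move=> cf cg x; exact: (continuousB (cf x) (cg x)). Qed.
Lemma contN f : continuous f -> continuous (fun x => - f x).
Proof. by move=> cf x; exact: (continuousN (cf x)). Qed.
Lemma contM f g : continuous f -> continuous g -> continuous (fun x => f x * g x).
Proof. by move=> cf cg x; exact: (continuousM (cf x) (cg x)). Qed.
Lemma contV f : (forall x, f x != 0) -> continuous f -> continuous (fun x => (f x)^-1).
Proof. by move=> f0 cf x; exact: (cvgV (f0 x) (cf x)). Qed.
Lemma cont_cst (c : R) : continuous (fun _ : T => c).
Proof. by move=> x; exact: cvg_cst. Qed.
Lemma cont_sum n (F : 'I_n -> T -> R) :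
  (forall i, continuous (F i)) -> continuous (fun x => \sum_(i < n) F i x).
Proof. by move=> cF; apply: (continuous_big add_continuous) => i _; exact: cF. Qed.
Lemma cont_prod n (F : 'I_n -> T -> R) :
  (forall i, continuous (F i)) -> continuous (fun x => \prod_(i < n) F i x).
Proof. by move=> cF; apply: (continuous_big mul_continuous) => i _; exact: cF. Qed.
Lemma cont_comp (U W : topologicalType) (f : T -> U) (g : U -> W) :
  continuous f -> continuous g -> continuous (fun x => g (f x)).
Proof. by move=> cf cg x; exact: (continuous_comp (cf x) (cg (f x))). Qed.
Lemma cont_norm (W : normedModType R) (f : T -> W) :
  continuous f -> continuous (fun x => `|f x|).
Proof. by move=> cf x; exact: (cvg_norm (cf x)). Qed.
Lemma cont_sub_cst (W : normedModType R) (f : T -> W) c :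
  continuous f -> continuous (fun x => f x - c).
Proof. by move=> cf x; exact: (cvgB (cf x) (cvg_cst _)). Qed.
Lemma cont_coord n (i : 'I_n) : continuous (fun z : 'rV[R]_n => z ord0 i).
Proof. exact: coord_continuous. Qed.
Lemma cont_rV n (f : T -> 'rV[R]_n) :
  (forall i, continuous (fun x => f x ord0 i)) -> continuous f.
Proof.
move=> cf x; apply/cvgrPdist_lt => e e0.
have : \forall y \near x, forall i, `|f x ord0 i - f y ord0 i| < e / 2.
  apply: filter_forall => i; have /cvgrPdist_lt := cf i x; apply; exact: divr_gt0.
apply: filterS => y yP; apply: (@le_lt_trans _ _ (e / 2)).
  apply: norm_le_coord; first by rewrite ltW// divr_gt0.
  by move=> i; rewrite !mxE ltW.
by rewrite ltr_pdivrMr// ltr_pMr// ltr1n.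
Qed.

End continuity.

(* Stated for abstract spaces, since [nbhs] on matrices gets unfolded by apply. *)
Lemma nbhs_imp {T : topologicalType} (x : T) (P Q : set T) :
  P `<=` Q -> nbhs x P -> nbhs x Q.
Proof. exact: filterS. Qed.

Lemma cvg_dist {R : realType} {T : topologicalType} {W : normedModType R}
    (f : T -> W) (x : T) (l : W) :
  (forall e : R, 0 < e -> \forall y \near x, `|l - f y| < e) -> f @ x --> l.
Proof. by move=> h; apply/cvgrPdist_lt. Qed.

Lemma near_line {R : realType} {V : normedModType R} (P : set V) (c v : V) :
  (\forall y \near c, P y) -> \forall h \near (0 : R)^', P (h *: v + c).
Proof.
move=> N; apply: (cvg_within_filter (F := nbhs (0 : R)) (f := fun h : R => h *: v + c) (G :=
  nbhs c)) N.
rewrite -[X in _ --> nbhs X]add0r -[X in X + _](scale0r v).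
by apply: cvgD; [apply: cvgZr_tmp; exact: cvg_id|exact: cvg_cst].
Qed.

Lemma is_derive_coord {R : realType} n (x v : 'rV[R]_n) (i : 'I_n) :
  is_derive x v (fun z : 'rV[R]_n => z ord0 i) (v ord0 i).
Proof.
apply: is_derive_of_line.
have -> : (fun s : R => (x + s *: v) ord0 i) = (fun s : R => x ord0 i + v ord0 i * s).
  by apply/funext => s; rewrite !mxE mulrC.
have H : is_derive (0:R) (1:R) (fun s : R => s) 1 by exact: is_derive_id.
have := is_deriveDE (is_derive_cst (x ord0 i) (0:R) (1:R)) (is_deriveCE (v ord0 i) H).
by rewrite add0r mulr1.
Qed.

Section dotrV.
Context {R : realType} {n : nat}.
Implicit Types x y z : 'rV[R]_n.

Lemma dotrVC x y : dotrV x y = dotrV y x.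
Proof. by apply: eq_bigr => i _; rewrite mulrC. Qed.
Lemma dotrVDl x y z : dotrV (x + y) z = dotrV x z + dotrV y z.
Proof. by rewrite /dotrV -big_split /=; apply: eq_bigr => i _; rewrite mxE mulrDl. Qed.
Lemma dotrVZl (a : R) x y : dotrV (a *: x) y = a * dotrV x y.
Proof. by rewrite /dotrV mulr_sumr; apply: eq_bigr => i _; rewrite mxE mulrA. Qed.
Lemma dotrVNl x y : dotrV (- x) y = - dotrV x y.
Proof. by rewrite -scaleN1r dotrVZl mulN1r. Qed.
Lemma dotrVBl x y z : dotrV (x - y) z = dotrV x z - dotrV y z.
Proof. by rewrite dotrVDl dotrVNl. Qed.
Lemma dotrVDr x y z : dotrV z (x + y) = dotrV z x + dotrV z y.
Proof. by rewrite ![dotrV z _]dotrVC dotrVDl. Qed.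
Lemma dotrVZr (a : R) x y : dotrV y (a *: x) = a * dotrV y x.
Proof. by rewrite ![dotrV y _]dotrVC dotrVZl. Qed.
Lemma dotrVNr x y : dotrV y (- x) = - dotrV y x.
Proof. by rewrite ![dotrV y _]dotrVC dotrVNl. Qed.
Lemma dotrVBr x y z : dotrV z (x - y) = dotrV z x - dotrV z y.
Proof. by rewrite ![dotrV z _]dotrVC dotrVBl. Qed.

Lemma dotrV_delta x i : dotrV (delta_mx ord0 i) x = x ord0 i.
Proof.
rewrite /dotrV (bigD1 i)//= mxE !eqxx mul1r big1 ?addr0// => j ji.
by rewrite mxE (negbTE ji) mul0r.
Qed.

Lemma dotrV_le x y : `|dotrV x y| <= n%:R * (`|x| * `|y|).
Proof.
apply: le_trans (ler_norm_sum _ _ _) _.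
apply: (@le_trans _ _ (\sum_(i < n) `|x| * `|y|)).
  by apply: ler_sum => i _; rewrite normrM ler_pM// coord_le_norm.
by rewrite sumr_const card_ord mulr_natl.
Qed.

Lemma dotrV_continuous x : continuous (dotrV x : 'rV[R]_n -> R).
Proof. by apply: cont_sum => i; apply: contM; [exact: cont_cst|exact: cont_coord]. Qed.

End dotrV.

(** * Symmetry of second derivatives *)

Section smooth.
Context {R : realType} {n : nat}.
Implicit Types (f : 'rV[R]_n -> R) (x y v c : 'rV[R]_n).
Local Notation e_ i := (delta_mx (ord0 : 'I_1) i : 'rV[R]_n).

Lemma smooth_partial f i : smooth f -> smooth (partial i f).
Proof.
move=> sf s.
have -> : partials s (partial i f) = partials (rcons s i) f.
  by rewrite /partials foldr_rcons.
exact: sf.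
Qed.

Lemma smooth_C1 f : smooth f -> C1 f.
Proof. by move=> sf i; split; [exact: (sf [::]).2|exact: (sf [:: i]).1]. Qed.

(** The mean value theorem is applied twice: to the function y |-> f (y + t e_j) - f y along e_i,
    then to [partial i f] along e_j. *)
Let second_difference f (i j : 'I_n) x (t : R) : C1 f -> C1 (partial i f) ->
  exists2 y : 'rV[R]_n, `|y - x| <= 2 * `|t| &
    f (x + t *: e_ i + t *: e_ j) - f (x + t *: e_ i) - (f (x + t *: e_ j) - f x)
    = t * (t * (partial j (partial i f) y : R)) :> R.
Proof.
move=> Cf Cif.
pose g y := f (y + t *: e_ j) - f y.
have dg y : is_derive y (t *: e_ i) g (t * (partial i f (y + t *: e_ j) - partial i f y)).
  rewrite mulrBr; apply: is_deriveB; last first.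
    by apply: is_derive_scale; exact: (Cf i).1.
  by apply: is_derive_translate; apply: is_derive_scale; exact: (Cf i).1.
have [|s /andP[s0 s1]] := @MVT_line R _ g x (t *: e_ i).
  by move=> s _; case: (dg (x + s *: (t *: e_ i))).
rewrite {1 2}/g => ->.
have [_ ->] := dg (x + s *: (t *: e_ i)).
set z := x + _.
have dh y : is_derive y (t *: e_ j) (partial i f) (t * partial j (partial i f) y).
  by apply: is_derive_scale; exact: (Cif j).1.
have [|r /andP[r0 r1] ->] := @MVT_line R _ (partial i f) z (t *: e_ j).
  by move=> r _; case: (dh (z + r *: (t *: e_ j))).
have [_ ->] := dh (z + r *: (t *: e_ j)).
eexists; last by [].
rewrite /z -[x + _ + _]addrA [x + _]addrC addrK.
have le_e k (a : R) : 0 <= a <= 1 -> `|a *: (t *: e_ k)| <= `|t|.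
  move=> /andP[a0 a1]; apply: norm_le_coord => // l.
  rewrite !mxE eqxx /=; case: eqP => _; last by rewrite !mulr0 normr0.
  by rewrite mulr1 normrM ger0_norm// ler_piMl.
apply: le_trans (ler_normD _ _) _.
by rewrite mulr_natl mulr2n lerD// le_e// ?s0 ?r0.
Qed.

(** The second difference over a parallelogram is symmetric in i and j, and [second_difference]
    writes it as t^2 times either mixed derivative at a point within 2 |t| of x. Continuity
    concludes for small t. *)
Lemma partialC f i j x : C1 f -> C1 (partial i f) -> C1 (partial j f) ->
  partial i (partial j f) x = partial j (partial i f) x.
Proof.
move=> Cf Cif Cjf; apply/eqP; rewrite -subr_eq0 -normr_le0; apply/ler_addgt0Pr => e e0;
  rewrite add0r; apply/ltW.
have [_ /(_ x) /cvgrPdist_lt/(_ _ (divr_gt0 e0 (ltr0n R 2)))] := Cif j.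
have [_ /(_ x) /cvgrPdist_lt/(_ _ (divr_gt0 e0 (ltr0n R 2)))] := Cjf i.
move=> /nbhs_ballP[d1 /= d10 H1] /nbhs_ballP[d2 /= d20 H2].
have [t t0 td] : exists2 t : R, 0 < t & 2 * `|t| < Num.min d1 d2.
  have d0 : 0 < Num.min d1 d2 by rewrite lt_min d10 d20.
  exists (Num.min d1 d2 / 4); first by rewrite divr_gt0.
  by move: d0; set d := Num.min d1 d2 => d0; rewrite gtr0_norm ?divr_gt0//; clear -d0; lra.
have [y yt E1] := @second_difference f i j x t Cf Cif.
have [z zt E2] := @second_difference f j i x t Cf Cjf.
have E : partial j (partial i f) y = partial i (partial j f) z.
  have key (A B C D a b : R) : A - B - (C - D) = t * (t * a) ->
      A - C - (B - D) = t * (t * b) -> a = b.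
    move=> e1 e2; apply: (@mulfI _ t); first by rewrite gt_eqF.
    apply: (@mulfI _ t); first by rewrite gt_eqF.
    by rewrite -e1 -e2; ring.
  by apply: key E1 _; rewrite (addrAC x); exact: E2.
have B2 : `|partial j (partial i f) x - partial j (partial i f) y| < e / 2.
  apply: H2; rewrite -ball_normE /= distrC.
  by apply: le_lt_trans yt _; apply: lt_le_trans td _; rewrite ge_min lexx orbT.
have B1 : `|partial i (partial j f) x - partial i (partial j f) z| < e / 2.
  apply: H1; rewrite -ball_normE /= distrC.
  by apply: le_lt_trans zt _; apply: lt_le_trans td _; rewrite ge_min lexx.
rewrite E in B2; move: B1 B2; clear.
move: (partial i (partial j f) x) (partial i (partial j f) z) (partial j (partial i f) x).
move=> a b c ab cb; rewrite -(subrKA b); apply: le_lt_trans (ler_normD _ _) _.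
by rewrite (splitr e) ltrD// distrC.
Qed.

Lemma smooth_partialC f i j : smooth f ->
  partial i (partial j f) = partial j (partial i f).
Proof.
move=> sf; apply/funext => x.
have si := smooth_partial i sf; have sj := smooth_partial j sf.
exact: (partialC x (smooth_C1 sf) (smooth_C1 si) (smooth_C1 sj)).
Qed.

End smooth.

(** * Positive definite matrices *)

Section posdef.
Context {R : realType}.

Definition qform n (A : 'M[R]_n) (v : 'rV[R]_n) : R := (v *m A *m v^T) ord0 ord0.

Definition posdef n (A : 'M[R]_n) := forall v, v != 0 -> 0 < qform A v.

Lemma qformE n (A : 'M[R]_n) v :
  qform A v = \sum_i \sum_j v ord0 i * v ord0 j * A i j.
Proof.
rewrite /qform mxE exchange_big /=; apply: eq_bigr => j _.
rewrite !mxE mulr_suml; apply: eq_bigr => i _; ring.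
Qed.

(** If the form vanishes at v, its nonnegativity at v + t w for every t forces the cross term v A
    w^T to vanish for every w; hence v A = 0, and v = 0 by invertibility. *)
Lemma psd_posdef n (A : 'M[R]_n) : A^T = A -> (forall v, 0 <= qform A v) ->
  \det A != 0 -> posdef A.
Proof.
move=> As A0 dA v v0; rewrite lt_neqAle A0 andbT; apply: contraNneq v0 => /esym vA.
have cross (w : 'rV[R]_n) : (v *m A *m w^T) ord0 ord0 = 0.
  set c := _ ord0 ord0.
  have cs : (w *m A *m v^T) ord0 ord0 = c.
    rewrite /c -[in RHS](trmxK (v *m A *m w^T)) [RHS]mxE.
    by rewrite !trmx_mul trmxK As mulmxA.
  have H t : 0 <= 2 * t * c + t ^+ 2 * qform A w.
    have := A0 (v + t *: w); rewrite /qform linearD /= linearZ /= !mulmxDl !mulmxDr.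
    rewrite -!scalemxAl -!scalemxAr.
    have E (X Y Z T : 'M[R]_1) : (X + t *: Y + (t *: Z + t *: (t *: T))) ord0 ord0
       = X ord0 ord0 + t * Y ord0 ord0 + (t * Z ord0 ord0 + t * (t * T ord0 ord0)).
      by rewrite !mxE.
    rewrite E cs -/c -/(qform A v) vA add0r => H.
    apply: le_trans H _; rewrite le_eqVlt -/(qform A w); apply/orP; left; apply/eqP.
    ring.
  apply/eqP; apply: contraT => c0.
  have q0 := A0 w.
  (* This t makes the expression negative unless c = 0; q + 1 in place of q keeps the denominator
     positive when the form vanishes at w. *)
  have := H (- c / (qform A w + 1)).
  set q := qform A w in q0 *.
  have q1 : q + 1 != 0 by rewrite gt_eqF// ltr_wpDl.
  have -> : 2 * (- c / (q + 1)) * c + (- c / (q + 1)) ^+ 2 * q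
      = - (c ^+ 2 * (q + 2) / (q + 1) ^+ 2) by field.
  rewrite oppr_ge0 leNgt => /negP[]; apply: divr_gt0; last by rewrite exprn_gt0// ltr_wpDl.
  by apply: mulr_gt0; [rewrite exprn_even_gt0|rewrite ltr_wpDl].
have vA0 : v *m A = 0.
  apply/rowP => j; have := cross (delta_mx ord0 j).
  rewrite trmx_delta -colE mxE => ->.
  by rewrite !mxE.
have Au : A \in unitmx by rewrite unitmxE unitfE.
by rewrite -(mulmxK Au v) vA0 mul0mx.
Qed.

Lemma posdef_det_neq0 n (A : 'M[R]_n) : posdef A -> \det A != 0.
Proof.
move=> pA; apply/det0P => -[v v0 vA].
by have := pA v v0; rewrite /qform vA mul0mx mxE ltxx.
Qed.

(** Cholesky factorization by induction: [D'] is the Schur complement of the upper left entry a, and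
    it is again positive definite. *)
Lemma posdef_factor n (A : 'M[R]_n) : A^T = A -> posdef A ->
  exists B : 'M[R]_n, A = B *m B^T.
Proof.
elim: n A => [|n IH] A As pA.
  by exists 0; apply/matrixP => -[].
change 'M[R]_(1 + n) in A.
pose a := ulsubmx A ord0 ord0; pose b := ursubmx A; pose D := drsubmx A.
have Ae : A = block_mx a%:M b b^T D.
  rewrite -[LHS]submxK /b /D; congr block_mx.
    by rewrite -mx11_scalar.
  by rewrite trmx_ursub As.
have Ds : D^T = D by rewrite /D trmx_drsub As.
have a0 : 0 < a.
  have /pA : row_mx (1%:M : 'M[R]_1) (0 : 'rV[R]_n) != 0.
    apply/eqP => /rowP/(_ (lshift n ord0)); rewrite row_mxEl !mxE /= => /eqP.
    by rewrite oner_eq0.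
  rewrite /qform Ae (@mul_row_block _ 1 1 n 1 n) (@tr_row_mx _ 1 1 n) (@mul_row_col _ 1 1 n 1)
    trmx0 mulmx0 addr0 trmx1 mulmx1.
  by rewrite mul1mx mul0mx addr0 mxE eqxx.
pose D' := D - a^-1 *: (b^T *m b).
have D's : D'^T = D'.
  by rewrite /D' linearB /= linearZ /= trmx_mul trmxK Ds.
have pD' : posdef D'.
  move=> w w0.
  (* The first coordinate minimizes the form for a given w, and the minimum is the form of the Schur
     complement at w. *)
  pose v : 'rV[R]_(1 + n) := row_mx (- a^-1 *: (w *m b^T)) w.
  have v0 : v != 0.
    apply: contra_neq w0 => v0; have := congr1 rsubmx v0.
    by rewrite row_mxKr linear0.
  have := pA v v0; rewrite /qform Ae (@mul_row_block _ 1 1 n 1 n) (@tr_row_mx _ 1 1 n)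
    (@mul_row_col _ 1 1 n 1).
  rewrite mul_mx_scalar scalerA mulrN divff ?gt_eqF// scaleN1r addNr mul0mx add0r.
  suff -> : (- a^-1 *: (w *m b^T)) *m b + w *m D = w *m D' by [].
  by rewrite /D' mulmxBr -scalemxAl -scalemxAr scaleNr mulmxA addrC.
have [B' B'E] := IH _ D's pD'.
pose s := Num.sqrt a.
have s0 : s != 0 by rewrite gt_eqF// sqrtr_gt0.
have ss : s * s = a by rewrite -expr2 sqr_sqrtr// ltW.
pose P : 'M[R]_(1 + n) := block_mx s%:M 0 (s^-1 *: b^T) B'.
suff E : P *m P^T = block_mx a%:M b b^T D by exists P; exact: etrans Ae (esym E).
rewrite /P tr_block_mx mulmx_block; congr (block_mx _ _ _ _).
- by rewrite trmx0 mul0mx addr0 tr_scalar_mx -scalar_mxM ss.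
- by rewrite mul0mx addr0 linearZ /= trmxK mul_scalar_mx scalerA divff// scale1r.
- by rewrite trmx0 mulmx0 addr0 tr_scalar_mx mul_mx_scalar scalerA divff// scale1r.
- rewrite -B'E /D' linearZ /= trmxK -scalemxAl -scalemxAr scalerA -invfM ss.
  by rewrite addrC subrK.
Qed.

Lemma posdef_det_gt0 n (A : 'M[R]_n) : A^T = A -> posdef A -> 0 < \det A.
Proof.
move=> As pA; have := posdef_det_neq0 pA; have [B ->] := posdef_factor As pA.
by rewrite det_mulmx det_tr -expr2 => H; rewrite lt_neqAle eq_sym H sqr_ge0.
Qed.

Lemma invmx_sym n (A : 'M[R]_n) : A^T = A -> (invmx A)^T = invmx A.
Proof. by move=> As; rewrite trmx_inv As. Qed.

(** With A = B B^T and C = B^-1, the trace is the squared Frobenius norm of C M C^T. *)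
Lemma mxtrace_posdef_ge0 n (A M : 'M[R]_n) : A^T = A -> posdef A -> M^T = M ->
  0 <= \tr (invmx A *m M *m invmx A *m M).
Proof.
move=> As pA Ms; have := posdef_det_neq0 pA; have [B ->] := posdef_factor As pA.
rewrite det_mulmx det_tr mulf_eq0 orbb => dB.
have Bu : B \in unitmx by rewrite unitmxE unitfE.
have -> : invmx (B *m B^T) = (invmx B)^T *m invmx B.
  rewrite -[LHS]mulmx1 -[X in _ *m X = _](mulmxV Bu) .
  have BTu : B^T \in unitmx by rewrite unitmx_tr.
  have BBu : B *m B^T \in unitmx by rewrite unitmx_mul Bu.
  apply: (can_inj (mulKmx BBu)).
  by rewrite mulKVmx// -mulmxA trmx_inv (mulKVmx BTu).
set C := invmx B.
have -> : \tr (C^T *m C *m M *m (C^T *m C) *m M) = \tr ((C *m M *m C^T) *m (C *m M *m C^T)^T).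
  by rewrite !trmx_mul trmxK Ms -!mulmxA mxtrace_mulC !mulmxA.
rewrite /mxtrace sumr_ge0// => i _; rewrite mxE sumr_ge0// => j _.
by rewrite [X in _ * X]mxE -expr2 sqr_ge0.
Qed.

(** Nonnegativity of the trace form at W - T/2 absorbs the cross term at the cost of a quarter of
    tr(STST), and the term in q costs at most a half, so a quarter remains. *)
Lemma bochner_trace n (A W T : 'M[R]_n) (q : R) : A^T = A -> posdef A ->
  W^T = W -> T^T = T -> q <= \tr (invmx A *m T *m invmx A *m T) ->
  4^-1 * \tr (invmx A *m T *m invmx A *m T) <=
  \tr (invmx A *m W *m invmx A *m W) - \tr (invmx A *m W *m invmx A *m T)
  + \tr (invmx A *m T *m invmx A *m T) - 2^-1 * q.
Proof.
move=> As pA Ws Ts qT.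
have := @mxtrace_posdef_ge0 _ A (W + (- 2^-1) *: T) As pA.
rewrite linearD /= linearZ /= Ws Ts => /(_ erefl).
set S := invmx A in qT *.
rewrite -(mulmxA (S *m _)) mulmxDr -scalemxAr.
rewrite -!(mulmxA (S *m _)) in qT *.
set SW := S *m W; set ST := S *m T in qT *.
rewrite mulmxDl !mulmxDr -!scalemxAl -!scalemxAr !mxtraceD !mxtraceZ.
rewrite (mxtrace_mulC ST SW).
set a := \tr _; set b := \tr _; set c := \tr _ in qT *; lra.
Qed.

End posdef.

(** * The gradient map of a convex function and its inverse *)

Section critical.
Context {R : realType} {n : nat}.
Implicit Types (f : 'rV[R]_n -> R) (x y z v : 'rV[R]_n).

Lemma grad_at_min f y (r : R) : C1 f -> 0 < r ->
  (forall z, `|z - y| < r -> f y <= f z) -> grad f y = 0.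
Proof.
move=> Cf r0 ymin; apply/rowP => i; rewrite !mxE partialE.
have dt (t : R) : is_derive t 1 (fun s : R => f (y + s *: delta_mx ord0 i))
    (partial i f (y + t *: delta_mx ord0 i)).
  by rewrite partialE; apply: is_derive_line; exact: (Cf i).1.
have [_ d0] : is_derive (0:R) (1:R) (fun s : R => f (y + s *: delta_mx ord0 i)) 0.
  apply: (@derive1_at_min _ _ (- r) r).
  - by rewrite lerNl (@le_trans _ _ 0)// ?oppr_le0 ltW.
  - by move=> t _; case: (dt t).
  - by rewrite in_itv /= oppr_lt0 r0.
  - move=> t; rewrite in_itv /= => /andP[t1 t2].
    rewrite scale0r addr0; apply: ymin; rewrite addrAC subrr add0r.
    apply: (@le_lt_trans _ _ `|t|); last by rewrite ltr_norml t1.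
    apply: norm_le_coord => // j; rewrite !mxE eqxx /=.
    by case: eqP => _; rewrite ?mulr1// mulr0 normr0.
by have := dt 0; rewrite scale0r addr0 partialE => -[_ <-].
Qed.

Lemma cball_compact x (r : R) : compact [set z | `|z - x| <= r].
Proof.
apply: bounded_closed_compact.
  exists (r + `|x|); split; first by rewrite num_real.
  move=> M rM z /= zr; rewrite -(subrK x z); apply: le_trans (ler_normD _ _) _.
  by rewrite ltW//; apply: le_lt_trans rM; rewrite lerD2r.
rewrite (_ : [set _ | _] = (fun z => `|z - x|) @^-1` [set t | t <= r])//.
apply: closed_comp; last exact: closed_le.
by move=> z _; move: z; apply: cont_norm; apply: cont_sub_cst => z; exact: cvg_id.
Qed.

Lemma sphere_compact x (r : R) : compact [set z | `|z - x| = r].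
Proof.
apply: subclosed_compact (@cball_compact x r) _; last by move=> z /= ->.
rewrite (_ : [set _ | _] = (fun z => `|z - x|) @^-1` [set r])//.
apply: closed_comp; last exact: closed_eq.
by move=> z _; move: z; apply: cont_norm; apply: cont_sub_cst => z; exact: cvg_id.
Qed.

(** The minimum over the closed ball cannot lie on the sphere, where f exceeds its value at the
    centre. *)
Lemma critical_in_ball f y0 (r : R) : C1 f -> 0 < r ->
  (forall z, `|z - y0| = r -> f y0 < f z) ->
  exists2 y, `|y - y0| < r & grad f y = 0.
Proof.
move=> Cf r0 bd.
have [||y /set_mem /= yr ymin] := @EVT_min_rV R n f [set z | `|z - y0| <= r] _ (@cball_compact
  y0 r).
- by exists y0; rewrite /= subrr normr0 ltW.
- apply: continuous_subspaceT; exact: C1_continuous.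
have {}yr : `|y - y0| < r.
  rewrite lt_neqAle yr andbT; apply/negP => /eqP yE.
  have := ymin y0; rewrite inE /= subrr normr0 (ltW r0) => /(_ erefl).
  by rewrite leNgt bd.
exists y => //; apply: (@grad_at_min f y (r - `|y - y0|)) => //; first by rewrite subr_gt0.
move=> z zy; apply: ymin; rewrite inE /= -(subrKA y) ltW//.
by apply: le_lt_trans (ler_normD _ _) _; rewrite -ltrBrDr.
Qed.

(** Compactness of the sphere makes the strict inequality of [critical_in_ball] stable under small
    changes of the parameter. For phi c z = psi z - <c, z> this plays the part of the inverse
    function theorem for [grad psi]; it also applies when a slice of [psi] moves with the
    parameter. *)
Lemma critical_near (U : topologicalType) (phi : U -> 'rV[R]_n -> R) u0 y0 (r : R) :
  (forall u, C1 (phi u)) -> 0 < r ->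
  (forall z, (fun p : U * 'rV[R]_n => phi p.1 p.2) @ (u0, z) --> phi u0 z) ->
  (forall z, `|z - y0| = r -> phi u0 y0 < phi u0 z) ->
  \forall u \near u0, exists2 y, `|y - y0| < r & grad (phi u) y = 0.
Proof.
move=> Cphi r0 cphi bd.
have /compact_near_coveringP/(_ _ (nbhs u0)
   (fun u z => phi u y0 < phi u z)) := @sphere_compact y0 r.
have cu : phi u y0 @[u --> u0] --> phi u0 y0.
  have -> : (fun u => phi u y0) = (fun p : U * 'rV[R]_n => phi p.1 p.2) \o (fun u => (u, y0)) by [].
  by apply: cvg_comp (cphi y0); exact: (cvg_pair cvg_id (cvg_cst _)).
move=> /(_ (nbhs_filter u0)) NC.
have {}NC : \forall u \near u0, forall z, `|z - y0| = r -> phi u y0 < phi u z.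
  apply: NC => z /= zr; pose a := (phi u0 y0 + phi u0 z) / 2.
  have [a1 a2] : phi u0 y0 < a /\ a < phi u0 z by rewrite !midf_lt// bd.
  have N1 : \forall z' \near z & u \near u0, a < phi u z'.
    have /cvgr_gt/(_ a a2) := cphi z.
    case=> -[A B] /= [nA nB] AB; exists (B, A) => //= -[z' u] /= [Bz Au].
    exact: (AB (u, z')).
  have N2 : \forall z' \near z & u \near u0, phi u y0 < a.
    have /cvgr_lt/(_ a a1) N := cu.
    exists (setT, [set u | phi u y0 < a]) => /=; first by split => //; exact: filterT.
    by move=> [z' u] [].
  by apply: filterS2 N1 N2 => -[z' u] /= h1 h2; exact: lt_trans h2 h1.
move: NC; apply: filterS => u hu; apply: critical_in_ball => // z zr; exact: hu.
Qed.

End critical.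

Section strictly_convex.
Context {R : realType} {n : nat}.
Variable psi : 'rV[R]_n -> R.
Hypothesis sm : smooth psi.
Hypothesis pd : forall x, posdef (hess psi x).
Implicit Types x y z v c : 'rV[R]_n.

Lemma hess_sym x : (hess psi x)^T = hess psi x.
Proof. by apply/matrixP => i j; rewrite !mxE smooth_partialC. Qed.

Lemma is_derive_grad_dot x v w :
  is_derive x v (fun y => dotrV (grad psi y) w) (\sum_i dotrV v (grad (partial i psi) x) * w
    ord0 i).
Proof.
apply: is_derive_sumE => i.
have -> : (fun y => grad psi y ord0 i * w ord0 i) = (fun y => w ord0 i * partial i psi y).
  by apply/funext => y; rewrite mxE mulrC.
rewrite mulrC; apply: is_deriveCE; apply: C1_is_derive; apply: smooth_C1; exact: smooth_partial.
Qed.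

Lemma grad_mono x v : v != 0 -> 0 < dotrV (grad psi (x + v) - grad psi x) v.
Proof.
move=> v0; rewrite dotrVBl.
have [|t _ ->] := @MVT_line R _ (fun y => dotrV (grad psi y) v) x v.
  by move=> t _; case: (is_derive_grad_dot (x + t *: v) v v).
have [_ ->] := is_derive_grad_dot (x + t *: v) v v.
have := pd (x + t *: v) v0; rewrite qformE; congr (0 < _).
apply: eq_bigr => i _; rewrite /dotrV mulr_suml; apply: eq_bigr => j _.
by rewrite !mxE; ring.
Qed.

Lemma grad_inj : injective (grad psi).
Proof.
move=> x y E; apply/eqP; apply: contraT => xy.
have := @grad_mono x (y - x).
by rewrite subr_eq0 eq_sym xy [x + _]addrC subrK E subrr /dotrV big1 ?ltxx => [/(_ erefl)//|i
  _]; rewrite mxE mul0r.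
Qed.

Lemma tangent_le x v : psi x + dotrV (grad psi x) v <= psi (x + v).
Proof.
have [t /andP[t0 t1] E] := C1_MVT x v (smooth_C1 sm).
rewrite addrC -lerBrDr E dotrVC -subr_ge0 -dotrVBr.
have [->|v0] := eqVneq v 0; first by rewrite /dotrV big1// => i _; rewrite mxE mul0r.
move: t0; rewrite le_eqVlt => /predU1P[<-|t0].
  by rewrite scale0r addr0 subrr dotrVC /dotrV big1// => i _; rewrite mxE mul0r.
have := @grad_mono x (t *: v); rewrite scaler_eq0 negb_or gt_eqF// v0 => /(_ erefl).
by rewrite dotrVZr pmulr_rgt0// dotrVC => /ltW.
Qed.

(** Through the midpoint: the two tangent inequalities add up, and strict monotonicity of the
    gradient separates their slopes. *)
Lemma tangent_lt x v : v != 0 -> psi x + dotrV (grad psi x) v < psi (x + v).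
Proof.
move=> v0; pose w := 2^-1 *: v.
have w0 : w != 0 by rewrite scaler_eq0 negb_or v0 andbT invr_eq0.
have vw : v = w + w by rewrite /w -scalerDl -[2^-1]div1r -splitr scale1r.
have h1 := tangent_le (x + w) w; have h2 := tangent_le x w.
have := grad_mono x w0; rewrite dotrVBl subr_gt0 => h3.
rewrite {2}vw addrA; apply: lt_le_trans h1; rewrite vw dotrVDr addrA.
by apply: ler_ltD.
Qed.

Lemma sphere_gap y0 (r : R) : 0 < r -> exists2 m : R, 0 < m &
  forall z, `|z - y0| = r -> psi y0 + dotrV (grad psi y0) (z - y0) + m <= psi z.
Proof.
move=> r0.
(* In dimension 0 the sphere is empty and any positive gap serves. *)
have [[z0 z0r]|N] := pselect (exists z, `|z - y0| = r); last first.
  by exists 1 => // z zr; exfalso; apply: N; exists z.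
pose g z := psi z - dotrV (grad psi y0) (z - y0).
have cg : continuous g.
  apply: contB; first exact: C1_continuous (smooth_C1 sm).
  apply: (@cont_comp _ _ _ (fun z => z - y0) (dotrV (grad psi y0))).
    by apply: cont_sub_cst => z; exact: cvg_id.
  exact: dotrV_continuous.
have [||z /set_mem /= zr zmin] := @EVT_min_rV R n g [set z | `|z - y0| = r] _ (@sphere_compact
  _ _ y0 r).
- by exists z0.
- exact: continuous_subspaceT.
exists (g z - psi y0).
  rewrite /g addrAC -addrA -opprD subr_gt0 .
  have := @tangent_lt y0 (z - y0); rewrite -normr_gt0 zr => /(_ r0).
  by rewrite [y0 + _]addrC subrK addrC.
move=> z' /mem_set/zmin; rewrite /g => H.
rewrite [X in X <= _](_ : _ = (psi z - dotrV (grad psi y0) (z - y0)) +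
  dotrV (grad psi y0) (z' - y0)).
  by rewrite -lerBrDr.
by move: (dotrV _ _) (dotrV _ _) => a b; ring.
Qed.

Lemma C1_sub_dot c : C1 (fun z => psi z - dotrV c z) /\
  forall y, grad (fun z => psi z - dotrV c z) y = grad psi y - c.
Proof.
have d i y : is_derive y (delta_mx ord0 i) (fun z => psi z - dotrV c z)
    (partial i psi y - c ord0 i).
  apply: is_deriveBE.
    by rewrite partialE; apply/derivableP; exact: (smooth_C1 sm i).1.
  apply: (@is_derive_eq _ _ _ _ _ _ _ (\sum_j c ord0 j * (delta_mx ord0 i : 'rV[R]_n) ord0 j)).
    apply: is_derive_sumE => j; apply: is_deriveCE.
    exact: is_derive_coord.
  by rewrite -/(dotrV c _) dotrVC dotrV_delta.
have E i : partial i (fun z => psi z - dotrV c z) = fun y => partial i psi y - c ord0 i.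
  by apply/funext => y; rewrite partialE; case: (d i y).
split=> [i|y]; last by apply/rowP => i; rewrite !mxE E.
split; first by move=> x; case: (d i x).
rewrite E; apply: cont_sub_cst; exact: (smooth_C1 sm i).2.
Qed.

(** The critical points of psi - <c, .> are the preimages of c under the gradient. For c =
    [grad psi y0] the point y0 is a strict minimum, a situation that [critical_near] carries over to
    nearby c. *)
Lemma grad_open_near y0 (r : R) : 0 < r ->
  \forall c \near grad psi y0, exists2 y, `|y - y0| < r & grad psi y = c.
Proof.
move=> r0.
have N : \forall c \near grad psi y0, exists2 y,
  `|y - y0| < r & grad (fun z => psi z - dotrV c z) y = 0.
  apply: (@critical_near R n 'rV[R]_n (fun c z => psi z - dotrV c z)) => //.
  - by move=> c; exact: (C1_sub_dot c).1.
  - move=> z; have : continuous (fun p : 'rV[R]_n * 'rV[R]_n => psi p.2 - dotrV p.1 p.2).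
      apply: contB.
        apply: (@cont_comp _ _ _ snd psi); first by move=> p; exact: cvg_snd.
        exact: C1_continuous (smooth_C1 sm).
      apply: cont_sum => i; apply: contM.
        apply: (@cont_comp _ _ _ fst (fun c : 'rV[R]_n => c ord0 i)); first by move=> p;
          exact: cvg_fst.
        exact: cont_coord.
      apply: (@cont_comp _ _ _ snd (fun c : 'rV[R]_n => c ord0 i)); first by move=> p;
        exact: cvg_snd.
      exact: cont_coord.
    by move=> /(_ (grad psi y0, z)).
  - move=> z zr; rewrite ltrBrDr addrAC -addrA -dotrVBr.
    have := @tangent_lt y0 (z - y0); rewrite -normr_gt0 zr => /(_ r0).
    by rewrite [y0 + (_ - _)]addrC subrK.
move: N; apply: nbhs_imp => c -[y yr /eqP].
by rewrite (C1_sub_dot c).2 subr_eq0 => /eqP yc; exists y.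
Qed.

(** The first order expansion of the gradient map is read through the inverse Hessian, which
    isolates the displacement D of the preimage. *)
Lemma grad_inv_estimate y (e : R) : 0 < e -> exists2 d : R, 0 < d &
  forall D, `|D| < d ->
    `|(grad psi (y + D) - grad psi y) *m invmx (hess psi y) - D| <= e * `|D|.
Proof.
move=> e0; set S := invmx _.
(* C bounds right multiplication by S in the sup norm; the leading 1 keeps it positive. *)
pose C := 1 + \sum_k \sum_i `|S k i|.
have C0 : 0 < C.
  rewrite ltr_pwDl// sumr_ge0// => k _; rewrite sumr_ge0// => i _; exact: normr_ge0.
have mulS (w : 'rV[R]_n) : `|w *m S| <= C * `|w|.
  apply: norm_le_coord; first by rewrite mulr_ge0// ltW.
  move=> i; rewrite mxE; apply: le_trans (ler_norm_sum _ _ _) _.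
  rewrite mulrC; apply: (@le_trans _ _ (`|w| * \sum_k `|S k i|)).
    by rewrite mulr_sumr; apply: ler_sum => k _; rewrite normrM ler_wpM2r// coord_le_norm.
  rewrite ler_wpM2l// /C; apply: ler_wpDl => //; apply: ler_sum => k _.
  by rewrite (bigD1 i)//= lerDl sumr_ge0.
have : exists2 d : R, 0 < d & forall a D, `|D| < d ->
    `|partial a psi (y + D) - partial a psi y - dotrV D (grad (partial a psi) y)| <= e / C * `|D|.
  have : \forall d \near (0 : R)^'+, forall a D, `|D| < d ->
    `|partial a psi (y + D) - partial a psi y - dotrV D (grad (partial a psi) y)| <= e / C * `|D|.
    apply: filter_forall => a.
    have [d d0 dP] := C1_estimate y (smooth_C1 (smooth_partial a sm)) (divr_gt0 e0 C0).
    near=> r => D Dr; apply: dP; apply: lt_le_trans Dr _.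
    by near: r; exact: nbhs_right_le.
  move=> N; near (0 : R)^'+ => d; exists d => //.
  by near: d.
move=> [d d0 dP]; exists d => // D Dd.
have Hu : hess psi y \in unitmx by rewrite unitmxE unitfE posdef_det_neq0.
rewrite -[X in _ - X](mulmxK Hu) -mulmxBl.
apply: le_trans (mulS _) _.
rewrite mulrC -ler_pdivlMr// mulrAC; apply: norm_le_coord.
  by rewrite mulr_ge0// divr_ge0// ltW.
move=> a; rewrite !mxE; apply: le_trans (dP a D Dd).
rewrite le_eqVlt; apply/orP; left; apply/eqP; congr (`|_ - _|).
apply: eq_bigr => b _; rewrite [hess _ _ _ _]mxE [grad _ _ _ _]mxE.
by rewrite smooth_partialC.
Unshelve. all: by end_near. Qed.

Section inverse.
Variable T : 'rV[R]_n -> 'rV[R]_n.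
Hypothesis TK : forall y, T (grad psi y) = y.

Lemma inv_grad_cvg y : T @ grad psi y --> y.
Proof.
apply: cvg_dist => e e0; have := grad_open_near y e0.
apply: nbhs_imp => c [y' y'y <-].
by rewrite TK distrC.
Qed.

Lemma inv_grad_is_derive y v i :
  is_derive (grad psi y) v (fun c => T c ord0 i) ((v *m invmx (hess psi y)) ord0 i).
Proof.
set w := v *m _.
suff H : (fun h : R => h^-1 *: (((fun c => T c ord0 i) \o shift (grad psi y)) (h *: v) - T
  (grad psi y) ord0 i))
    @ 0^' --> w ord0 i.
  by apply: DeriveDef; [apply/cvg_ex; exists (w ord0 i)|exact: cvg_lim H].
apply/cvgrPdist_le => e e0.
(* The bound 1/2 lets |D| be absorbed, giving |D| <= 2 |h| |w|; the second bound then makes the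
   error at most e |h|. *)
pose e' := Num.min 2^-1 (e / (2 * (`|w| + 1))).
have w1 : 0 < `|w| + 1 by rewrite ltr_wpDl.
have e'0 : 0 < e' by rewrite lt_min invr_gt0 ltr0n divr_gt0// mulr_gt0.
have [d d0 dP] := grad_inv_estimate y e'0.
have Td : \forall h \near (0:R)^', `|y - T (h *: v + grad psi y)| < d.
  apply: (@near_line _ _ (fun c => `|y - T c| < d)).
  apply: nbhs_imp (grad_open_near y d0) => c [y' y'y <-].
  by rewrite TK distrC.
have Nr : \forall h \near (0 : R)^', exists y', h *: v + grad psi y = grad psi y'.
  apply: (@near_line _ _ (fun c => exists y', c = grad psi y')).
  by apply: nbhs_imp (grad_open_near y ltr01) => c [y' _ <-]; exists y'.
near=> h.
have h0 : h != 0 by near: h; exact: nbhs_dnbhs_neq.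
have [y' y'E] : exists y', h *: v + grad psi y = grad psi y' by near: h.
have : `|y - T (h *: v + grad psi y)| < d by near: h.
rewrite /= y'E !TK distrC => y'd.
have := dP _ y'd; rewrite [y + _]addrC subrK -y'E addrK -scalemxAl -/w.
set D := y' - y => est.
have Dle : `|D| <= 2 * (`|h| * `|w|).
  have : `|D| <= `|h| * `|w| + 2^-1 * `|D|.
    rewrite -{1}(subrKC (h *: w) D); apply: le_trans (ler_normD _ _) _.
    rewrite normrZ lerD// distrC; apply: le_trans est _.
    by rewrite ler_wpM2r// /e' ge_min lexx.
  by move: (`|D|) (`|h| * `|w|) => a b ab; lra.
have -> : w ord0 i - h^-1 *: (y' ord0 i - y ord0 i) = h^-1 * (h *: w - D) ord0 i.
  by rewrite !mxE mulrBr mulKf.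
rewrite normrM normfV mulrC ler_pdivrMr ?normr_gt0//.
apply: le_trans (coord_le_norm _ _) _; apply: le_trans est _.
apply: (@le_trans _ _ (e / (2 * (`|w| + 1)) * (2 * (`|h| * `|w|)))).
  by rewrite ler_pM// ?(ltW e'0)// /e' ge_min lexx orbT.
rewrite -(mulrA e) ler_pM2l// mulrC ler_pdivrMr ?mulr_gt0//.
by rewrite mulrCA ler_wpM2l// ler_pM2l// lerDl.
Unshelve. all: by end_near. Qed.

End inverse.

Lemma legendre_grad y : legendre psi (grad psi y) = dotrV (grad psi y) y - psi y.
Proof.
have ub : ubound [set dotrV (grad psi y) z - psi z | z in setT] (dotrV (grad psi y) y - psi y).
  move=> _ [z _ <-]; have := tangent_le y (z - y).
  rewrite [y + _]addrC subrK dotrVBr.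
  by move: (dotrV _ _) (dotrV _ _) => a b h; rewrite lerBlDr -addrA -lerBlDl; lra.
apply/eqP; rewrite eq_le /legendre; apply/andP; split.
  by apply: ge_sup => //; exists (dotrV (grad psi y) y - psi y), y.
by apply: ub_le_sup; [exists (dotrV (grad psi y) y - psi y)|exists y].
Qed.

Lemma legendre_le y z : dotrV (grad psi z - grad psi y) y <= legendre psi (grad psi z) -
  legendre psi (grad psi y).
Proof.
rewrite !legendre_grad dotrVBl.
have := tangent_le z (y - z); rewrite [z + _]addrC subrK dotrVBr.
move: (dotrV _ _) (dotrV _ _) (dotrV _ _) (psi y) (psi z) => a b c d e; lra.
Qed.

(** Two instances of [legendre_le] squeeze the difference quotient between the i-th coordinates of y
    and of the preimage [y'] of the shifted point, and [y'] tends to y by [grad_open_near]. *)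
Lemma grad_legendre y : grad (legendre psi) (grad psi y) = y.
Proof.
apply/rowP => i; rewrite mxE partialE.
suff H : (fun h : R => h^-1 *: ((legendre psi \o shift (grad psi y)) (h *: delta_mx ord0 i) -
  legendre psi (grad psi y)))
    @ 0^' --> y ord0 i by exact: cvg_lim H.
apply/cvgrPdist_le => e e0.
have N := grad_open_near y e0.
have {}N := near_line (delta_mx ord0 i) N.
near=> h.
have h0 : h != 0 by near: h; exact: nbhs_dnbhs_neq.
have [y' y'y y'E] : exists2 y', `|y' - y| < e & grad psi y' = h *: delta_mx ord0 i + grad psi y.
  by near: h; exact: N.
have dE z : dotrV (grad psi y' - grad psi y) z = h * z ord0 i.
  by rewrite y'E addrK dotrVZl dotrV_delta.
have l1 := legendre_le y y'; rewrite dE in l1.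
have l2 := legendre_le y' y; rewrite -opprB dotrVNl dE -[X in _ <= X]opprB lerN2 in l2.
have yi : `|y' ord0 i - y ord0 i| <= e.
  by apply: le_trans (ltW y'y); have := coord_le_norm (y' - y) i; rewrite !mxE.
rewrite /= -y'E; set L := _ - _ in l1 l2 *.
have -> : y ord0 i - h^-1 *: L = h^-1 * (h * y ord0 i - L) by rewrite mulrBr mulKf.
rewrite normrM normfV mulrC ler_pdivrMr ?normr_gt0//.
apply: (@le_trans _ _ (`|h * (y' ord0 i - y ord0 i)|)); last first.
  by rewrite normrM mulrC ler_wpM2r.
rewrite distrC mulrBr !ger0_norm ?subr_ge0//; last exact: le_trans l1 l2.
by rewrite lerD2r.
Unshelve. all: by end_near. Qed.

End strictly_convex.

(** * Bochner's formula *)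

Section matrix_calculus.
Context {R : realType}.

Lemma is_derive_prodE (V : normedModType R) n (F : 'I_n -> V -> R) x v (d : 'I_n -> R) :
  (forall i, is_derive x v (F i) (d i)) ->
  is_derive x v (fun y => \prod_(i < n) F i y)
    (\sum_(i < n) \prod_(j < n) (if j == i then d j else F j x)).
Proof.
elim: n F d => [|n IH] F d dF.
  rewrite big_ord0 (_ : (fun y => _) = cst 1); first exact: is_derive_cst.
  by apply/funext => y; rewrite big_ord0.
have -> : (fun y => \prod_(i < n.+1) F i y) =
    (fun y => F ord0 y * \prod_(i < n) F (lift ord0 i) y).
  by apply/funext => y; rewrite big_ord_recl.
have := is_deriveME (dF ord0) (IH _ _ (fun i => dF (lift ord0 i))).
move=> H; apply: (is_derive_eq H); rewrite big_ord_recl; congr (_ + _).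
  by rewrite big_ord_recl eqxx; congr (_ * _); apply: eq_bigr.
rewrite mulr_sumr; apply: eq_bigr => i _.
by rewrite big_ord_recl /=; congr (_ * _); apply: eq_bigr => j _.
Qed.

Lemma is_derive_bigsum (V : normedModType R) (I : Type) (r : seq I) (F : I -> V ->
  R) x v (d : I -> R) :
  (forall i, is_derive x v (F i) (d i)) ->
  is_derive x v (fun y => \sum_(i <- r) F i y) (\sum_(i <- r) d i).
Proof.
move=> dF; elim: r => [|i r IH].
  rewrite big_nil (_ : (fun y => _) = cst 0); first exact: is_derive_cst.
  by apply/funext => y; rewrite big_nil.
rewrite big_cons (_ : (fun y => _) = (fun y => F i y + \sum_(j <- r) F j y)).
  exact: is_deriveDE.
by apply/funext => y; rewrite big_cons.
Qed.

(** Jacobi's formula. In the Leibniz expansion, differentiating the factor of row i gives the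
    determinant with row i replaced by that of D, which is then expanded along this row. *)
Lemma is_derive_det (V : normedModType R) n (M : V -> 'M[R]_n) x v (D : 'M[R]_n) :
  (forall i j, is_derive x v (fun y => M y i j) (D i j)) ->
  is_derive x v (fun y => \det (M y)) (\tr (D *m \adj (M x))).
Proof.
move=> dM.
have := @is_derive_bigsum V _ (index_enum _) (fun (s : 'S_n) y => (-1) ^+ s * \prod_i M y i (s
  i)) x v _
  (fun s => is_deriveCE ((-1) ^+ s) (is_derive_prodE (fun i => dM i (s i)))).
move=> H; apply: (is_derive_eq H).
under eq_bigr do rewrite mulr_sumr.
rewrite exchange_big /=; apply: eq_bigr => i _.
pose Mi : 'M[R]_n := \matrix_(a, b) if a == i then D a b else M x a b.
transitivity (\det Mi).
  by apply: eq_bigr => s _; congr (_ * _); apply: eq_bigr => j _; rewrite mxE.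
rewrite (expand_det_row _ i) mxE; apply: eq_bigr => j _.
rewrite !mxE eqxx; congr (_ * _).
rewrite /cofactor; congr (_ * \det _); apply/matrixP => a b.
by rewrite !mxE eq_sym (negbTE (neq_lift _ _)).
Qed.

Lemma cont_det (T : topologicalType) n (M : T -> 'M[R]_n) :
  (forall i j, continuous (fun y => M y i j)) -> continuous (fun y => \det (M y)).
Proof.
move=> cM; apply: (continuous_big add_continuous) => s _.
apply: contM; first exact: cont_cst.
by apply: cont_prod => i; exact: cM.
Qed.

Lemma cont_invmx (T : topologicalType) n (M : T -> 'M[R]_n) i j :
  (forall y, \det (M y) != 0) ->
  (forall i j, continuous (fun y => M y i j)) -> continuous (fun y => invmx (M y) i j).
Proof.
move=> dM cM.
have -> : (fun y => invmx (M y) i j) = (fun y => (\det (M y))^-1 * cofactor (M y) j i).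
  by apply/funext => y; rewrite /invmx unitmxE unitfE dM !mxE.
apply: contM; first by apply: contV => //; exact: cont_det.
apply: contM; first exact: cont_cst.
apply: cont_det => a b.
have -> : (fun y => row' j (col' i (M y)) a b) = (fun y => M y (lift j a) (lift i b)).
  by apply/funext => y; rewrite !mxE.
exact: cM.
Qed.

Lemma is_derive_invmx (V : normedModType R) n (M : V -> 'M[R]_n) x v (D : 'M[R]_n) i j :
  (forall y, \det (M y) != 0) -> (forall i j, continuous (fun y => M y i j)) ->
  (forall i j, is_derive x v (fun y => M y i j) (D i j)) ->
  is_derive x v (fun y => invmx (M y) i j) (- (invmx (M x) *m D *m invmx (M x)) i j).
Proof.
move=> uM cM dM.
have Mu y : M y \in unitmx by rewrite unitmxE unitfE.
have E h : h^-1 *: (((fun y => invmx (M y) i j) \o shift x) (h *: v) - invmx (M x) i j) =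
   - \sum_k \sum_l invmx (M (h *: v + x)) i l *
       (h^-1 *: (((fun y => M y l k) \o shift x) (h *: v) - M x l k)) * invmx (M x) k j.
  (* Resolvent identity B^-1 - A^-1 = - B^-1 (B - A) A^-1; in the limit it only calls for continuity
     of the inverse. *)
  have -> : invmx (M (h *: v + x)) i j - invmx (M x) i j =
      - (invmx (M (h *: v + x)) *m (M (h *: v + x) - M x) *m invmx (M x)) i j.
    by rewrite mulmxBr mulmxBl mulVmx// mul1mx mulmxK// !mxE opprB.
  rewrite scalerN; congr (- _); rewrite mxE scaler_sumr; apply: eq_bigr => k _.
  rewrite mxE mulr_suml scaler_sumr; apply: eq_bigr => l _.
  rewrite !mxE /GRing.scale /=; ring.
suff H : (fun h : R => h^-1 *: (((fun y => invmx (M y) i j) \o shift x) (h *: v) - invmx (M x) i j))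
    @ 0^' --> - (invmx (M x) *m D *m invmx (M x)) i j.
  by apply: DeriveDef; [apply/cvg_ex; eexists; exact: H|exact: cvg_lim H].
under eq_fun do rewrite E.
rewrite mxE; apply: cvgN; apply: (cvg_big add_continuous) => k _.
rewrite mxE mulr_suml; apply: (cvg_big add_continuous) => l _.
apply: cvgMr_tmp; apply: cvgM.
  have := @cont_invmx V n M i l uM cM x => /cvgrPdist_lt H.
  by apply/cvgrPdist_lt => e e0; apply: (@near_line _ _ (fun y => `|invmx (M x) i l - invmx (M
    y) i l| < e)); exact: H.
by case: (dM l k) => d <-; exact: d.
Qed.

End matrix_calculus.

Lemma is_derive_compR {R : realType} {V : normedModType R} (f : V -> R) (h : R -> R) x v (d a : R) :
  is_derive x v f d -> is_derive (f x) 1 h a -> is_derive x v (fun y => h (f y)) (a * d).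
Proof.
move=> [df dfE] dh; apply: is_derive_of_line.
apply: (@is_derive1_comp R h (fun s : R => f (x + s *: v)) 0).
  by rewrite scale0r addr0.
have := @is_derive_line R V f x v 0; rewrite scale0r addr0 dfE; exact.
Qed.

Section second_derivative.
Context {R : realType} {V : normedModType R}.

(** If a were negative, g would lie strictly below g x after x and strictly above it before x. The
    increments of f over the two steps next to x would then contradict the midpoint inequality. *)
Lemma second_deriv_ge0 (f g : V -> R) x v (a : R) :
  (forall y, is_derive y v f (g y)) -> is_derive x v g a ->
  (forall t : R, 2 * f x <= f (x + t *: v) + f (x - t *: v)) -> 0 <= a.
Proof.
move=> df [dg1 dg2] conv; rewrite leNgt; apply/negP => a0.
have {dg1 dg2} dg : (fun h : R => h^-1 *: ((g \o shift x) (h *: v) - g x)) @ 0^' --> a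
  by rewrite -dg2.
have /cvgr_lt/(_ 0 a0) [d /= d0 dP] := dg.
have lt_g (t : R) : 0 < t -> t < d -> g (x + t *: v) < g x /\ g x < g (x - t *: v).
  move=> t0 td; split.
    have := dP t; rewrite /= sub0r normrN gtr0_norm// => /(_ td); rewrite gt_eqF// => /(_ erefl).
    by rewrite [t *: v + x]addrC [_ *: _]mulrC pmulr_llt0 ?invr_gt0// subr_lt0.
  have := dP (- t); rewrite /= sub0r normrN normrN gtr0_norm// => /(_ td);
    rewrite oppr_eq0 gt_eqF// => /(_ erefl).
  by rewrite [- t *: v + x]addrC scaleNr [_ *: _]mulrC nmulr_llt0 ?invr_lt0 ?oppr_lt0// subr_gt0.
pose t := d / 2.
have t0 : 0 < t by rewrite divr_gt0.
have td : t < d by rewrite ltr_pdivrMr// ltr_pMr// ltr1n.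
have dl y (s : R) : is_derive s 1 (fun s : R => f (y + s *: v)) (g (y + s *: v)).
  by have [d1 d2] := df (y + s *: v); rewrite -d2; exact: is_derive_line.
have mvt y : exists2 c, 0 < c < t & f (y + t *: v) - f y = g (y + c *: v) * t.
  have cl : {within `[0, t], continuous (fun s : R => f (y + s *: v))}.
    by apply: derivable_within_continuous => s _; case: (dl y s).
  have [c] := @MVT R (fun s : R => f (y + s *: v)) (fun s => g (y + s *: v)) 0 t t0
    (fun s _ => dl y s) cl.
  by rewrite in_itv /= subr0 scale0r addr0 => c0t E; exists c.
have [c1 /andP[c10 c1t] E1] := mvt x.
have [c2 /andP[c20 c2t]] := mvt (x - t *: v).
have -> : x - t *: v + c2 *: v = x - (t - c2) *: v by rewrite scalerBl opprB addrA addrAC.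
rewrite subrK => E2.
have := conv t.
have h1 : g (x + c1 *: v) * t < g x * t by rewrite ltr_pM2r//; apply: (lt_g _ _ _).1 => //;
  exact: lt_trans td.
have h2 : g x * t < g (x - (t - c2) *: v) * t.
  rewrite ltr_pM2r//; apply: (lt_g _ _ _).2; first by rewrite subr_gt0.
  by apply: lt_trans td; rewrite ltrBlDr ltrDl.
rewrite -E1 in h1; rewrite -E2 in h2.
move: (f (x + _)) (f (x - _)) (f x) (g x * t) h1 h2 => A B C D; clear => *; lra.
Qed.

End second_derivative.

Lemma mxB_entry {R : realType} m n (A B : 'M[R]_(m, n)) i j : (A - B) i j = A i j - B i j.
Proof. by rewrite !mxE. Qed.

(* Sealed copies of the differential operators: otherwise failing unification
   attempts unfold nested [partial] down to the definition of limits. *)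
Fact seal_key T (x : T) : {y : T | y = x}.
Proof. by exists x. Qed.

Definition seal T (x : T) : T := sval (seal_key x).

Lemma sealE T (x : T) : seal x = x.
Proof. exact: svalP (seal_key x). Qed.

Section bochner_defs.
Context {R : realType} {n : nat}.
Implicit Types (psi u : 'rV[R]_n -> R) (x : 'rV[R]_n).
Local Notation e_ k := (delta_mx (ord0 : 'I_1) k : 'rV[R]_n).

Definition pd : 'I_n -> ('rV[R]_n -> R) -> 'rV[R]_n -> R := seal (@partial R n).

Lemma pdE : @partial R n = pd.
Proof. by rewrite /pd sealE. Qed.

Lemma smooth_pd u i : smooth u -> smooth (pd i u).
Proof. by rewrite -pdE; exact: smooth_partial. Qed.

Lemma smooth_pdC u i j : smooth u -> pd i (pd j u) = pd j (pd i u).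
Proof. by rewrite -pdE; exact: smooth_partialC. Qed.

Lemma smooth_continuous u : smooth u -> continuous u.
Proof. by move=> /smooth_C1/C1_continuous. Qed.

Lemma smooth_is_derive u (i : 'I_n) x : smooth u -> is_derive x (e_ i) u (pd i u x).
Proof. by move=> su; rewrite -pdE partialE; apply/derivableP; exact: (smooth_C1 su i).1. Qed.

Lemma gradE u x i : grad u x ord0 i = pd i u x.
Proof. by rewrite mxE pdE. Qed.

Lemma smooth_pd3_rev u a b c : smooth u -> pd a (pd b (pd c u)) = pd c (pd b (pd a u)).
Proof.
move=> su; rewrite (smooth_pdC b c su) (smooth_pdC a c (smooth_pd b su)).
by rewrite (smooth_pdC a b su).
Qed.

Lemma smooth_pd4_rev u a b c d : smooth u ->
  pd a (pd b (pd c (pd d u))) = pd d (pd c (pd b (pd a u))).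
Proof.
move=> su; rewrite (smooth_pd3_rev a b c (smooth_pd d su)).
rewrite (smooth_pdC a d su) (smooth_pdC b d (smooth_pd a su)).
by rewrite (smooth_pdC c d (smooth_pd b (smooth_pd a su))).
Qed.

Definition hs : ('rV[R]_n -> R) -> 'rV[R]_n -> 'M[R]_n := seal (@hess R n).

Lemma hessEs : @hess R n = hs.
Proof. by rewrite /hs sealE. Qed.

Lemma hsE u x i j : hs u x i j = pd j (pd i u) x.
Proof. by rewrite -hessEs mxE pdE. Qed.

Lemma hs_sym u x : smooth u -> (hs u x)^T = hs u x.
Proof. by move=> su; apply/matrixP => i j; rewrite mxE !hsE smooth_pdC. Qed.

Definition hess3 : ('rV[R]_n -> R) -> 'I_n -> 'rV[R]_n -> 'M[R]_n :=
  seal (fun psi a x => \matrix_(i, j) pd a (pd j (pd i psi)) x).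

Lemma hess3E psi a x i j : hess3 psi a x i j = pd a (pd j (pd i psi)) x.
Proof. by rewrite /hess3 sealE mxE. Qed.

Lemma hess3_sym psi a x : smooth psi -> (hess3 psi a x)^T = hess3 psi a x.
Proof. by move=> sm; apply/matrixP => i j; rewrite mxE !hess3E (smooth_pdC _ _ sm). Qed.

Lemma hess3_perm psi a i j x : smooth psi -> hess3 psi a x i j = hess3 psi i x a j.
Proof.
move=> sm; rewrite !hess3E.
rewrite (smooth_pdC a j (smooth_pd i sm)) (smooth_pdC i j (smooth_pd a sm)).
by rewrite (smooth_pdC a i sm).
Qed.

(** The third derivative of [psi] contracted with v, that is, the derivative of the Hessian along v.
    For v the Riemannian gradient of u it is the matrix T of Bochner's formula. *)
Definition hess_dir : ('rV[R]_n -> R) -> 'rV[R]_n -> 'rV[R]_n -> 'M[R]_n :=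
  seal (fun psi x v => \matrix_(i, j) \sum_(c < n) v ord0 c * hess3 psi c x i j).

Lemma hess_dirE psi x v i j : hess_dir psi x v i j = \sum_(c < n) v ord0 c * hess3 psi c x i j.
Proof. by rewrite /hess_dir sealE mxE. Qed.

Lemma hess_dir_sym psi x v : smooth psi -> (hess_dir psi x v)^T = hess_dir psi x v.
Proof.
move=> sm; apply/matrixP => i j; rewrite mxE !hess_dirE.
by apply: eq_bigr => c _; rewrite -{1}(hess3_sym c x sm) mxE.
Qed.

Lemma mul_hess3 psi x v a i : smooth psi -> (v *m hess3 psi a x) ord0 i = hess_dir psi x v a i.
Proof.
by move=> sm; rewrite mxE hess_dirE; apply: eq_bigr => c _; rewrite [in RHS]hess3_perm.
Qed.

Definition hsI : ('rV[R]_n -> R) -> 'rV[R]_n -> 'M[R]_n := seal (fun psi x => invmx (hs psi x)).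

Lemma hsIE psi x : invmx (hs psi x) = hsI psi x.
Proof. by rewrite /hsI sealE. Qed.

Definition riem_grad : ('rV[R]_n -> R) -> ('rV[R]_n -> R) -> 'rV[R]_n -> 'rV[R]_n :=
  seal (fun psi u x => grad u x *m hsI psi x).

Lemma riem_gradEm psi u x : riem_grad psi u x = grad u x *m hsI psi x.
Proof. by rewrite /riem_grad sealE. Qed.

Lemma riem_gradE psi u x a : riem_grad psi u x ord0 a = \sum_(j < n) pd j u x * hsI psi x j a.
Proof. by rewrite riem_gradEm mxE; apply: eq_bigr => j _; rewrite gradE. Qed.

End bochner_defs.

(** * The Bochner identity for the Hessian metric and the resulting bound on Q *)

Section bochner.
Context {R : realType} {n : nat}.
Variable psi : 'rV[R]_n -> R.
Hypothesis sm : smooth psi.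
Hypothesis rho_gt0 : forall x, 0 < rho psi x.
Implicit Types (x y v : 'rV[R]_n) (u : 'rV[R]_n -> R).
Local Notation e_ k := (delta_mx (ord0 : 'I_1) k : 'rV[R]_n).
Local Notation S x := (hsI psi x).
Local Notation D3 := (hess3 psi).
Local Notation Vf := (riem_grad psi).
Local Notation T u x := (hess_dir psi x (riem_grad psi u x)).

Lemma hess_unit x : hs psi x \in unitmx.
Proof. by rewrite unitmxE unitfE -hessEs gt_eqF// rho_gt0. Qed.

Lemma cont_hess_entry i j : continuous (fun y => hs psi y i j).
Proof.
have -> : (fun y => hs psi y i j) = pd j (pd i psi) by apply/funext => y; rewrite hsE.
by apply: smooth_continuous; do 2 apply: smooth_pd.
Qed.

Lemma is_derive_hessI i j a x :
  is_derive x (e_ a) (fun y => S y i j) (- (S x *m D3 a x *m S x) i j).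
Proof.
have -> : (fun y => S y i j) = fun y => invmx (hs psi y) i j by apply/funext => y; rewrite hsIE.
rewrite -!hsIE; apply: is_derive_invmx.
- by move=> y; rewrite -hessEs gt_eqF// rho_gt0.
- exact: cont_hess_entry.
- move=> k l; rewrite hess3E.
  have -> : (fun y => hs psi y k l) = pd l (pd k psi) by apply/funext => y; rewrite hsE.
  by apply: smooth_is_derive; do 2 apply: smooth_pd.
Qed.

Lemma hessI_sym x : (S x)^T = S x.
Proof. by rewrite -hsIE invmx_sym// hs_sym. Qed.

(** The inverse Hessian S has derivative - S D3 S, and the contraction of D3 with grad u S = V is
    the matrix T. *)
Lemma is_derive_riem_grad u a l x : smooth u ->
  is_derive x (e_ l) (fun y => Vf u y ord0 a) (((hs u x - T u x) *m S x) l a).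
Proof.
move=> su.
have -> : (fun y => Vf u y ord0 a) = (fun y => \sum_(j < n) pd j u y * S y j a).
  by apply/funext => y; rewrite riem_gradE.
have := is_derive_sumE (fun j => is_deriveME (smooth_is_derive l x (smooth_pd j su))
  (is_derive_hessI j a l x)).
move=> H; apply: (is_derive_eq H); rewrite big_split /= mulmxBl mxB_entry.
congr (_ + _).
  by rewrite mxE; apply: eq_bigr => j _; rewrite hsE smooth_pdC.
transitivity (- (grad u x *m (S x *m D3 l x *m S x)) ord0 a).
  by rewrite [in RHS]mxE -sumrN; apply: eq_bigr => j _; rewrite mulrN gradE.
congr (- _); rewrite mulmxA [grad u x *m _]mulmxA -riem_gradEm mxE [RHS]mxE.
by apply: eq_bigr => i _; rewrite mul_hess3.
Qed.

Lemma gradprodE u h x : gradprod psi u h x = \sum_(a < n) Vf u x ord0 a * pd a h x.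
Proof.
rewrite /gradprod exchange_big /=; apply: eq_bigr => j _.
by rewrite riem_gradE mulr_suml; apply: eq_bigr => i _; rewrite pdE hessEs hsIE [_ * pd i u x]mulrC.
Qed.

Lemma is_derive_gradprod u k x : smooth u -> is_derive x (e_ k) (gradprod psi u u)
  (2 * (\sum_(a < n) Vf u x ord0 a * pd k (pd a u) x)
   - \sum_(a < n) Vf u x ord0 a * T u x k a).
Proof.
move=> su.
have -> : gradprod psi u u = fun y => \sum_(a < n) Vf u y ord0 a * pd a u y.
  by apply/funext => y; rewrite gradprodE.
have := is_derive_sumE (fun a => is_deriveME (is_derive_riem_grad a k x su) (smooth_is_derive k
  x (smooth_pd a su))).
move=> H; apply: (is_derive_eq H); rewrite big_split /=.
have -> : \sum_(i < n) ((hs u x - T u x) *m S x) k i * pd i u x =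
   \sum_(a < n) Vf u x ord0 a * (pd k (pd a u) x - T u x k a).
  transitivity (((hs u x - T u x) *m (Vf u x)^T) k ord0).
    rewrite riem_gradEm trmx_mul hessI_sym mulmxA [RHS]mxE; apply: eq_bigr => i _.
    by rewrite [(grad u x)^T _ _]mxE gradE.
  rewrite mxE; apply: eq_bigr => a _.
  rewrite mulrC [_^T _ _]mxE; congr (_ * _).
  by rewrite mxB_entry hsE smooth_pdC.
rewrite mulr_sumr -sumrB -big_split /=.
by apply: eq_bigr => a _; move: (pd _ _ _) (Vf _ _ _ _) (T _ _ _ _) => p q r; ring.
Qed.

Lemma is_derive_gradprod2 u k l x : smooth u -> is_derive x (e_ l) (pd k (gradprod psi u u))
  (2 * (\sum_(a < n) (((hs u x - T u x) *m S x) l a * pd k (pd a u) x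
        + Vf u x ord0 a * pd l (pd k (pd a u)) x))
   - \sum_(a < n) \sum_(b < n)
      ((Vf u x ord0 a * Vf u x ord0 b) * pd l (pd k (pd a (pd b psi))) x
       + 2 * (((hs u x - T u x) *m S x) l a * (Vf u x ord0 b * pd k (pd a (pd b psi)) x)))).
Proof.
move=> su.
have -> : pd k (gradprod psi u u) = fun y =>
  2 * (\sum_(a < n) Vf u y ord0 a * pd k (pd a u) y)
   - \sum_(a < n) \sum_(b < n) (Vf u y ord0 a * Vf u y ord0 b) * pd k (pd a (pd b psi)) y.
  apply/funext => y; have [_] := is_derive_gradprod k y su.
  rewrite -[LHS]partialE pdE => ->.
  transitivity (2 * (\sum_(a < n) Vf u y ord0 a * pd k (pd a u) y) - \sum_(a < n) Vf u y ord0 a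
    * T u y k a) => //.
  congr (_ - _); apply: eq_bigr => a _; rewrite hess_dirE mulr_sumr; apply: eq_bigr => b _.
  by rewrite hess3E mulrA smooth_pd3_rev.
apply: is_deriveBE.
  apply: is_deriveCE; apply: is_derive_sumE => a; apply: is_deriveME.
    exact: is_derive_riem_grad.
  by apply: smooth_is_derive; do 2 apply: smooth_pd.
have H := is_derive_sumE (fun a => is_derive_sumE (fun b => is_deriveME
  (is_deriveME (is_derive_riem_grad a l x su) (is_derive_riem_grad b l x su))
  (smooth_is_derive l x (smooth_pd k (smooth_pd a (smooth_pd b sm)))))).
apply: (is_derive_eq H).
set X := (hs u x - T u x) *m S x.
have -> : \sum_(a < n) \sum_(b < n) ((X l a * Vf u x ord0 b + Vf u x ord0 a * X l b) *
     pd k (pd a (pd b psi)) x +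
     Vf u x ord0 a * Vf u x ord0 b * pd l (pd k (pd a (pd b psi))) x)
  = \sum_(a < n) \sum_(b < n) (X l a * (Vf u x ord0 b * pd k (pd a (pd b psi)) x))
  + (\sum_(a < n) \sum_(b < n) (X l b * (Vf u x ord0 a * pd k (pd a (pd b psi)) x))
  + \sum_(a < n) \sum_(b < n) Vf u x ord0 a * Vf u x ord0 b * pd l (pd k (pd a (pd b psi))) x).
  rewrite -!big_split; apply: eq_bigr => a _ /=; rewrite -!big_split; apply: eq_bigr => b _ /=.
  by move: (pd _ _ _) (pd _ _ _) (X _ _) (X _ _) (Vf _ _ _ _) (Vf _ _ _ _) => p q r s t w; ring.
(* The two sums in which one of the factors V is differentiated coincide after exchanging a and b,
   by symmetry of the third derivative; hence the factor 2. *)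
rewrite [X in _ + (X + _)]exchange_big /=.
rewrite -!big_split; apply: eq_bigr => a _ /=; rewrite -!big_split; apply: eq_bigr => b _ /=.
rewrite (smooth_pdC a b sm).
by move: (pd _ _ _) (pd _ _ _) (X _ _) (Vf _ _ _ _) (Vf _ _ _ _) => p q r s t; ring.
Qed.

Lemma is_derive_laplacian u a x : smooth u -> is_derive x (e_ a) (laplacian psi u)
  (\sum_(k < n) \sum_(l < n) (S x k l * pd a (pd l (pd k u)) x
     - (S x *m D3 a x *m S x) k l * hs u x k l)).
Proof.
move=> su.
have -> : laplacian psi u = fun y => \sum_(k < n) \sum_(l < n) S y k l * pd l (pd k u) y.
  by apply/funext => y; rewrite /laplacian pdE hessEs hsIE.
have H := is_derive_sumE (fun k => is_derive_sumE (fun l => is_deriveME (is_derive_hessI k l a x)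
  (smooth_is_derive a x (smooth_pd l (smooth_pd k su))))).
apply: (is_derive_eq H); apply: eq_bigr => k _; apply: eq_bigr => l _.
by rewrite hsE mulNr addrC.
Qed.

Definition gamma2 u x := 2^-1 * laplacian psi (gradprod psi u u) x - gradprod psi u (laplacian
  psi u) x.

(** The fourth derivative of [psi], contracted twice with v and traced with the inverse Hessian: the
    only term of Bochner's formula that has no sign by itself, and the one that log-concavity
    controls. *)
Definition hess4_trace x v := \sum_(k < n) \sum_(l < n) S x k l *
  \sum_(a < n) \sum_(b < n) v ord0 a * v ord0 b * pd l (pd k (pd a (pd b psi))) x.

(** Third derivatives of u occur in both halves of [gamma2], through the same sum [D3u], and cancel.
    What remains is quadratic in W and T, apart from the fourth derivative of [psi]. *)
Lemma bochner_formula u x : smooth u ->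
  gamma2 u x = \tr (S x *m hs u x *m S x *m hs u x) - \tr (S x *m hs u x *m S x *m T u x)
   + \tr (S x *m T u x *m S x *m T u x) - 2^-1 * hess4_trace x (Vf u x).
Proof.
move=> su; set W := hs u x; set Tx := T u x; set Sx := S x; set V := Vf u x.
have Ws : W^T = W by exact: hs_sym.
have Ts : Tx^T = Tx by exact: hess_dir_sym.
have Ss : Sx^T = Sx by exact: hessI_sym.
(* By [is_derive_riem_grad], X l a is the derivative of the a-th coordinate of V in direction l. *)
pose X := (W - Tx) *m Sx.
pose D3u := \sum_(k < n) \sum_(l < n) Sx k l * \sum_(a < n) V ord0 a * pd a (pd l (pd k u)) x.
have trE (A B : 'M[R]_n) : B^T = B -> \tr (A *m B) = \sum_(k < n) \sum_(l < n) A k l * B k l.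
  move=> Bs; apply: eq_bigr => k _; rewrite mxE; apply: eq_bigr => l _.
  by rewrite -{1}Bs mxE.
have E1 : laplacian psi (gradprod psi u u) x =
    2 * \tr (Sx *m (X *m (W - Tx))) + 2 * D3u - hess4_trace x V.
  rewrite /laplacian pdE hessEs hsIE -/Sx /D3u /hess4_trace.
  have -> : \tr (Sx *m (X *m (W - Tx))) = \sum_(k < n) \sum_(l < n) Sx k l * (X *m (W - Tx)) l k.
    by apply: eq_bigr => k _; rewrite mxE.
  rewrite !mulr_sumr -big_split -sumrB; apply: eq_bigr => k _ /=.
  rewrite !mulr_sumr -big_split -sumrB; apply: eq_bigr => l _ /=.
  have -> : pd l (pd k (gradprod psi u u)) x =
    2 * (\sum_(a < n) (X l a * pd k (pd a u) x + V ord0 a * pd l (pd k (pd a u)) x))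
   - \sum_(a < n) \sum_(b < n)
      ((V ord0 a * V ord0 b) * pd l (pd k (pd a (pd b psi))) x
       + 2 * (X l a * (V ord0 b * pd k (pd a (pd b psi)) x))).
    have [_] := is_derive_gradprod2 k l x su.
    by rewrite -[LHS]partialE pdE => ->.
  have -> : (X *m (W - Tx)) l k = \sum_(a < n) X l a * pd k (pd a u) x -
      \sum_(a < n) \sum_(b < n) X l a * (V ord0 b * pd k (pd a (pd b psi)) x).
    rewrite mulmxBr mxB_entry !mxE; congr (_ - _); apply: eq_bigr => a _; first by rewrite hsE.
    rewrite /Tx -mulr_sumr; congr (_ * _).
    rewrite -{1}(hess_dir_sym x V sm) mxE hess_dirE; apply: eq_bigr => b _; congr (_ * _).
    rewrite (hess3_perm _ _ _ _ sm) hess3E.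
    by rewrite (smooth_pdC b k (smooth_pd a sm)) (smooth_pdC a b sm) || idtac.
  rewrite big_split /=.
  have -> : \sum_(a < n) V ord0 a * pd l (pd k (pd a u)) x = \sum_(a < n) V ord0 a * pd a (pd l
    (pd k u)) x.
    apply: eq_bigr => a _; congr (_ * _).
    by rewrite (smooth_pdC k a su) (smooth_pdC l a (smooth_pd k su)).
  under [X in _ - X]eq_bigr do rewrite big_split /= -mulr_sumr.
  rewrite big_split /= -mulr_sumr.
  by move: (\sum_(a < n) _) (\sum_(a < n) _) (\sum_(a < n) _) (\sum_(a < n) _) (Sx k l) => p q
    r s t; ring.
have E2 : gradprod psi u (laplacian psi u) x = D3u - \tr (Sx *m Tx *m Sx *m W).
  rewrite gradprodE -/V (trE _ _ Ws).
  have -> : \sum_(k < n) \sum_(l < n) (Sx *m Tx *m Sx) k l * W k l =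
     \sum_(a < n) V ord0 a * \sum_(k < n) \sum_(l < n) (Sx *m D3 a x *m Sx) k l * W k l.
    under [RHS]eq_bigr do rewrite mulr_sumr.
    rewrite [RHS]exchange_big /=; apply: eq_bigr => k _.
    under [RHS]eq_bigr do rewrite mulr_sumr.
    rewrite [RHS]exchange_big /=; apply: eq_bigr => l _.
    under [RHS]eq_bigr do rewrite mulrA.
    rewrite -mulr_suml; congr (_ * _).
    have -> : Tx = \sum_(a < n) V ord0 a *: D3 a x.
      apply/matrixP => i j; rewrite hess_dirE summxE; apply: eq_bigr => a _.
      by rewrite mxE.
    rewrite mulmx_sumr mulmx_suml summxE; apply: eq_bigr => a _.
    by rewrite -scalemxAr -scalemxAl mxE.
  rewrite /D3u.
  have -> : \sum_(k < n) \sum_(l < n) Sx k l * (\sum_(a < n) V ord0 a * pd a (pd l (pd k u)) x) =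
     \sum_(a < n) V ord0 a * \sum_(k < n) \sum_(l < n) Sx k l * pd a (pd l (pd k u)) x.
    under [RHS]eq_bigr do rewrite mulr_sumr.
    rewrite [RHS]exchange_big /=; apply: eq_bigr => k _.
    under [RHS]eq_bigr do rewrite mulr_sumr.
    rewrite [RHS]exchange_big /=; apply: eq_bigr => l _.
    by rewrite mulr_sumr; apply: eq_bigr => a _; rewrite mulrCA.
  rewrite -sumrB; apply: eq_bigr => a _; rewrite -mulrBr; congr (_ * _).
  have [_] := is_derive_laplacian a x su; rewrite -[LHS]partialE pdE => ->.
  rewrite -sumrB; apply: eq_bigr => k _; rewrite -sumrB; apply: eq_bigr => l _.
  by [].
rewrite /gamma2 E1 E2 /X -!mulmxA.
have trB (A B : 'M[R]_n) : \tr (A - B) = \tr A - \tr B by rewrite linearB.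
rewrite mulmxBl !mulmxBr !trB.
have -> : \tr (Sx *m (Tx *m (Sx *m W))) = \tr (Sx *m (W *m (Sx *m Tx))).
  by rewrite !mulmxA -mulmxA mxtrace_mulC !mulmxA.
clear E1 E2; move: (\tr _) (\tr _) (\tr _) D3u (hess4_trace x V) => p q r s t.
by field.
Qed.

(** The difference of the two sides is the second derivative of - log det (hess psi) along v, which
    is nonnegative by convexity. *)
Lemma hess4_trace_le x v : log_concave (rho psi) ->
  hess4_trace x v <= \tr (S x *m hess_dir psi x v *m S x *m hess_dir psi x v).
Proof.
move=> [H [HNy Hcvx HE]].
pose f y := - ln (\det (hs psi y)).
have det_gt0 y : 0 < \det (hs psi y) by rewrite -hessEs; exact: rho_gt0.
(* Positivity of rho excludes the value +oo, so H is finite everywhere and equal to - log det. *)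
have Hf y : H y = (f y)%:E.
  have := HE y; have := HNy y; case: (H y) => [r _|_|//].
    move=> [] E; rewrite /f -hessEs -/(rho psi y) E expRK opprK//.
  by rewrite /= => -[] E; have := rho_gt0 y; rewrite E ltxx.
pose Tv y := hess_dir psi y v.
have dhs y i j : is_derive y v (fun z => hs psi z i j) (Tv y i j).
  have -> : (fun z => hs psi z i j) = pd j (pd i psi) by apply/funext => z; rewrite hsE.
  have := C1_is_derive y v (smooth_C1 (smooth_pd j (smooth_pd i sm))).
  move=> D; apply: (is_derive_eq D); rewrite hess_dirE; apply: eq_bigr => c _.
  by rewrite gradE hess3E.
have dS y i j : is_derive y v (fun z => S z i j) (- (S y *m Tv y *m S y) i j).
  have -> : (fun z => S z i j) = fun z => invmx (hs psi z) i j by apply/funext => z; rewrite hsIE.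
  rewrite -!hsIE; apply: is_derive_invmx => //; first by move=> z; rewrite gt_eqF.
  exact: cont_hess_entry.
pose g y := - \sum_(k < n) \sum_(l < n) S y k l * Tv y l k.
have df y : is_derive y v f (g y).
  have D := is_deriveN (is_derive_compR (is_derive_det (dhs y)) (is_derive1_ln (det_gt0 y))).
  apply: (is_derive_eq D); congr (- _).
  rewrite -mxtraceZ scalemxAr.
  have -> : (\det (hs psi y))^-1 *: \adj (hs psi y) = S y.
    by rewrite -hsIE /invmx unitmxE unitfE gt_eqF.
  by rewrite mxtrace_mulC; apply: eq_bigr => k _; rewrite mxE.
have dT y i j : is_derive y v (fun z => Tv z i j)
    (\sum_(a < n) \sum_(b < n) v ord0 a * v ord0 b * pd b (pd a (pd j (pd i psi))) y).
  have -> : (fun z => Tv z i j) = fun z => \sum_(c < n) v ord0 c * pd c (pd j (pd i psi)) z.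
    by apply/funext => z; rewrite /Tv hess_dirE; apply: eq_bigr => c _; rewrite hess3E.
  have D := is_derive_sumE (fun c => is_deriveCE (v ord0 c)
    (C1_is_derive y v (smooth_C1 (smooth_pd c (smooth_pd j (smooth_pd i sm)))))).
  apply: (is_derive_eq D); apply: eq_bigr => a _; rewrite /dotrV mulr_sumr; apply: eq_bigr => b _.
  by rewrite gradE mulrA.
have dg := is_derive_sumE (fun k => is_derive_sumE (fun l => is_deriveME (dS x k l) (dT x l k))).
have := @second_deriv_ge0 R _ f g x v _ df (is_deriveN dg) => H0.
have mid (t : R) : 2 * f x <= f (x + t *: v) + f (x - t *: v).
  have t2 : 0 <= 2^-1 :> R by [].
  have t21 : 2^-1 <= 1 :> R by rewrite invf_le1// ler1n.
  have := Hcvx (x + t *: v) (x - t *: v) 2^-1 t2 t21.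
  have -> : 2^-1 *: (x + t *: v) + (1 - 2^-1) *: (x - t *: v) = x.
    have -> : 1 - 2^-1 = 2^-1 :> R by rewrite {1}(splitr 1) div1r addrK.
    by rewrite -scalerDr addrACA subrr addr0 scalerDr -scalerDl -[2^-1]div1r -splitr scale1r.
  rewrite !Hf -!EFinM -EFinD lee_fin.
  by move: (f x) (f _) (f _) => p q r; clear; lra.
have {}H0 := H0 mid; rewrite oppr_ge0 in H0.
have E : \sum_(k < n) \sum_(l < n)
     (- (S x *m Tv x *m S x) k l * Tv x l k + S x k l *
      (\sum_(a < n) \sum_(b < n) v ord0 a * v ord0 b * pd b (pd a (pd k (pd l psi))) x))
   = hess4_trace x v - \tr (S x *m Tv x *m S x *m Tv x).
  rewrite addrC; under eq_bigr do rewrite big_split /=.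
  rewrite big_split /=; congr (_ + _).
    rewrite /mxtrace -sumrN; apply: eq_bigr => k _; rewrite [in RHS]mxE -sumrN;
      apply: eq_bigr => l _.
    by rewrite mulNr.
  apply: eq_bigr => k _; apply: eq_bigr => l _; congr (_ * _).
  apply: eq_bigr => a _; apply: eq_bigr => b _; congr (_ * _).
  by rewrite smooth_pd4_rev.
by move: H0; rewrite E subr_le0.
Qed.

Lemma gamma2_ge u x : (forall y, posdef (hess psi y)) -> log_concave (rho psi) -> smooth u ->
  4^-1 * \tr (S x *m T u x *m S x *m T u x) <= gamma2 u x.
Proof.
move=> pdh lc su; rewrite bochner_formula// -!hsIE -hessEs.
apply: bochner_trace; rewrite ?hess_symm//.
- by rewrite hessEs hs_sym.
- by rewrite hessEs hs_sym.
- exact: hess_dir_sym.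
- by rewrite hessEs hsIE; exact: hess4_trace_le.
Qed.

(** The base point of [Qstar] at [grad psi x] is x by [grad_legendre]; the sums over i and j
    contract the two third derivatives with v, and the other four sums form the trace. *)
Lemma QstarE x v : (forall y, posdef (hess psi y)) ->
  Qstar psi (grad psi x) v = \tr (S x *m hess_dir psi x v *m S x *m hess_dir psi x v).
Proof.
move=> pdh; rewrite /Qstar grad_legendre// pdE hessEs hsIE.
pose A (i j k : 'I_n) := pd k (pd j (pd i psi)) x.
pose F i j k l m p := v ord0 i * v ord0 j * S x l m * A j k m * S x k p * A i l p.
(* Pairing i and j into one index lets both pass the remaining sums in a single exchange. *)
transitivity (\sum_(k < n) \sum_(l < n) \sum_(m < n) \sum_(p < n) \sum_(q : 'I_n * 'I_n) F q.1
  q.2 k l m p).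
  rewrite (pair_bigA _ (fun i j => \sum_(k < n) \sum_(l < n) \sum_(m < n) \sum_(p < n) F i j k
    l m p)) /=.
  rewrite exchange_big /=; apply: eq_bigr => k _.
  rewrite exchange_big /=; apply: eq_bigr => l _.
  rewrite exchange_big /=; apply: eq_bigr => m _.
  by rewrite exchange_big.
have TE k l : hess_dir psi x v k l = \sum_(j < n) v ord0 j * A j k l.
  rewrite hess_dirE; apply: eq_bigr => j _; rewrite hess3E /A; congr (_ * _).
  by rewrite smooth_pd3_rev// (smooth_pdC k l (smooth_pd j sm)).
rewrite exchange_big /=; apply: eq_bigr => l _.
rewrite [RHS]mxE exchange_big /=.
under [LHS]eq_bigr do rewrite exchange_big /=.
rewrite exchange_big /=; apply: eq_bigr => p _.
rewrite [in RHS]mxE mulr_suml exchange_big /=; apply: eq_bigr => k _.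
rewrite [in RHS]mxE mulr_suml mulr_suml; apply: eq_bigr => m _.
rewrite -(hess_dir_sym x v sm) [_^T m k]mxE [_^T p l]mxE !TE.
rewrite -(pair_bigA _ (fun i j => F i j k l m p)) /=.
rewrite mulr_sumr; apply: eq_bigr => i _.
rewrite mulr_sumr !mulr_suml; apply: eq_bigr => j _.
by rewrite /F; move: (A _ _ _) (A _ _ _) (S x _ _) (S x _ _) => a b c d; ring.
Qed.

Lemma Qstar_scale x v (t : R) : Qstar psi x (t *: v) = t ^+ 2 * Qstar psi x v.
Proof.
rewrite /Qstar mulr_sumr; apply: eq_bigr => i _; rewrite mulr_sumr; apply: eq_bigr => j _.
rewrite mulr_sumr; apply: eq_bigr => k _; rewrite mulr_sumr; apply: eq_bigr => l _.
rewrite mulr_sumr; apply: eq_bigr => m _; rewrite mulr_sumr; apply: eq_bigr => p _.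
rewrite !mxE pdE; move: (pd _ _ _) (pd _ _ _) (invmx _ _ _) (invmx _ _ _) => a b c d; ring.
Qed.

Lemma Q_ge0 x U : (0 <= Q psi x U)%E.
Proof.
apply: ereal_sup_ubound; exists 0 => /=.
  by rewrite -(scale0r 0) Qstar_scale expr0n mul0r.
congr (_%:E); rewrite big1 ?expr0n ?mulr0// => i _; rewrite big1// => j _.
by rewrite mxE mulr0.
Qed.

Lemma riem_gradK u x : riem_grad psi u x *m hs psi x = grad u x.
Proof. by rewrite riem_gradEm -hsIE mulmxKV// hess_unit. Qed.

(* The supremum defining [Q] is tested on multiples of the Riemannian gradient
   of [u], and the arithmetic-geometric mean inequality linearizes the square. *)
Lemma Q_ge u x U : (forall y, posdef (hess psi y)) -> log_concave (rho psi) -> smooth u ->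
  ((- 2 * dotrV U (grad u x) - gamma2 u x)%:E <= Q psi (grad psi x) U)%E.
Proof.
move=> pdh lc su; have := gamma2_ge x pdh lc su; rewrite -QstarE//.
set V := Vf u x; set q := Qstar _ _ V => qg.
have q0 : 0 <= q.
  rewrite /q QstarE// -hsIE -hessEs; apply: mxtrace_posdef_ge0 => //;
    first by rewrite hessEs hs_sym.
  exact: hess_dir_sym.
set A := dotrV U (grad u x).
have term t : t ^+ 2 * q <= 1 -> ((4 * (t * A) ^+ 2)%:E <= Q psi (grad psi x) U)%E.
  move=> tq; apply: ereal_sup_ubound; exists (t *: V) => /=; first by rewrite Qstar_scale.
  congr ((4 * _ ^+ 2)%:E).
  rewrite grad_legendre// /A /dotrV mulr_sumr; apply: eq_bigr => i _.
  rewrite pdE -(riem_gradK u x) mxE mulrCA mulr_sumr mulr_sumr; apply: eq_bigr => j _.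
  rewrite -(hs_sym x sm) [_^T j i]mxE [_ *: _ in LHS]/GRing.scale /= mxE hsE -/V.
  by move: (pd _ _ _) (V _ _) (U _ _) => a b c; ring.
have [t tq tA] : exists2 t, t ^+ 2 * q <= 1 & - 2 * A - 4^-1 * q <= 4 * (t * A) ^+ 2.
  (* When q = 0 every t is admissible, and 4 t^2 A^2 = 2 |A| for t^2 = 1 / (2 |A|). When q > 0 the
     choice t^2 = 1 / q leaves the difference (4 A + q)^2 / (4 q). *)
  move: q0; rewrite le_eqVlt => /predU1P[<-|qp].
    have [->|A0] := eqVneq A 0.
      by exists 0; rewrite !mulr0 ?ler01// subr0 expr0n mulr0.
    exists (Num.sqrt (2 * `|A|)^-1); first by rewrite mulr0 ler01.
    rewrite mulr0 subr0 exprMn sqr_sqrtr ?invr_ge0 ?mulr_ge0//.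
    have -> : 4 * ((2 * `|A|)^-1 * A ^+ 2) = 2 * `|A|.
      rewrite -(real_normK (num_real A)); have : `|A| != 0 by rewrite normr_eq0.
      by move: `|A| => a a0; field.
    by rewrite mulNr -mulrN ler_pM2l// -normrN ler_norm.
  exists (Num.sqrt q^-1); rewrite ?exprMn sqr_sqrtr ?invr_ge0 ?(ltW qp)//;
    first by rewrite mulVf ?gt_eqF.
  have qn : q != 0 by rewrite gt_eqF.
  rewrite -subr_ge0 (_ : _ - _ = (4 * A + q) ^+ 2 / (4 * q)); last by field.
  by rewrite divr_ge0 ?sqr_ge0// mulr_ge0// ltW.
apply: le_trans (term t tq); rewrite lee_fin; apply: le_trans tA.
by rewrite lerD2l lerN2.
Qed.

End bochner.

Section convex_posdef.
Context {R : realType} {n : nat}.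

(** Convexity makes the second derivative along every line nonnegative, and the nonzero determinant
    upgrades this to positive definiteness. *)
Lemma convex_hess_posdef (psi : 'rV[R]_n -> R) : smooth psi ->
  @convex_function R 'rV[R]_n setT psi -> (forall x, 0 < rho psi x) ->
  forall x, posdef (hess psi x).
Proof.
move=> sm cvx rho0 x; apply: psd_posdef; first exact: hess_sym.
  move=> v.
  have df y : is_derive y v psi (dotrV (grad psi y) v).
    by rewrite dotrVC; exact: C1_is_derive (smooth_C1 sm).
  have := @second_deriv_ge0 R _ psi _ x v _ df (is_derive_grad_dot sm x v v).
  have -> : \sum_i dotrV v (grad (partial i psi) x) * v ord0 i = qform (hess psi x) v.
    rewrite qformE; apply: eq_bigr => i _; rewrite /dotrV mulr_suml; apply: eq_bigr => j _.
    by rewrite hessEs hsE gradE pdE mulrAC [v ord0 j * _]mulrC.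
  apply=> t.
  have t2 : 0 <= 2^-1 :> R by [].
  have t21 : 2^-1 <= 1 :> R by rewrite invf_le1// ler1n.
  pose h : {i01 R} := Itv01 t2 t21.
  have := cvx h (x + t *: v) (x - t *: v); rewrite !inE => /(_ Logic.I Logic.I).
  have half : 1 - 2^-1 = 2^-1 :> R by rewrite {1}(splitr 1) div1r addrK.
  have -> : conv h ((x + t *: v) : convex_lmodType 'rV[R]_n) (x - t *: v) = x.
    rewrite -[LHS]/(2^-1 *: (x + t *: v) + (1 - 2^-1) *: (x - t *: v)).
    rewrite half -scalerDr addrACA subrr addr0 scalerDr -scalerDl.
    by rewrite -[2^-1]div1r -splitr scale1r.
  move=> H; have {}H : psi x <= 2^-1 * psi (x + t *: v) + (1 - 2^-1) * psi (x - t *: v) by exact: H.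
  move: H; rewrite half; move: (psi _) (psi _) (psi x) => p q r; clear => h; lra.
by rewrite gt_eqF// -/(rho psi x).
Qed.

End convex_posdef.

(** * Lebesgue measure on row vectors *)

Section density.
Context d (T : measurableType d) (R : realType).
Variables (mu nu : {measure set T -> \bar R}) (w : T -> R).
Hypotheses (mw : measurable_fun setT w) (w0 : forall x, 0 <= w x).
Hypothesis nuE : forall A, measurable A -> nu A = (\int[mu]_(x in A) (w x)%:E)%E.
Import HBNNSimple.

Let density_nnsfun (h : {nnsfun T >-> R}) :
  (\int[nu]_x (h x)%:E = \int[mu]_x ((h x)%:E * (w x)%:E))%E.
Proof.
have ind r : measurable (h @^-1` [set r]) by exact: measurable_sfunP.
have mind r : measurable_fun setT (fun x => (\1_(h @^-1` [set r]) x)%:E : \bar R).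
  by apply/measurable_EFinP.
transitivity (\int[nu]_x (\sum_(y \in range h) (y * \1_(h @^-1` [set y]) x)%:E))%E.
  by apply: eq_integral => x _; rewrite fimfunE -fsumEFin.
rewrite ge0_integral_fsum//; first last.
- by move=> r x _; exact: nnfun_muleindic_ge0.
- by move=> r; apply/measurable_EFinP; exact: measurable_funM.
transitivity (\int[mu]_x (\sum_(y \in range h) ((y * \1_(h @^-1` [set y]) x)%:E * (w
  x)%:E)))%E; last first.
  apply: eq_integral => x _; rewrite -ge0_mule_fsuml; first by rewrite fsumEFin// -fimfunE.
  by move=> r; exact: nnfun_muleindic_ge0.
rewrite ge0_integral_fsum//; first last.
- by move=> r x _; rewrite mule_ge0 ?lee_fin//; exact: nnfun_muleindic_ge0.
- move=> r; apply: emeasurable_funM; first by apply/measurable_EFinP; exact: measurable_funM.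
  exact/measurable_EFinP.
apply: eq_fsbigr => r /[!inE] -[x _ <-].
under eq_integral do rewrite EFinM.
rewrite ge0_integralZl_EFin//.
rewrite integral_indic// setIT nuE//.
under [RHS]eq_integral do rewrite EFinM -muleA.
rewrite ge0_integralZl_EFin//; first last.
- by apply: emeasurable_funM => //; exact/measurable_EFinP.
- by move=> y _; rewrite mule_ge0 ?lee_fin.
congr (_ * _)%E; rewrite integral_mkcond; apply: eq_integral => y _.
by rewrite patchE indicE; case: ifPn => _; rewrite ?mul1e ?mul0e.
Qed.

(** On simple functions the formula reduces to the values of nu, and monotone convergence does the
    rest. Agreement is asked on measurable sets only, in accordance with the way [mu] is defined. *)
Lemma ge0_integral_density (f : T -> \bar R) : measurable_fun setT f ->
  (forall x, (0 <= f x)%E) ->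
  (\int[nu]_x f x = \int[mu]_x (f x * (w x)%:E))%E.
Proof.
move=> mf f0; pose h := nnsfun_approx measurableT mf.
have hf x : ((h n x)%:E @[n --> \oo] --> f x)%E by exact: cvg_nnsfun_approx.
have nd x : {homo (fun n => (h n x)%:E) : m n / (m <= n)%N >-> (m <= n)%E}.
  by move=> m n mn; rewrite lee_fin; exact/lefP/nd_nnsfun_approx.
transitivity (limn (fun n => \int[nu]_x (h n x)%:E))%E.
  rewrite -monotone_convergence//.
  - by apply: eq_integral => x _; apply/esym/cvg_lim.
  - by move=> n; exact/measurable_EFinP.
  - by move=> n x _; rewrite lee_fin.
under eq_fun do rewrite density_nnsfun.
rewrite -monotone_convergence//.
- apply: eq_integral => x _; apply/cvg_lim => //.
  by apply: cvgeZr => //; exact: hf.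
- by move=> n; apply: emeasurable_funM; exact/measurable_EFinP.
- by move=> n x _; rewrite mule_ge0 ?lee_fin.
- by move=> x _ m n mn; rewrite lee_wpmul2r ?lee_fin//; exact/lefP/nd_nnsfun_approx.
Qed.

End density.

(* No measurability is needed on the larger function: the integral of a
   nonnegative function is a supremum over the simple functions below it. *)
Lemma ge0_le_integral_nonmeas d (T : measurableType d) (R : realType)
    (mu : {measure set T -> \bar R}) (D : set T) (f g : T -> \bar R) :
  (forall x, D x -> (0 <= f x)%E) -> (forall x, D x -> (f x <= g x)%E) ->
  (\int[mu]_(x in D) f x <= \int[mu]_(x in D) g x)%E.
Proof.
move=> f0 fg; have g0 x : D x -> (0 <= g x)%E by move=> Dx; exact: le_trans (f0 x Dx) (fg x Dx).
rewrite !ge0_integralE//; apply: le_ereal_sup => _ [h hf <-]; exists h => // x.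
apply: le_trans (hf x) _; rewrite !patchE; case: ifPn => // /set_mem; exact: fg.
Qed.

Section borel_rV.
Context {R : realType} {n : nat}.
Implicit Types (U D K : set 'rV[R]_n) (f : 'rV[R]_n -> R).

Lemma measurable_ball_rV (c : 'rV[R]_n) (r : R) : measurable [set x : 'rV[R]_n | forall i,
  `|x ord0 i - c ord0 i| < r].
Proof.
rewrite (_ : [set _ | _] = \bigcap_(i in [set: 'I_n])
    ((fun v : 'rV[R]_n => v ord0 i) @^-1` [set t | `|t - c ord0 i| < r])); last first.
  by apply/seteqP; split => v /= h i; [move=> _; exact: h|exact: h].
apply: fin_bigcap_measurable => // i _.
rewrite -[X in measurable X]setTI; apply: measurable_coord => //.
apply: open_measurable; rewrite (_ : [set _ | _] = (fun t => `|t - c ord0 i|) @^-1` [set t | t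
  < r])//.
apply: open_comp; last exact: open_lt.
by move=> z _; move: z; apply: cont_norm; apply: cont_sub_cst => z; exact: cvg_id.
Qed.

(** The sigma-algebra is generated by the coordinates, so U is written as a countable union of cubes
    with rational centre and radius 1/(k+1); pickling enumerates these cubes. *)
Lemma open_measurable_rV U : open U -> measurable U.
Proof.
move=> oU.
pose B (p : 'rV[rat]_n * nat) := [set x : 'rV[R]_n | forall i,
  `|x ord0 i - ratr (p.1 ord0 i)| < p.2.+1%:R^-1].
pose F k := if @unpickle ('rV[rat]_n * nat)%type k is Some p then
   (if `[< B p `<=` U >] then B p else set0) else set0.
suff -> : U = \bigcup_k F k.
  apply: bigcupT_measurable => k; rewrite /F; case: unpickle => [p|]; last exact: measurable0.
  case: ifP => _; last exact: measurable0.
  have := @measurable_ball_rV (\row_i ratr (p.1 ord0 i)) p.2.+1%:R^-1.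
  by congr measurable; apply/seteqP; split => x /= h i; have := h i; rewrite mxE.
apply/seteqP; split => [x Ux|x [k _]]; last first.
  by rewrite /F; case: unpickle => [p|//]; case: ifP => // /asboolP h /h.
have /nbhs_ballP[e /= e0 eU] : nbhs x U by exact: open_nbhs_nbhs.
have [k ke] : exists k, k.+1%:R^-1 < e / 2 :> R.
  exists (Num.truncn (e / 2)^-1); rewrite invf_plt ?posrE ?divr_gt0//.
  exact: truncnS_gt.
have k0 : 0 < k.+1%:R^-1 :> R by rewrite invr_gt0.
have rq i : exists q : rat, `|x ord0 i - ratr q| < k.+1%:R^-1.
  have lt : x ord0 i - k.+1%:R^-1 < x ord0 i + k.+1%:R^-1 by rewrite ltrD2l gtrN.
  have [q] := rat_in_itvoo lt.
  rewrite in_itv /= => /andP[q1 q2]; exists q; rewrite distrC ltr_distl q1 q2//.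
pose q : 'rV[rat]_n := \row_i projT1 (cid (rq i)).
have xB : B (q, k) x by move=> i /=; rewrite mxE; exact: projT2 (cid (rq i)).
exists (pickle (q, k)) => //; rewrite /F pickleK ifT//; apply/asboolP => y yB.
apply: eU; rewrite -ball_normE /=; apply: (@le_lt_trans _ _ (k.+1%:R^-1 + k.+1%:R^-1)).
  apply: norm_le_coord; first by rewrite addr_ge0// ltW.
  move=> i; rewrite !mxE -(subrKA (ratr (q ord0 i))); apply: le_trans (ler_normD _ _) _.
  by apply: lerD; apply: ltW; [exact: xB|rewrite distrC; exact: yB].
by rewrite (splitr e) ltrD.
Qed.

Lemma cont_measurable_rV D f : open D -> (forall x, D x -> f @ x --> f x) -> measurable_fun D f.
Proof.
move=> oD cf mD; apply: (measurability _ (RGenOInfty.measurableE R)) => //.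
move=> _ [_ [a ->] <-]; apply: open_measurable_rV.
rewrite openE => x [Dx fx]; rewrite /interior.
have /= fx' : a < f x by move: fx; rewrite /= in_itv /= andbT.
apply: filterI; first exact: open_nbhs_nbhs.
have /cvgr_gt/(_ a fx') := cf x Dx.
by apply: nbhs_imp => y /=; rewrite in_itv /= andbT.
Qed.

Lemma continuous_measurable_rV f : continuous f -> measurable_fun setT f.
Proof. by move=> cf; apply: cont_measurable_rV; [exact: openT|move=> x _; exact: cf]. Qed.

Lemma continuous_measurable_rVrV m (f : 'rV[R]_n -> 'rV[R]_m) : continuous f ->
  measurable_fun setT f.
Proof.
move=> cf; apply/measurable_fun_rVP => i; apply: continuous_measurable_rV.
exact: (cont_comp cf (@cont_coord R m i)).
Qed.

End borel_rV.

Section fubini_rV.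
Context {R : realType} {n : nat}.
Implicit Types (f : 'rV[R]_n.+1 -> \bar R).
Local Notation leb := (@lebesgue_measure R).

Lemma measurable_consrVl (s : R) : measurable_fun setT (fun y : 'rV[R]_n => consrV (s, y)).
Proof.
apply: (measurableT_comp (@measurable_consrV R n)).
exact: measurable_pair1.
Qed.

Lemma measurable_consrVr (y : 'rV[R]_n) : measurable_fun setT (fun s : R => consrV (s, y)).
Proof.
apply: (measurableT_comp (@measurable_consrV R n)).
exact: measurable_pair2.
Qed.

Lemma integral_rVS f : measurable_fun setT f -> (forall x, (0 <= f x)%E) ->
  (\int[lebesgue_rV n.+1]_x f x = \int[leb]_s \int[lebesgue_rV n]_y f (consrV (s, y)))%E.
Proof.
move=> mf f0; rewrite /= /lebesgue_rV_step ge0_integral_pushforward//; first last.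
  exact: measurable_consrV.
rewrite preimage_setT fubini_tonelli1//;
  first exact: (measurableT_comp mf (@measurable_consrV R n)).
by move=> x; exact: f0.
Qed.

Lemma integral_rVS_swap f : measurable_fun setT f -> (forall x, (0 <= f x)%E) ->
  (\int[lebesgue_rV n.+1]_x f x = \int[lebesgue_rV n]_y \int[leb]_s f (consrV (s, y)))%E.
Proof.
move=> mf f0; rewrite /= /lebesgue_rV_step ge0_integral_pushforward//; first last.
  exact: measurable_consrV.
have mfc := measurableT_comp mf (@measurable_consrV R n).
have fc0 x : (0 <= (f \o @consrV R n) x)%E by exact: f0.
by rewrite preimage_setT fubini_tonelli1// fubini_tonelli.
Qed.

End fubini_rV.

(** * Translation invariance and null sets *)

Section translation.
Context {R : realType}.
Local Notation leb := lebesgue_measure.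

Let shift_by (t : R) : measurableTypeR R -> measurableTypeR R := fun s => (s : R) + t.

Let measurable_shift_by (t : R) : measurable_fun setT (shift_by t).
Proof. exact: (@measurable_funD _ R R setT id (cst t)). Qed.

Lemma lebesgue_measure_translate (t : R) (A : set R) : measurable A ->
  leb ((fun s : R => s + t) @^-1` A) = leb A.
Proof.
move=> mA; apply/esym.
apply: (@lebesgue_measure_unique R (pushforward leb (shift_by t))) => //= _ [[a b]] _ <-.
rewrite /pushforward /=.
have -> : shift_by t @^-1` `]a, b] = `]a - t, b - t]%classic.
  by apply/seteqP; split => s; rewrite /= !in_itv /= ltrBlDr lerBrDr.
rewrite !lebesgue_measure_itv /= !lte_fin ltrD2r; case: ifP => // _.
by rewrite -!EFinB opprB addrA subrK.
Qed.

Lemma integral_translate (t : R) (f : R -> \bar R) : measurable_fun setT f ->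
  (forall x, (0 <= f x)%E) ->
  (\int[leb]_s f (s + t)%R = \int[leb]_s f s)%E.
Proof.
move=> mf f0.
have := @ge0_integral_pushforward _ _ (measurableTypeR R) (measurableTypeR R) R (shift_by t)
  (measurable_shift_by t) leb setT f measurableT mf (fun x _ => f0 x).
rewrite preimage_setT => <-.
by apply: eq_measure_integral => A mA _; exact: lebesgue_measure_translate.
Qed.

Lemma rVDE n (x y : 'rV[R]_n) i : (x + y) ord0 i = x ord0 i + y ord0 i.
Proof. by rewrite mxE. Qed.

Lemma rVZE n (a : R) (x : 'rV[R]_n) i : (a *: x) ord0 i = a * x ord0 i.
Proof. by rewrite mxE. Qed.

Lemma consrV_delta0 n (s t : R) (y : 'rV[R]_n) :
  consrV (s, y) + t *: delta_mx ord0 ord0 = consrV (s + t, y).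
Proof.
apply/rowP => i; rewrite rVDE rVZE [delta_mx _ _ _ _]mxE.
case: (unliftP ord0 i) => [j|] ->.
  by rewrite !consrVS /= mulr0 addr0.
by rewrite !consrV0 eqxx mulr1.
Qed.

Lemma consrV_deltaS n (s t : R) (y : 'rV[R]_n) j :
  consrV (s, y) + t *: delta_mx ord0 (lift ord0 j) = consrV (s, y + t *: delta_mx ord0 j).
Proof.
apply/rowP => i; rewrite rVDE rVZE [delta_mx _ _ _ _]mxE.
case: (unliftP ord0 i) => [k|] ->.
  by rewrite !consrVS !mxE /= (inj_eq (lift_inj)).
by rewrite !consrV0 /= mulr0 addr0.
Qed.

Lemma measurable_translate n (x : 'rV[R]_n) : measurable_fun setT (fun y : 'rV[R]_n => y + x).
Proof.
apply: continuous_measurable_rVrV => y; exact: (cvgD cvg_id (cvg_cst _)).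
Qed.

Lemma integral_rV_translate n j (t : R) (f : 'rV[R]_n -> \bar R) : measurable_fun setT f ->
  (forall x, (0 <= f x)%E) ->
  (\int[lebesgue_rV n]_x f (x + t *: delta_mx ord0 j)%R = \int[lebesgue_rV n]_x f x)%E.
Proof.
elim: n j f => [|n IH] j f mf f0; first by case: j.
have mft : measurable_fun setT (fun x : 'rV[R]_n.+1 => f (x + t *: delta_mx ord0 j)).
  exact: (measurableT_comp mf (measurable_translate _)).
case: (unliftP ord0 j) mft => [k|] -> mft.
  rewrite (integral_rVS mft (fun x => f0 _)) (integral_rVS mf f0); apply: eq_integral => s _.
  under eq_integral do rewrite consrV_deltaS.
  apply: (IH k (fun y => f (consrV (s, y)))) => //.
  exact: (measurableT_comp mf (measurable_consrVl s)).
rewrite (integral_rVS_swap mft (fun x => f0 _)) (integral_rVS_swap mf f0);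
  apply: eq_integral => y _.
under eq_integral do rewrite consrV_delta0.
apply: (integral_translate t (f := fun s => f (consrV (s, y)))) => //.
exact: (measurableT_comp mf (measurable_consrVr y)).
Qed.

Lemma measurable_line n (x v : 'rV[R]_n) : measurable_fun setT (fun t : R => x + t *: v).
Proof.
apply/measurable_fun_rVP => i.
under eq_fun do rewrite !mxE.
by apply: measurable_funD => //; exact: measurable_funM.
Qed.

(** Fubini, with an induction that strips the leading coordinate until direction j is the one split
    off. *)
Lemma lebesgue_rV_null_lines n j (E : set 'rV[R]_n) : measurable E ->
  (forall x, leb [set t | E (x + t *: delta_mx ord0 j)] = 0%E) -> lebesgue_rV n E = 0%E.
Proof.
elim: n j E => [|n IH] j E mE E0; first by case: j E0.
have mi : measurable_fun setT (fun x => (\1_E x)%:E : \bar R) by exact/measurable_EFinP.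
have -> : lebesgue_rV n.+1 E = (\int[lebesgue_rV n.+1]_x (\1_E x)%:E)%E.
  by rewrite integral_indic// setIT.
have i0 x : (0 <= (\1_E x)%:E :> \bar R)%E by rewrite lee_fin.
case: (unliftP ord0 j) E0 => [k|] -> E0.
  rewrite integral_rVS// integral0_eq// => s _.
  have mEs : measurable ((fun y : 'rV[R]_n => consrV (s, y)) @^-1` E).
    by rewrite -[X in measurable X]setTI; apply: measurable_consrVl.
  transitivity (\int[lebesgue_rV n]_y (\1_((fun y : 'rV[R]_n => consrV (s,
    y)) @^-1` E) y)%:E)%E => //.
  rewrite integral_indic// setIT; apply: (IH k) => // y.
  by have := E0 (consrV (s, y)); under eq_set do rewrite consrV_deltaS.
rewrite integral_rVS_swap// integral0_eq// => y _.
have mEs : measurable ((fun s : R => consrV (s, y)) @^-1` E).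
  by rewrite -[X in measurable X]setTI; apply: measurable_consrVr.
transitivity (\int[leb]_s (\1_((fun s : R => consrV (s, y)) @^-1` E) s)%:E)%E => //.
rewrite integral_indic// setIT.
have := E0 (consrV (0, y)); under eq_set do rewrite consrV_delta0 add0r.
by [].
Qed.

End translation.

(** * Change of variables along a gradient map *)

Section density_measure.
Context d (T : measurableType d) (R : realType).
Variables (mu : {measure set T -> \bar R}) (w : T -> R).
Hypotheses (mw : measurable_fun setT w) (w0 : forall x, 0 <= w x).

Let nu (A : set T) : \bar R := (\int[mu]_(x in A) (w x)%:E)%E.

Let nu0 : nu set0 = 0%E.
Proof. exact: integral_set0. Qed.

Let nu_ge0 A : (0 <= nu A)%E.
Proof. by apply: integral_ge0 => x _; rewrite lee_fin. Qed.

Let nu_sigma_additive : semi_sigma_additive nu.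
Proof.
move=> F mF tF mUF; rewrite /nu ge0_integral_bigcup//.
- by apply: is_cvg_ereal_nneg_natsum => k _; exact: nu_ge0.
- by apply: measurable_funTS; exact/measurable_EFinP.
- by move=> x _; rewrite lee_fin.
Qed.

(** This provides a genuine measure with the same values as the bare set function [mu], so that
    integration theory applies to it. *)
Lemma density_measure : exists m : {measure set T -> \bar R},
  (m : set T -> \bar R) = (fun A => \int[mu]_(x in A) (w x)%:E)%E.
Proof.
pose m : {measure set T -> \bar R} := HB.pack nu (isMeasure.Build _ _ _ nu nu0 nu_ge0
  nu_sigma_additive).
by exists m.
Qed.

End density_measure.

(** * One-dimensional substitution along an increasing function *)

Section increasing_substitution.
Context {R : realType}.
Variables (m m' : R -> R).
Hypothesis dm : forall s : R, is_derive s 1 m (m' s).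
Hypothesis m'0 : forall s, 0 < m' s.
Hypothesis cm' : continuous m'.
Local Notation leb := lebesgue_measure.

Let m_inc : {mono m : x y / x < y}.
Proof.
apply/leW_mono/le_mono => x y xy.
have [|c _ E] := @MVT R m m' x y xy (fun x _ => dm x).
  by apply: derivable_within_continuous => z _; case: (dm z).
by rewrite -subr_gt0 E mulr_gt0// subr_gt0.
Qed.

Let m_le : {mono m : x y / x <= y}.
Proof. by move=> x y; rewrite !leNgt m_inc. Qed.

Let cm : continuous m.
Proof. by move=> x; apply: differentiable_continuous; apply/derivable1_diffP; case: (dm x). Qed.

Let I := range m.

Let itvP a b : a <= b -> m @` `]a, b]%classic = `]m a, m b]%classic.
Proof.
move=> ab; apply/seteqP; split => [_ [s + <-]|t] /=; rewrite !in_itv /= ?m_inc ?m_le//.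
move=> /andP[at_ tb].
have mab : m a <= m b by rewrite m_le.
have [|s] := @IVT R m a b t ab (continuous_subspaceT cm) _.
  by rewrite min_l// max_r// (ltW at_) tb.
rewrite in_itv /= => /andP[sa sb] E; exists s => //; rewrite in_itv /= sb andbT -m_inc E//.
Qed.

Let openI : open I.
Proof.
rewrite openE => _ [s _ <-]; rewrite /interior.
apply: (@filterS _ (nbhs (m s)) _ `]m (s - 1), m (s + 1)[).
  move=> t; rewrite /= in_itv /= => /andP[t1 t2].
  have : `]m (s - 1), m (s + 1)]%classic t by rewrite /= in_itv /= t1 ltW.
  by rewrite -itvP => [[z _ <-]|]; [exists z|lra].
by apply: near_in_itvoo; rewrite in_itv /= !m_inc; lra.
Qed.

Let mI : measurable I := open_measurable openI.

(** The inverse of m on its range, with default value 0 elsewhere; points outside the range are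
    discarded later by restricting Lebesgue measure to I. *)
Let g (t : R) : R := if pselect (I t) is left h then projT1 (cid2 h) else 0.

Let gK s : g (m s) = s.
Proof.
rewrite /g; case: pselect => [h|N]; last by exfalso; apply: N; exists s.
by case: cid2 => z _ /= E; apply/le_anti; rewrite -(m_le z s) -(m_le s z) E lexx.
Qed.

Let mg_on t : I t -> m (g t) = t.
Proof. by move=> [s _ <-]; rewrite gK. Qed.

Let gT : measurableTypeR R -> measurableTypeR R := g.

Let mg : measurable_fun setT gT.
Proof.
suff : measurable_fun [set: R] g by [].
move=> _; apply: (measurability _ (RGenOInfty.measurableE R)) => //.
move=> _ [_ [a ->] <-]; rewrite setTI.
(* On the range the condition reads t > m a; off the range the default value 0 decides, all or
   nothing. *)
have -> : g @^-1` `]a, +oo[ = (I `&` `]m a, +oo[) `|` (~` I `&` [set t | a < 0]).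
  apply/seteqP; split => [t|t [[[s _ <-]]|[nI]]] /=; rewrite !in_itv /= !andbT.
  - have [[s _ <-]|nI] := pselect (I t); first by rewrite gK => h; left; split;
    [exists s|rewrite m_inc].
    by rewrite /g; case: pselect => // _ h; right.
  - by rewrite m_inc gK.
  - by rewrite /g; case: pselect.
apply: measurableU; first exact: measurableI.
apply: measurableI; first exact: measurableC.
by case: (ltP a 0) => h; [rewrite (_ : [set _ | _] = setT)//; apply/seteqP;
  split|rewrite (_ : [set _ | _] = set0)//; apply/seteqP; split].
Qed.

Let mm : measurable_fun setT m.
Proof. by apply: continuous_measurable_fun; exact: cm. Qed.

Let mm' : measurable_fun setT m'.
Proof. exact: continuous_measurable_fun. Qed.

Let lebm : {measure set (measurableTypeR R) -> \bar R} := lebesgue_measure.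

(** The image under g of Lebesgue measure on the range of m. On ]a, b] it gives m b - m a, and so
    does the density m' by the fundamental theorem of calculus; the two measures therefore agree. *)
Let nu2 := pushforward (mrestr lebm mI) gT.

Let nu2oc a b : a <= b -> nu2 `]a, b] = (m b - m a)%:E.
Proof.
move=> ab; rewrite /nu2 /pushforward /mrestr.
have -> : gT @^-1` `]a, b] `&` I = `]m a, m b]%classic.
  rewrite -itvP//; apply/seteqP; split => [t [h It]|t [s h <-]].
    by exists (g t) => //; exact: mg_on.
  by split; [rewrite /= /gT gK|exists s].
transitivity (lebesgue_measure (`]m a, m b]%classic : set R)) => //.
rewrite lebesgue_measure_itv /= lte_fin m_inc; case: ltP => // ba.
by rewrite (@le_anti _ _ a b) ?subrr// ab ba.
Qed.

Let int_oc a b : a <= b -> (\int[leb]_(s in `]a, b]) (m' s)%:E = (m b - m a)%:E)%E.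
Proof.
rewrite le_eqVlt => /predU1P[->|ab]; first by rewrite set_itvoc0 integral_set0 subrr.
rewrite integral_itv_obnd_cbnd; last first.
  by apply: measurable_funTS; exact/measurable_EFinP.
rewrite (@continuous_FTC2 R m' m a b)//.
- by apply: continuous_subspaceT.
- split; first by move=> x _; case: (dm x).
  + by apply: cvg_at_right_filter; exact: cm.
  + by apply: cvg_at_left_filter; exact: cm.
- by move=> x _; rewrite derive1E; case: (dm x).
Qed.

Let nu2E A : measurable A -> nu2 A = (\int[leb]_(s in A) (m' s)%:E)%E.
Proof.
have [nu1 nu1E] := @density_measure _ _ R lebm m' mm' (fun x => ltW (m'0 x)).
have E B : measurable B -> nu1 B = nu2 B.
  apply: (@measure_unique _ R (measurableTypeR R) (@ocitv R) (fun k => `]- k%:R,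
    k%:R]%classic)) => //.
  - exact: ocitvI.
  - by move=> k; exact: is_ocitv.
  - by apply/seteqP; split => // x _; exists (Num.truncn `|x|).+1 => //=; rewrite in_itv /=;
    have := truncnS_gt `|x|; rewrite ltr_norml => /andP[-> /ltW].
  - move=> _ [[a b] _ <-] /=; rewrite nu1E.
    case: (leP a b) => ab; first by rewrite -[RHS]/(nu2 `]a, b]%classic) (nu2oc ab) -int_oc.
    have E0 : (`]a, b]%classic = set0 :> set R) by rewrite set_itv_ge// bnd_simp -leNgt ltW.
    by rewrite -[RHS]/(nu2 `]a, b]%classic) E0 integral_set0 /nu2 measure0.
  - move=> k; rewrite nu1E.
    have := @int_oc (- k%:R) k%:R; rewrite /lebm => ->; first exact: ltry.
    by rewrite (@le_trans _ _ 0)// ?oppr_le0.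
by move=> mA; rewrite -(E A mA) nu1E.
Qed.

Lemma increasing_substitution (h : R -> \bar R) :
  measurable_fun setT h -> (forall x, (0 <= h x)%E) ->
  (\int[leb]_s (h (m s) * (m' s)%:E) = \int[leb]_(t in range m) h t)%E.
Proof.
move=> mh h0.
have mhm : measurable_fun [set: measurableTypeR R] (h \o m) by exact: (measurableT_comp mh mm).
have := @ge0_integral_density _ _ R lebm nu2 m' mm' (fun x => ltW (m'0 x)) nu2E (h \o m) mhm
  (fun x => h0 _).
move=> <-.
have rE A : measurable A -> mrestr lebm mI A = (\int[lebm]_(x in A) (\1_I x)%:E)%E.
  by move=> mA; rewrite integral_indic// /mrestr setIC.
rewrite (ge0_integral_pushforward mg) ?preimage_setT//; last by move=> x _; exact: h0.
rewrite (@ge0_integral_density _ _ R lebm _ (\1_I) _ _ rE)//.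
- rewrite [RHS]integral_mkcond; apply: eq_integral => t _; rewrite patchE indicE.
  by case: ifPn => [/set_mem It|_]; rewrite ?mule1 ?mule0//= mg_on.
- exact: (measurableT_comp mhm mg).
- by move=> x; exact: h0.
Qed.

End increasing_substitution.

(** * Gradient range and linear growth of a strictly convex function *)

Section growth.
Context {R : realType} {n : nat}.
Variable psi : 'rV[R]_n -> R.
Hypothesis sm : smooth psi.
Hypothesis pdh : forall x, posdef (hess psi x).

Lemma cont_grad : continuous (grad psi).
Proof. by apply: cont_rV => i; under eq_fun do rewrite mxE; exact: (smooth_C1 sm i).2. Qed.

Lemma open_range_grad : open (range (grad psi)).
Proof.
rewrite openE => _ [x _ <-]; rewrite /interior.
have := grad_open_near sm pdh x ltr01; apply: nbhs_imp => c [y _ <-].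
by exists y.
Qed.

Lemma near_range_grad y : nbhs (grad psi y) (range (grad psi)).
Proof. by apply: open_nbhs_nbhs; split; [exact: open_range_grad|exists y]. Qed.

Lemma rho_gt0 x : 0 < rho psi x.
Proof. by apply: posdef_det_gt0; [exact: hess_sym|exact: pdh]. Qed.

Lemma cont_hess i j : continuous (fun y => hess psi y i j).
Proof. by under eq_fun do rewrite hessEs; exact: cont_hess_entry. Qed.

Lemma cont_rho : continuous (rho psi).
Proof. by apply: cont_det => i j; exact: cont_hess. Qed.

Lemma cont_invhess i j : continuous (fun y => invmx (hess psi y) i j).
Proof.
by apply: cont_invmx => [z|a b]; [exact: posdef_det_neq0|exact: cont_hess].
Qed.

(** The gap above the tangent plane on the unit sphere propagates outwards along rays by
    convexity. *)
Lemma linear_growth y0 : exists2 m : R, 0 < m &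
  forall z, 1 <= `|z - y0| -> psi y0 + dotrV (grad psi y0) (z - y0) + `|z - y0| * m <= psi z.
Proof.
have [m m0 mP] := sphere_gap sm pdh y0 (ltr01 : 0 < 1 :> R); exists m => // z z1.
set r := `|z - y0| in z1 *.
have r0 : 0 < r by exact: lt_le_trans z1.
pose e := r^-1 *: (z - y0).
have zE : z - y0 = r *: e by rewrite /e scalerA mulfV ?gt_eqF// scale1r.
have ne : `|e| = 1 by rewrite /e normrZ gtr0_norm ?invr_gt0// mulVf// gt_eqF.
have h1 := mP (y0 + e); have E1 : y0 + e - y0 = e by rewrite addrAC subrr add0r.
rewrite E1 in h1; have {}h1 := h1 ne.
have h2 := tangent_le sm pdh (y0 + e) (- e).
rewrite addrK dotrVNr in h2.
have h3 := tangent_le sm pdh (y0 + e) ((r - 1) *: e).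
have zE2 : y0 + e + (r - 1) *: e = z
  by rewrite scalerBl scale1r -addrA [e + _]addrC subrK -zE addrC subrK.
rewrite zE2 dotrVZr in h3.
rewrite zE dotrVZr.
move: h1 h2 h3 z1 m0.
move: (dotrV _ _) (dotrV _ _) (psi _) (psi _) (psi _) => a b p q t.
move: (r) => r'; clear => h1 h2 h3 r1 m0.
have : 0 <= (r' - 1) * (a - (b + m)) by rewrite mulr_ge0//; lra.
by move: h1 h2 h3; clear; rewrite mulrBr mulrDr !mulrBl !mul1r; lra.
Qed.

Lemma midpoint_le x w : 2 * psi x <= psi (x + w) + psi (x - w).
Proof.
have h1 := tangent_le sm pdh x w; have h2 := tangent_le sm pdh x (- w).
move: h1 h2; rewrite dotrVNr.
by move: (dotrV _ _) (psi _) (psi _) (psi _) => a b c d; clear; lra.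
Qed.

End growth.

Lemma cvg_comp_at (T U V : topologicalType) (f : T -> U) (g : U -> V) x :
  f @ x --> f x -> g @ f x --> g (f x) -> (fun y => g (f y)) @ x --> g (f x).
Proof. by move=> cf cg; exact: (cvg_comp _ _ cf cg). Qed.

Section consrV_calculus.
Context {R : realType} {n : nat}.

Lemma consrVD (s t : R) (x y : 'rV[R]_n) : consrV (s, x) + consrV (t, y) = consrV (s + t, x + y).
Proof.
by apply/rowP => i; rewrite rVDE; case: (unliftP ord0 i) => [j|] ->;
  rewrite ?consrVS ?consrV0//= mxE.
Qed.

Lemma consrVZ (a t : R) (y : 'rV[R]_n) : a *: consrV (t, y) = consrV (a * t, a *: y).
Proof.
by apply/rowP => i; rewrite rVZE; case: (unliftP ord0 i) => [j|] ->;
  rewrite ?consrVS ?consrV0//= mxE.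
Qed.

Lemma consrVN (t : R) (y : 'rV[R]_n) : - consrV (t, y) = consrV (- t, - y).
Proof. by rewrite -scaleN1r consrVZ mulN1r scaleN1r. Qed.

Lemma cont_consrV (T : topologicalType) (a : T -> R) (b : T -> 'rV[R]_n) :
  continuous a -> continuous b -> continuous (fun t => consrV (a t, b t)).
Proof.
move=> ca cb; apply: cont_rV => i; case: (unliftP ord0 i) => [j|] ->.
  under eq_fun do rewrite consrVS.
  exact: (@cont_comp _ _ _ b (fun z : 'rV[R]_n => z ord0 j) cb (@cont_coord R n j)).
by under eq_fun do rewrite consrV0.
Qed.

(** The difference quotients on both sides are the same function, so the identity holds even where
    no derivative exists. *)
Lemma partial_slice (f : 'rV[R]_n.+1 -> R) (s : R) (i : 'I_n) :
  partial i (fun y => f (consrV (s, y))) = fun y => partial (lift ord0 i) f (consrV (s, y)).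
Proof.
apply/funext => y; rewrite !partialE.
suff E : (fun h : R => h^-1 *: (((fun y => f (consrV (s,
  y))) \o shift y) (h *: delta_mx ord0 i) - f (consrV (s, y))))
   = (fun h : R => h^-1 *: ((f \o shift (consrV (s,
     y))) (h *: delta_mx ord0 (lift ord0 i)) - f (consrV (s, y)))).
  by have := congr1 (fun q => lim (q @ (0 : R)^')) E.
by apply/funext => h /=; rewrite [h *: _ + y]addrC [h *: _ + consrV _]addrC consrV_deltaS.
Qed.

Lemma derivable_slice (f : 'rV[R]_n.+1 -> R) (s : R) (i : 'I_n) y :
  derivable f (consrV (s, y)) (delta_mx ord0 (lift ord0 i)) ->
  derivable (fun y => f (consrV (s, y))) y (delta_mx ord0 i).
Proof.
rewrite /derivable => h.
suff -> : (fun h : R => h^-1 *: (((fun y => f (consrV (s,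
  y))) \o shift y) (h *: delta_mx ord0 i) - f (consrV (s, y))))
   = (fun h : R => h^-1 *: ((f \o shift (consrV (s,
     y))) (h *: delta_mx ord0 (lift ord0 i)) - f (consrV (s, y)))) by [].
by apply/funext => t /=; rewrite [t *: _ + y]addrC [t *: _ + consrV _]addrC consrV_deltaS.
Qed.

Lemma smooth_slice (f : 'rV[R]_n.+1 -> R) (s : R) : smooth f -> smooth (fun y => f (consrV (s, y))).
Proof.
move=> sf l.
have -> : partials l (fun y => f (consrV (s, y))) =
  fun y => partials (map (lift ord0) l) f (consrV (s, y)).
  by elim: l => //= i l ->; rewrite partial_slice.
have [cf df] := sf (map (lift ord0) l); split.
  apply: (@cont_comp _ _ _ (fun y : 'rV[R]_n => consrV (s,
    y)) (partials (map (lift ord0) l) f)) => //.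
  by apply: (@cont_consrV _ (fun=> s) id); [exact: cont_cst|move=> x; exact: cvg_id].
by move=> i x; apply: derivable_slice; exact: df.
Qed.

End consrV_calculus.

(** * Slices of a convex function and the change of variables in mixed coordinates *)

Section slices.
Context {R : realType} {n : nat}.
Variable psi : 'rV[R]_n.+1 -> R.
Hypothesis sm : smooth psi.
Hypothesis pdh : forall x, posdef (hess psi x).
Implicit Types (s t : R) (x z : 'rV[R]_n.+1) (y c : 'rV[R]_n).

Let sl s : 'rV[R]_n -> R := fun y => psi (consrV (s, y)).

Let hd z : R := z ord0 ord0.

Let tl z : 'rV[R]_n := \row_j z ord0 (lift ord0 j).

Let consK z : consrV (hd z, tl z) = z.
Proof. by apply/rowP => i; case: (unliftP ord0 i) => [j|] ->; rewrite ?consrVS ?consrV0//= mxE. Qed.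

Let hdK s c : hd (consrV (s, c)) = s. Proof. exact: consrV0. Qed.

Let tlK s c : tl (consrV (s, c)) = c.
Proof. by apply/rowP => j; rewrite mxE consrVS. Qed.

Let smooth_sl s : smooth (sl s). Proof. exact: smooth_slice. Qed.

Let grad_sl s y : grad (sl s) y = tl (grad psi (consrV (s, y))).
Proof. by apply/rowP => j; rewrite !mxE /sl partial_slice. Qed.

Let grad_cons x : grad psi x = consrV (partial ord0 psi x, tl (grad psi x)).
Proof. by rewrite -[LHS]consK /hd mxE. Qed.

Let hess_sl s y : hess (sl s) y = row' ord0 (col' ord0 (hess psi (consrV (s, y)))).
Proof. by apply/matrixP => i j; rewrite !mxE /sl !partial_slice. Qed.

Lemma posdef_slice s y : posdef (hess (fun y => psi (consrV (s, y))) y).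
Proof.
rewrite -/(sl s).
move=> v v0; have := pdh (consrV (s, y)) (v := consrV (0, v)).
have -> : consrV (0, v) != 0.
  by apply: contra v0 => /eqP E; rewrite -(tlK 0 v) E; apply/eqP/rowP => j; rewrite !mxE.
move=> /(_ isT); rewrite !qformE big_ord_recl consrV0 /= big1; last by move=> j _; rewrite !mul0r.
rewrite add0r; congr (_ < _); apply: eq_bigr => i _; rewrite big_ord_recl consrV0 mulr0 mul0r add0r.
by apply: eq_bigr => j _; rewrite !consrVS hess_sl !mxE.
Qed.

Let posdef_sl s y : posdef (hess (sl s) y). Proof. exact: posdef_slice. Qed.

(* By midpoint convexity between (s, z) and (2 s0 - s, y0), the linear growth of
   the slice at s0 is inherited by the slice at s. *)
Let slice_range s0 s y0 : exists y, grad (sl s) y = grad (sl s0) y0.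
Proof.
set c := grad (sl s0) y0.
have [m m0 mP] := linear_growth (smooth_sl s0) (posdef_sl s0) y0.
have [C1s gs] := C1_sub_dot (smooth_sl s) c.
(* A is the defect in the midpoint comparison at y0. The radius r makes the growth r m exceed A, and
   r / 2 >= 1 lets [linear_growth] apply at y0 + p. *)
pose A := (sl s y0 - dotrV c y0) + (sl (2 * s0 - s) y0 - dotrV c y0) - 2 * (sl s0 y0 - dotrV c y0).
pose r := 2 + `|A| / m + 1.
have Am0 : 0 <= `|A| / m by rewrite divr_ge0// ltW.
have r0 : 0 < r by rewrite /r; lra.
have [|y _ /eqP] := @critical_in_ball _ _ _ y0 r C1s r0; last first.
  by rewrite gs subr_eq0 => /eqP; exists y.
move=> z zr; pose p := 2^-1 *: (z - y0).
have pE : p + p = z - y0 by rewrite /p -scalerDl -[2^-1]div1r -splitr scale1r.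
have np : `|p| = 2^-1 * r by rewrite /p normrZ zr gtr0_norm ?invr_gt0.
have h1 := mP (y0 + p); have E1 : y0 + p - y0 = p by rewrite addrAC subrr add0r.
rewrite E1 np in h1; have {}h1 : 1 <= 2^-1 * r -> _ := h1.
have r1 : 1 <= 2^-1 * r by rewrite /r; lra.
have {r1}h1 := h1 r1.
have := midpoint_le sm pdh (consrV (s0, y0 + p)) (consrV (s - s0, p)).
rewrite consrVN !consrVD opprB addrK subrKC -addrA pE subrKC.
rewrite (_ : s0 + (s0 - s) = 2 * s0 - s); last by ring.
rewrite -/(sl s0 (y0 + p)) -/(sl s z) -/(sl (2 * s0 - s) y0) => h2.
have zE : dotrV c z = dotrV c y0 + 2 * dotrV c p by rewrite -(subrKC y0 z) -pE !dotrVDr; ring.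
rewrite zE; have := ler_norm A; rewrite {1}/A.
have : `|A| < r * m by rewrite -ltr_pdivrMr// /r; lra.
move: h1 h2; rewrite -/c -mulrA.
move: (dotrV _ _) (dotrV _ _) (sl _ _) (sl _ _) (sl _ _) (sl _ _) (sl _ _) (r * m) `|A| => a b
  p1 p2 p3 p4 p5 rm nA.
lra.
Qed.

Let D := range (grad (sl 0)).

(** All slices share one range, so [Omega] is the product of a line and D, on which the integrals
    over s and c can be exchanged. *)
Let rangeD s : range (grad (sl s)) = D.
Proof.
apply/seteqP; split => _ [y _ <-].
  by have [y' yE] := slice_range s 0 y; exists y'.
by have [y' yE] := slice_range 0 s y; exists y'.
Qed.

Let Omega := [set z | D (tl z)].

Let Y z : 'rV[R]_n :=
  if pselect (exists y, grad (sl (hd z)) y = tl z) is left h then projT1 (cid h) else 0.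

Let YP z : Omega z -> grad (sl (hd z)) (Y z) = tl z.
Proof.
rewrite /Omega /= -(rangeD (hd z)) => -[y _ yE]; rewrite /Y; case: pselect => [h|[]];
  last by exists y.
by case: cid.
Qed.

Let YK z y : grad (sl (hd z)) y = tl z -> Y z = y.
Proof.
move=> yE; apply: (grad_inj (smooth_sl (hd z)) (posdef_sl (hd z))); rewrite YP//.
by rewrite /Omega /= -(rangeD (hd z)); exists y.
Qed.

(** An implicit function statement: [critical_near] applied to the slice at height [hd z] tilted by
    [tl z]. It yields both the openness of [Omega] and the continuity of Y. *)
Let Y_near z0 (r : R) : Omega z0 -> 0 < r ->
  \forall z \near z0, exists2 y, `|y - Y z0| < r & grad (sl (hd z)) y = tl z.
Proof.
move=> Oz r0.
have N : \forall z \near z0, exists2 y,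
  `|y - Y z0| < r & grad (fun y => sl (hd z) y - dotrV (tl z) y) y = 0.
  apply: (@critical_near R n 'rV[R]_n.+1 (fun z y => sl (hd z) y - dotrV (tl z) y)) => //.
  - by move=> z; exact: (C1_sub_dot (smooth_sl (hd z)) (tl z)).1.
  - move=> y; have : continuous (fun p : 'rV[R]_n.+1 * 'rV[R]_n => sl (hd p.1) p.2 - dotrV (tl
    p.1) p.2).
      have c1 (j : 'I_n.+1) : continuous (fun p : 'rV[R]_n.+1 * 'rV[R]_n => p.1 ord0 j).
        apply: (@cont_comp _ _ _ fst (fun c : 'rV[R]_n.+1 => c ord0 j)); first by move=> p;
          exact: cvg_fst.
        exact: cont_coord.
      have c2 : continuous (snd : 'rV[R]_n.+1 * 'rV[R]_n -> 'rV[R]_n) by move=> p; exact: cvg_snd.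
      apply: contB.
        apply: (@cont_comp _ _ _ (fun p : 'rV[R]_n.+1 * 'rV[R]_n => consrV (hd p.1, p.2)) psi).
          exact: (cont_consrV (c1 ord0) c2).
        exact: C1_continuous (smooth_C1 sm).
      apply: cont_sum => i; apply: contM.
        by under eq_fun do rewrite mxE; exact: c1.
      exact: (@cont_comp _ _ _ snd (fun c : 'rV[R]_n => c ord0 i) c2 (@cont_coord R n i)).
    by move=> /(_ (z0, y)).
  - move=> y yr; rewrite -(YP Oz) ltrBrDr addrAC -addrA -dotrVBr.
    have := @tangent_lt _ _ _ (smooth_sl (hd z0)) (posdef_sl (hd z0)) (Y z0) (y - Y z0).
    by rewrite -normr_gt0 yr => /(_ r0); rewrite [Y z0 + (_ - _)]addrC subrK.
move: N; apply: nbhs_imp => z -[y yr /eqP].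
by rewrite (C1_sub_dot (smooth_sl (hd z)) (tl z)).2 subr_eq0 => /eqP yc; exists y.
Qed.

Let openO : open Omega.
Proof.
rewrite openE => z Oz; rewrite /interior.
have := Y_near Oz ltr01; apply: nbhs_imp => z' [y _ yE].
by rewrite /Omega /= -(rangeD (hd z')); exists y.
Qed.

Let Y_cvg z : Omega z -> Y @ z --> Y z.
Proof.
move=> Oz; apply: cvg_dist => e e0; have := Y_near Oz e0.
apply: nbhs_imp => z' [y yr yE].
by rewrite (YK yE) distrC.
Qed.

(** Mixed coordinates: z holds the first coordinate of a point together with the remaining partial
    derivatives of [psi] at it, and X recovers the point. *)
Let X z := consrV (hd z, Y z).

Let X_cvg z : Omega z -> X @ z --> X z.
Proof.
move=> Oz; have cc : continuous (fun p : R * 'rV[R]_n => consrV (p.1, p.2)).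
  by apply: cont_consrV => p; [exact: cvg_fst|exact: cvg_snd].
apply: (@cvg_comp_at _ _ _ (fun z => (hd z, Y z)) (fun p : R * 'rV[R]_n => consrV (p.1, p.2)));
  last exact: cc.
exact: (cvg_pair (@cont_coord R n.+1 ord0 z) (Y_cvg Oz)).
Qed.

Let XE z (f : 'rV[R]_n.+1 -> R) : continuous f -> Omega z -> f (X z') @[z' --> z] --> f (X z).
Proof. by move=> cf Oz; apply: (@cvg_comp_at _ _ _ X f z); [exact: X_cvg|exact: cf]. Qed.

Let gradX z : Omega z -> grad psi (X z) = consrV (partial ord0 psi (X z), tl z).
Proof. by move=> Oz; rewrite grad_cons /X -grad_sl YP. Qed.

Let minor x := \det (row' ord0 (col' ord0 (hess psi x))).

Let minor_gt0 x : 0 < minor x.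
Proof.
rewrite /minor -(consK x) -hess_sl; apply: posdef_det_gt0; last exact: posdef_sl.
exact: hess_sym.
Qed.

Let rho0 x : 0 < rho psi x := rho_gt0 sm pdh x.

(** A Schur complement, the reciprocal of the (0, 0) entry of the inverse Hessian. It is the part of
    the Jacobian [rho psi] left over once the slices have accounted for [minor]. *)
Let w x := rho psi x / minor x.

Let cw : continuous w.
Proof.
apply: contM; first exact: cont_rho.
apply: contV; first by move=> x; rewrite gt_eqF.
apply: cont_det => i j.
have -> : (fun y : 'rV[R]_n.+1 => row' ord0 (col' ord0 (hess psi y)) i j) =
  (fun y : 'rV[R]_n.+1 => hess psi y (lift ord0 i) (lift ord0 j)).
  by apply/funext => y; rewrite [LHS]mxE [LHS]mxE.
exact: cont_hess.
Qed.

Let invhess00 x : invmx (hess psi x) ord0 ord0 = (w x)^-1.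
Proof.
rewrite /invmx unitmxE unitfE gt_eqF//; last exact: rho0.
rewrite mxE mxE /cofactor /= expr0 mul1r /w /minor invf_div mulrC.
by [].
Qed.

Let m z := partial ord0 psi (X z).

(* m is inverted by t |-> first coordinate of the preimage of (t, c) under
   grad psi, whose derivative is the (0, 0) entry of the inverse Hessian. *)
Let m_is_derive c : D c -> forall s : R, is_derive s 1 (fun s : R => m (consrV (s,
  c))) (w (X (consrV (s, c)))).
Proof.
move=> Dc s; set z := consrV (s, c).
have Oz s' : Omega (consrV (s', c)) by rewrite /Omega /= tlK.
pose T := grad (legendre psi).
have TK (y : 'rV[R]_n.+1) : T (grad psi y) = y by exact: grad_legendre.
pose f t : R := T (consrV (t, c)) ord0 ord0.
have fm s' : f (m (consrV (s', c))) = s'.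
  by rewrite /f /m -[in X in consrV (_, X)](tlK s' c) -gradX ?TK// /X consrV0 hdK.
have mf t : range (grad psi) (consrV (t, c)) ->
  m (consrV (f t, c)) = t /\ is_derive t 1 f ((w (X (consrV (f t, c))))^-1).
  move=> [x _ xE].
  have ft : f t = hd x by rewrite /f -xE TK.
  have Yx : Y (consrV (f t, c)) = tl x.
    by apply: YK; rewrite hdK tlK ft grad_sl consK xE tlK.
  have Xx : X (consrV (f t, c)) = x by rewrite /X hdK Yx ft consK.
  have mE : m (consrV (f t, c)) = t by rewrite /m Xx; have := congr1 hd xE; rewrite hdK /hd mxE.
  split=> //; rewrite Xx.
  have := @inv_grad_is_derive _ _ psi sm pdh T TK x (delta_mx ord0 ord0) ord0.
  rewrite xE -rowE mxE invhess00.
  have -> : consrV (t, c) = consrV (0, c) + t *: delta_mx ord0 ord0 by rewrite consrV_delta0 add0r.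
  move=> [d1 d2]; have := is_derive_line d1; rewrite d2.
  have -> : (fun t' : R => T (consrV (0, c) + t' *: delta_mx ord0 ord0) ord0 ord0) = f.
    by apply/funext => t'; rewrite consrV_delta0 add0r.
  exact.
have openr := open_range_grad sm pdh.
pose t := m z.
have rt : range (grad psi) (consrV (t, c)).
  by exists (X z); [|rewrite (gradX (Oz s)) tlK].
have Nt : \forall t' \near t, range (grad psi) (consrV (t', c)).
  have cc : continuous (fun t' : R => consrV (t', c)).
    by apply: (@cont_consrV _ _ _ id (fun=> c)) => x; [exact: cvg_id|exact: cvg_cst].
  by apply: (cc t); exact: open_nbhs_nbhs.
have ftE : f t = s by exact: fm.
have [_ df] := mf t rt.
rewrite ftE in df.
have N1 : {near t, cancel f (fun s => m (consrV (s, c)))}.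
  by move: Nt; apply: filterS => t' /mf[].
have N2 : {near t, continuous f}.
  by move: Nt; apply: filterS => t' /mf[_ [dt' _]]; apply: differentiable_continuous;
    apply/derivable1_diffP.
have w0 : (w (X z))^-1 != 0 by rewrite invr_eq0 /w mulf_neq0// ?invr_eq0 gt_eqF.
have := is_derive_inverse N1 N2 df w0; rewrite ftE invrK.
exact.
Qed.

Let mO : measurable Omega. Proof. exact: open_measurable_rV. Qed.

(** The integrand in mixed coordinates. Integrating it over c first gives one side of the
    substitution formula, over s first the other. *)
Let H (h : 'rV[R]_n.+1 -> \bar R) : 'rV[R]_n.+1 -> \bar R :=
  (fun z => h (consrV (m z, tl z)) * (w (X z))%:E)%E \_ Omega.

Let H_ge0 h z : (forall x, (0 <= h x)%E) -> (0 <= H h z)%E.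
Proof.
move=> h0; rewrite /H patchE; case: ifP => // _; rewrite mule_ge0// lee_fin.
by rewrite /w divr_ge0// ltW.
Qed.

Let measurable_H h : measurable_fun setT h -> measurable_fun setT (H h).
Proof.
move=> mh; apply/(measurable_restrictT _ mO); apply: emeasurable_funM.
  have mm : measurable_fun setT (m \_ Omega).
    apply/(measurable_restrictT _ mO); apply: cont_measurable_rV => // z Oz.
    by apply: (@XE z (partial ord0 psi)) => //; exact: (smooth_C1 sm ord0).2.
  apply: (@eq_measurable_fun _ _ _ _ _ (h \o (fun z => consrV ((m \_ Omega) z, tl z)))).
    by move=> z Oz; rewrite /= patchE Oz.
  apply: measurable_funTS; apply: (measurableT_comp mh).
  apply: (measurableT_comp (@measurable_consrV R n)); apply/measurable_fun_pairP; split => //=.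
  apply/measurable_fun_rVP => j; under eq_fun do rewrite mxE; exact: measurable_coord.
apply/measurable_EFinP; apply: cont_measurable_rV => // z Oz.
exact: (XE cw).
Qed.

Let measurable_gradT : measurable_fun setT (grad psi).
Proof. by apply: continuous_measurable_rVrV; exact: cont_grad. Qed.

Let measurable_range : measurable (range (grad psi)).
Proof.
by apply: open_measurable_rV; exact: open_range_grad.
Qed.

(** The Jacobian factors as [minor] times w: the first belongs to the slice map y |-> c at fixed s,
    covered by the hypothesis, the second to s |-> t at fixed c, covered by the one-dimensional
    substitution. *)
Lemma grad_substitution_step :
  (forall s (h : 'rV[R]_n -> \bar R), measurable_fun setT h -> (forall y, (0 <= h y)%E) ->
   (\int[lebesgue_rV n]_y (h (grad (fun y => psi (consrV (s,
     y))) y) * (rho (fun y => psi (consrV (s, y))) y)%:E)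
    = \int[lebesgue_rV n]_(c in range (grad (fun y => psi (consrV (s, y))))) h c)%E) ->
  forall h : 'rV[R]_n.+1 -> \bar R, measurable_fun setT h -> (forall x, (0 <= h x)%E) ->
   (\int[lebesgue_rV n.+1]_x (h (grad psi x) * (rho psi x)%:E)
    = \int[lebesgue_rV n.+1]_(x in range (grad psi)) h x)%E.
Proof.
move=> IH h mh h0.
have rho_sl s y : rho (sl s) y = minor (consrV (s, y)) by rewrite /rho hess_sl.
have cr := cont_rho sm.
have mL : measurable_fun setT (fun x => (h (grad psi x) * (rho psi x)%:E)%E).
  apply: emeasurable_funM; first exact: (measurableT_comp mh measurable_gradT).
  by apply/measurable_EFinP; exact: continuous_measurable_rV.
have L0 x : (0 <= h (grad psi x) * (rho psi x)%:E)%E by rewrite mule_ge0// lee_fin ltW.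
have mH := measurable_H mh; have H0 z := H_ge0 z h0.
transitivity (\int[lebesgue_rV n.+1]_z H h z)%E.
  rewrite (integral_rVS mL L0) (integral_rVS mH H0); apply: eq_integral => s _.
  have mHs : measurable_fun setT (fun c => H h (consrV (s, c))) :=
    measurableT_comp mH (measurable_consrVl s).
  transitivity (\int[lebesgue_rV n]_y (H h (consrV (s, grad (sl s) y)) * (rho (sl s) y)%:E))%E.
    apply: eq_integral => y _; rewrite /H patchE ifT; last first.
      by rewrite inE /Omega /= tlK -(rangeD s); exists y.
    have Yx : Y (consrV (s, grad (sl s) y)) = y by apply: YK; rewrite hdK tlK.
    have Xx : X (consrV (s, grad (sl s) y)) = consrV (s, y) by rewrite /X Yx hdK.
    rewrite /m Xx tlK grad_sl -grad_cons -muleA -EFinM rho_sl /w divfK//.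
    by rewrite gt_eqF.
  rewrite (IH s (fun c => H h (consrV (s, c))))// -/(sl s) rangeD integral_mkcond.
  apply: eq_integral => c _; rewrite patchE; case: ifPn => // Dc; rewrite /H patchE ifF//.
  by apply/negbTE; apply: contra Dc; rewrite !inE /Omega /= tlK.
have mR : measurable_fun setT (h \_ (range (grad psi))).
  by apply/(measurable_restrictT _ measurable_range); exact: measurable_funTS.
have R0 z : (0 <= (h \_ (range (grad psi))) z)%E by rewrite patchE; case: ifP.
rewrite [RHS]integral_mkcond (integral_rVS_swap mH H0) (integral_rVS_swap mR R0).
apply: eq_integral => c _.
have [Dc|nDc] := pselect (D c); last first.
  apply: eq_integral => s _; rewrite /H !patchE !ifF//; apply/negbTE; apply/negP; rewrite inE.
    move=> [x _ xE]; apply: nDc; rewrite -(rangeD (hd x)); exists (tl x) => //.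
    by rewrite grad_sl consK xE tlK.
  by rewrite /Omega /= tlK.
have Oc s : Omega (consrV (s, c)) by rewrite /Omega /= tlK.
have d3 : continuous (fun s => w (X (consrV (s, c)))).
  move=> s; apply: (@cvg_comp_at _ _ _ (fun s : R => consrV (s, c)) (fun z => w (X z)));
    last exact: XE.
  by apply: (@cont_consrV _ _ _ id (fun=> c)) => x; [exact: cvg_id|exact: cvg_cst].
have d2 s : 0 < w (X (consrV (s, c))) by rewrite /w divr_gt0.
have mhc : measurable_fun setT (fun t => h (consrV (t, c))) :=
  measurableT_comp mh (measurable_consrVr c).
have := increasing_substitution (m_is_derive Dc) d2 d3 mhc (fun t => h0 _).
move=> S; transitivity (\int[lebesgue_measure]_s (h (consrV (m (consrV (s, c)),
  c)) * (w (X (consrV (s, c))))%:E))%E.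
  by apply: eq_integral => s _; rewrite /H patchE ifT ?tlK// inE.
transitivity (\int[lebesgue_measure]_(t in range (fun s => m (consrV (s, c)))) h (consrV (t,
  c)))%E => //.
rewrite integral_mkcond; apply: eq_integral => t _; rewrite !patchE.
suff -> : (t \in range (fun s => m (consrV (s, c)))) = (consrV (t, c) \in range (grad psi)) by [].
apply/idP/idP; rewrite !inE.
  by move=> [s _ <-]; exists (X (consrV (s, c))) => //; rewrite (gradX (Oc s)) tlK.
move=> [x _ xE]; exists (hd x) => //.
have Yx : Y (consrV (hd x, c)) = tl x by apply: YK; rewrite hdK tlK grad_sl consK xE tlK.
by rewrite /m /X Yx hdK consK; have := congr1 hd xE; rewrite hdK /hd mxE.
Qed.

End slices.

(* Induction on n: integrate over the slice with the first coordinate s fixed,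
   exchange the integrals, then substitute t = d_0 psi along the curve of points
   whose other partial derivatives are fixed. *)
Theorem grad_substitution (R : realType) n (psi : 'rV[R]_n -> R) : smooth psi ->
  (forall x, posdef (hess psi x)) ->
  forall h : 'rV[R]_n -> \bar R, measurable_fun setT h -> (forall x, (0 <= h x)%E) ->
  (\int[lebesgue_rV n]_x (h (grad psi x) * (rho psi x)%:E)
    = \int[lebesgue_rV n]_(x in range (grad psi)) h x)%E.
Proof.
elim: n psi => [|n IH] psi sm pdh h mh h0; last first.
  apply: (grad_substitution_step sm pdh) => // s h' mh' h'0; apply: IH => //.
    exact: smooth_slice.
  exact: posdef_slice.
have E (x : 'rV[R]_0) : x = 0 by apply/rowP => -[].
have -> : range (grad psi) = setT by apply/seteqP; split => // x _; exists 0 => //;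
  rewrite (E x) (E (grad _ _)).
by apply: eq_integral => x _; rewrite (E (grad psi x)) -(E x) /rho det_mx00 mule1.
Qed.

(** * Almost everywhere differentiability of Lipschitz functions *)

Section stieltjes.
Context {R : realType}.
Local Notation leb := lebesgue_measure.

Lemma stieltjes_itv (G : cumulative R R) (a b : R) : a <= b ->
  lebesgue_stieltjes_measure G `]a, b]%classic = (G b - G a)%:E.
Proof.
move=> ab; rewrite /lebesgue_stieltjes_measure /measure_extension measurable_mu_extE/=;
  last exact: is_ocitv.
exact: wlength_itv_bnd.
Qed.

Lemma stieltjes_exists (g : R -> R) : {homo g : x y / x <= y} -> continuous g ->
  exists nu : {measure set (measurableTypeR R) -> \bar R},
  forall a b : R, a <= b -> nu `]a, b]%classic = (g b - g a)%:E.
Proof.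
move=> ndg cg.
pose G : cumulative R R := HB.pack g (isCumulative.Build R _ R g ndg (right_continuousW cg)).
exists (lebesgue_stieltjes_measure G) => a b ab.
exact: stieltjes_itv.
Qed.

Lemma stieltjes_unique (m1 m2 : {measure set (measurableTypeR R) -> \bar R}) (g : R -> R) :
  (forall a b : R, a <= b -> m1 `]a, b]%classic = (g b - g a)%:E) ->
  (forall a b : R, a <= b -> m2 `]a, b]%classic = (g b - g a)%:E) ->
  forall A, measurable A -> m1 A = m2 A.
Proof.
move=> h1 h2 A mA.
apply: (@measure_unique _ R (measurableTypeR R) (@ocitv R) (fun k => `]- k%:R,
  k%:R]%classic)) => //.
- exact: ocitvI.
- by move=> k; exact: is_ocitv.
- by apply/seteqP; split => // x _; exists (Num.truncn `|x|).+1 => //=; rewrite in_itv /=;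
  have := truncnS_gt `|x|; rewrite ltr_norml => /andP[-> /ltW].
- move=> _ [[a b] _ <-] /=; case: (leP a b) => ab; first by rewrite h1// h2.
  have -> : (`]a, b]%classic = set0 :> set R) by rewrite set_itv_ge// bnd_simp -leNgt ltW.
  by rewrite !measure0.
- by move=> k; rewrite h1 ?ltry// (@le_trans _ _ 0)// ?oppr_le0.
Qed.

End stieltjes.

Section lipschitz_ae.
Context {R : realType}.
Local Notation leb := (@lebesgue_measure R).

Lemma lipschitz1_continuous (f : R -> R) (L : R) :
  (forall s t, `|f s - f t| <= L * `|s - t|) -> continuous f.
Proof.
move=> fL x; apply: cvg_dist => e e0.
have L0 : 0 < `|L| + 1 by rewrite ltr_wpDl.
near=> y; apply: le_lt_trans (fL _ _) _.
apply: (@le_lt_trans _ _ ((`|L| + 1) * `|x - y|)).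
  by rewrite ler_wpM2r// (le_trans (ler_norm L))// lerDl.
rewrite mulrC -ltr_pdivlMr//; near: y.
apply: (@cvgr_dist_lt _ _ _ (nbhs x) _ id x); [exact: cvg_id|exact: divr_gt0].
Unshelve. all: by end_near. Qed.

(* The Stieltjes measures of f + L t and L t - f add up to 2 L times the Lebesgue
   measure, so the first has a density; f + L t is a primitive of it. *)
Lemma lipschitz_ae_derivable (f : R -> R) (L a b : R) :
  (forall s t, `|f s - f t| <= L * `|s - t|) ->
  {ae leb, forall x, a < x < b -> derivable f x 1}.
Proof.
move=> fL; have cf := lipschitz1_continuous fL.
have L0 : 0 <= L by have := fL 1 0; rewrite subr0 normr1 mulr1; apply: le_trans.
case: (ltP a b) => ab; last first.
  by apply: aeW => x /andP[ax xb]; have := lt_trans ax xb; rewrite ltNge ab.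
pose g1 t := f t + L * t; pose g2 t := L * t - f t.
have cL : continuous (fun t : R => L * t) by apply: contM; [exact: cont_cst|move=> x;
  exact: cvg_id].
have g1nd : {homo g1 : x y / x <= y}.
  move=> x y xy; rewrite -subr_ge0; have := fL x y;
    rewrite distrC (distrC x) (ger0_norm (_ : 0 <= y - x)) ?subr_ge0//.
  by rewrite /g1 ler_norml => /andP[h _]; move: h; lra.
have g2nd : {homo g2 : x y / x <= y}.
  move=> x y xy; rewrite -subr_ge0; have := fL x y;
    rewrite distrC (distrC x) (ger0_norm (_ : 0 <= y - x)) ?subr_ge0//.
  by rewrite /g2 ler_norml => /andP[_ h]; move: h; lra.
have [nu1 h1] := stieltjes_exists g1nd (contD cf cL).
have [nu2 h2] := stieltjes_exists g2nd (contB cL cf).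
pose lebm : {measure set (measurableTypeR R) -> \bar R} := leb.
have L20 : 0 <= 2 * L by rewrite mulr_ge0.
have addE A : measurable A -> (nu1 A + nu2 A = (2 * L)%:E * leb A)%E.
  move=> mA.
  rewrite -measure_addE; apply: (@stieltjes_unique R (measure_add nu1 nu2) (mscale (NngNum L20)
    lebm) (fun t => 2 * L * t)) => // s t st.
    transitivity (nu1 `]s, t]%classic + nu2 `]s, t]%classic)%E; first exact: measure_addE.
    by rewrite h1// h2// -EFinD; congr (_%:E); rewrite /g1 /g2; lra.
  transitivity ((2 * L)%:E * leb (`]s, t]%classic : set R))%E => //.
  rewrite lebesgue_measure_itv /= lte_fin; case: ltP => ts.
    by rewrite -EFinD -EFinM mulrBr.
  by rewrite mule0 (@le_anti _ _ s t) ?subrr// st ts.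
pose I := `]a, b]%classic : set (measurableTypeR R).
have mI : measurable I by exact: measurable_itv.
have Ioo : (nu1 I < +oo)%E by rewrite h1 ?ltry// ltW.
pose nu : {finite_measure set (measurableTypeR R) -> \bar R} := mfrestr mI Ioo.
(* Since nu2 is nonnegative, nu1 is at most 2 L times Lebesgue measure, hence absolutely
   continuous. *)
have dom : nu `<< (leb : {sigma_finite_measure set (measurableTypeR R) -> \bar R}).
  apply/null_content_dominatesP => A mA A0.
  rewrite /nu /mfrestr /mrestr /=; apply/eqP; rewrite eq_le measure_ge0 andbT.
  apply: (@le_trans _ _ (nu1 A)).
    by apply: le_measure; rewrite ?inE//; exact: measurableI.
  have := addE A mA; rewrite A0 mule0 => <-.
  by rewrite leeDl.
have [h [h0 hfin hint hE]] := radon_nikodym_sigma_finite dom.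
pose hr t := fine (h t).
have hrE : EFin \o hr = h by apply/funext => t; rewrite /= fineK.
have hri : leb.-integrable [set: R] (EFin \o hr) by rewrite hrE.
have hriS (D : set R) : measurable D -> leb.-integrable D (EFin \o hr) by move=> mD;
  exact: integrableS hri.
have := @FTC1 R hr (BRight a) (fun y => hriS _ (measurable_itv _)) (open_integrable_locally
  openT hri).
apply: filterS; first exact: (ae_filter_ringOfSetsType leb).
move=> x Fx /andP[ax xb].
have [dF _] := Fx ax.
pose F t : R := (\int[leb]_(s in `]a, t]) hr s)%R.
have FE t : a < t < b -> F t = g1 t - g1 a.
  move=> /andP[aT tb]; rewrite /F /Rintegral -/(EFin \o hr) hrE -hE; last exact: measurable_itv.
  have -> : nu `]a, t]%classic = nu1 (`]a, t]%classic `&` I) by [].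
  have -> : `]a, t]%classic `&` I = `]a, t]%classic; last by rewrite h1// ltW.
  by apply/seteqP; split => [u []//|u /=]; rewrite /I /= !in_itv /= => /andP[-> ut];
    rewrite ut (le_trans ut)// ltW.
(* On ]a, b[ the function k coincides with f, and F is derivable at x by Lebesgue
   differentiation. *)
pose k t : R := F t + (g1 a - L * t).
have : derivable k x 1.
  apply: derivableD; first exact: dF.
  apply: derivableB; first exact: derivable_cst.
  by apply: derivableM; [exact: derivable_cst|exact: derivable_id].
apply: near_eq_derivable; near=> t.
have tab : t \in `]a, b[ by near: t; apply: near_in_itvoo; rewrite in_itv /= ax.
rewrite in_itv /= in tab.
by rewrite /k FE// /g1; ring.
Unshelve. all: by end_near. Qed.

End lipschitz_ae.

Section lipschitz_line.
Context {R : realType}.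
Local Notation leb := (@lebesgue_measure R).

(** Clamping the argument to [a, b] is 1-Lipschitz, so f o c is globally Lipschitz, and it agrees
    with f near every interior point. *)
Lemma lipschitz_on_ae_derivable (f : R -> R) (L a b : R) : a < b ->
  (forall s t, a <= s <= b -> a <= t <= b -> `|f s - f t| <= L * `|s - t|) ->
  {ae leb, forall x, a < x < b -> derivable f x 1}.
Proof.
move=> ab fL; pose c t := Num.max a (Num.min b t).
have cI t : a <= c t <= b.
  by rewrite /c le_max lexx /= ge_max (ltW ab) ge_min lexx.
have L0 : 0 <= L.
  have := fL a b; rewrite !lexx (ltW ab) => /(_ isT isT) h.
  have : 0 <= L * `|a - b| by apply: le_trans h.
  by rewrite pmulr_lge0// normr_gt0 subr_eq0 lt_eqF.
have cLip s t : `|c s - c t| <= `|s - t|.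
  wlog st : s t / s <= t.
    by move=> W; case: (leP s t) => [/W//|/ltW/W]; rewrite distrC (distrC t).
  have cst : c s <= c t.
    have m1 : Num.min b s <= b by rewrite ge_min lexx.
    have m2 : Num.min b s <= t by rewrite ge_min st orbT.
    by rewrite /c ge_max !le_max lexx /= le_min m1 m2 orbT.
  rewrite distrC (distrC s) !ger0_norm ?subr_ge0// lerBlDl.
  rewrite {1}/c ge_max; case/andP: (cI s) => ac _.
  rewrite (le_trans ac) /= ?lerDl ?subr_ge0//.
  apply: (@le_trans _ _ (Num.min b s + (t - s))); last by rewrite lerD2r /c le_max lexx orbT.
  rewrite {2}/Num.min; case: (ltP b s) => bs.
    by rewrite (@le_trans _ _ b) ?ge_min ?lexx// lerDl subr_ge0.
  by rewrite subrKC ge_min lexx orbT.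
have := @lipschitz_ae_derivable R (f \o c) L a b.
move=> /(_ (fun s t => le_trans (fL _ _ (cI s) (cI t)) (ler_wpM2l L0 (cLip s t)))).
apply: filterS; first exact: (ae_filter_ringOfSetsType leb).
move=> x dx axb; apply: near_eq_derivable (dx axb); near=> t.
have tab : t \in `]a, b[ by near: t; apply: near_in_itvoo; rewrite in_itv.
move: tab; rewrite in_itv /= => /andP[/ltW at_ /ltW tb].
by rewrite /= /c min_r// max_r.
Unshelve. all: by end_near. Qed.

Lemma locally_lipschitz_ae_derivable (f : R -> R) :
  (forall M : R, exists L : R, forall s t, `|s| <= M -> `|t| <= M ->
    `|f s - f t| <= L * `|s - t|) ->
  leb.-negligible [set x | ~ derivable f x 1].
Proof.
move=> fL; pose N k := [set x : R | `|x| < k.+1%:R /\ ~ derivable f x 1].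
apply: (@negligibleS _ _ _ leb (\bigcup_k N k)).
  move=> x /= dx; exists (Num.truncn `|x|) => //; split => //.
  by rewrite truncnS_gt.
apply: negligible_bigcup => k; have [L LP] := fL k.+1%:R.
have k0 : - k.+1%:R < k.+1%:R :> R by rewrite gtrN.
have := @lipschitz_on_ae_derivable f L (- k.+1%:R) k.+1%:R k0.
move=> /(_ _)[|A [mA A0 AP]].
  by move=> s t; rewrite -!ler_norml; exact: LP.
exists A; split => //; apply: subset_trans AP => x [xk dx] /=.
by rewrite -ltr_norml => /(_ xk).
Qed.

End lipschitz_line.

(** * Partial derivatives of Lipschitz functions almost everywhere *)

Section partial_ae.
Context {R : realType} {n : nat}.
Implicit Types (f : 'rV[R]_n -> R) (x : 'rV[R]_n).
Local Notation e_ j := (delta_mx (ord0 : 'I_1) j : 'rV[R]_n).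

Definition partial_dom f j := [set x : 'rV[R]_n | derivable f x (e_ j)].

Let q f j x (h : R) : R := h^-1 *: ((f \o shift x) (h *: e_ j) - f x).

Let cq f j h : continuous f -> continuous (fun x => q f j x h).
Proof.
move=> cf; apply: (@contM _ _ (fun _ => h^-1)); first exact: cont_cst.
apply: contB => //; apply: (@cont_comp _ _ _ (fun x => h *: e_ j + x) f) => //.
apply: cont_rV => i; under eq_fun do rewrite rVDE.
by apply: contD; [exact: cont_cst|exact: cont_coord].
Qed.

(* Sets of points where the difference quotients are Cauchy at a given scale:
   being closed for continuous f, they make the domain of a partial derivative
   measurable. *)
Let C f j k m := [set x | forall h h' : R, 0 < `|h| < m.+1%:R^-1 -> 0 < `|h'| < m.+1%:R^-1 ->
  `|q f j x h - q f j x h'| <= k.+1%:R^-1].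

Let closedC f j k m : continuous f -> closed (C f j k m).
Proof.
move=> cf.
have -> : C f j k m = \bigcap_(p in [set p : R * R | (0 < `|p.1| < m.+1%:R^-1) && (0 < `|p.2| <
  m.+1%:R^-1)])
    (fun x => `|q f j x p.1 - q f j x p.2|) @^-1` [set t | t <= k.+1%:R^-1].
  apply/seteqP; split => x; first by move=> h [a b] /= /andP[a0 b0]; exact: h.
  by move=> h a b a0 b0; apply: (h (a, b)) => /=; rewrite a0 b0.
apply: closed_bigI => p _; apply: closed_comp; last exact: closed_le.
move=> x _; move: x; apply: cont_norm; apply: contB; exact: cq.
Qed.

Let partial_domE f j : partial_dom f j = \bigcap_k \bigcup_m C f j k m.
Proof.
apply/seteqP; split => x.
  move=> /cauchy_cvgP/cauchy_ballP dx k _.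
  have k0 : 0 < k.+1%:R^-1 :> R by rewrite invr_gt0.
  have [[A B] /= [[d1 /= d10 dA] [d2 /= d20 dB]] AB] := dx _ k0.
  exists (Num.truncn (Num.min d1 d2)^-1) => // h h' /andP[h0 hd] /andP[h'0 h'd].
  have d0 : 0 < Num.min d1 d2 by rewrite lt_min d10.
  have md : (Num.truncn (Num.min d1 d2)^-1).+1%:R^-1 < Num.min d1 d2.
    by rewrite invf_plt ?posrE//; exact: truncnS_gt.
  have {}hd := lt_trans hd md; have {}h'd := lt_trans h'd md.
  rewrite !lt_min in hd h'd; case/andP: hd => hd1 hd2; case/andP: h'd => h'd1 h'd2.
  have Ah : A (q f j x h) by apply: (dA h); [rewrite /= sub0r normrN|rewrite -normr_gt0].
  have Bh : B (q f j x h') by apply: (dB h'); [rewrite /= sub0r normrN|rewrite -normr_gt0].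
  by apply/ltW; exact: (AB (q f j x h, q f j x h') (conj Ah Bh)).
move=> h; apply/cauchy_cvgP/cauchy_ballP => e e0.
have [k ke] : exists k, k.+1%:R^-1 < e :> R.
  by exists (Num.truncn e^-1); rewrite invf_plt ?posrE//; exact: truncnS_gt.
have [m _ hm] := h k I.
have m0 : 0 < m.+1%:R^-1 :> R by rewrite invr_gt0.
have N : \forall t \near (0 : R)^', 0 < `|t| < m.+1%:R^-1.
  near=> t; rewrite normr_gt0; apply/andP; split; first by near: t; exact: nbhs_dnbhs_neq.
  by near: t; exact: dnbhs0_lt.
pose S := [set q f j x t | t in [set t | 0 < `|t| < m.+1%:R^-1]].
exists (S, S) => /=.
  by split; apply: filterS N => t ht; exists t.
by move=> [_ _] [[a a0 <-] [b b0 <-]]; apply: le_lt_trans ke; exact: hm.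
Unshelve. all: by end_near. Qed.

Lemma measurable_partial_dom f j : continuous f -> measurable (partial_dom f j).
Proof.
move=> cf; rewrite partial_domE; apply: bigcapT_measurable => k.
apply: bigcupT_measurable => m; rewrite -[X in measurable X]setCK; apply: measurableC.
apply: open_measurable_rV; rewrite openC; exact: closedC.
Qed.

Lemma partial_dom_cvg f j x (t : R^nat) : partial_dom f j x -> (forall k, t k != 0) ->
  t @ \oo --> 0 -> (fun k => (t k)^-1 * (f (x + t k *: e_ j) - f x)) @ \oo --> partial j f x.
Proof.
move=> dx t0 ct; rewrite partialE.
have : q f j x h @[h --> (0 : R)^'] --> 'D_(e_ j) f x by exact: dx.
have ct' : t @ \oo --> (0 : R)^'.
  move=> A NA; have N : \forall k \near \oo, t k != 0 -> A (t k) by exact: (ct _ NA).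
  by apply: filterS N => k; apply; exact: t0.
have -> : (fun k => (t k)^-1 * (f (x + t k *: e_ j) - f x)) = q f j x \o t.
  by apply/funext => k /=; rewrite /q /= [_ + x]addrC.
by move=> h; exact: (cvg_comp _ _ ct' h).
Qed.

Lemma partial_dom_near f g j x : (\forall y \near x, f y = g y) -> partial_dom f j x ->
  partial_dom g j x /\ partial j f x = partial j g x.
Proof.
move=> fg dx; have nfg : {near x, f =1 g} by [].
split; first exact: near_eq_derivable nfg dx.
rewrite !partialE; apply: near_eq_derive nfg.
Qed.

(** The class that is stable under composition with [grad psi], which is Lipschitz on bounded sets:
    F = g o grad psi belongs to it when g is Lipschitz. *)
Definition bdd_lipschitz f := forall M : R, exists L : R, forall x y, `|x| <= M -> `|y| <= M ->
  `|f x - f y| <= L * `|x - y|.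

Lemma bdd_lipschitz_continuous f : bdd_lipschitz f -> continuous f.
Proof.
move=> fL x; apply: cvg_dist => e e0.
have [L LP] := fL (`|x| + 1).
have L0 : 0 < `|L| + 1 by rewrite ltr_wpDl.
have r0 : 0 < Num.min 1 (e / (`|L| + 1)) by rewrite lt_min ltr01 divr_gt0.
apply: (@filterS _ (nbhs x) (@nbhs_filter _ _) [set y | `|x - y| < Num.min 1 (e / (`|L| +
  1))]); last first.
  by apply/nbhs_ballP; exists (Num.min 1 (e / (`|L| + 1))) => // y; rewrite -ball_normE.
move=> y /=; rewrite lt_min => /andP[y1 ye].
apply: le_lt_trans (LP x y _ _) _.
- by rewrite lerDl.
- by rewrite -[y](subKr x) (le_trans (ler_normB _ _))// lerD2l ltW.
- apply: (@le_lt_trans _ _ ((`|L| + 1) * `|x - y|)).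
    by rewrite ler_wpM2r// (le_trans (ler_norm L))// lerDl.
  by rewrite mulrC -ltr_pdivlMr.
Qed.

Lemma lipschitz_bdd f (L : R) : (forall x y, `|f x - f y| <= L * `|x - y|) -> bdd_lipschitz f.
Proof. by move=> fL M; exists L => x y _ _. Qed.

Lemma lipschitz_continuous_rV f (L : R) :
  (forall x y, `|f x - f y| <= L * `|x - y|) -> continuous f.
Proof. by move=> /lipschitz_bdd/bdd_lipschitz_continuous. Qed.

Lemma norm_delta_le1 j : `|e_ j| <= 1 :> R.
Proof. by apply: norm_le_coord => // i; rewrite mxE eqxx /=; case: (i == j);
  rewrite /= ?normr1 ?normr0. Qed.

Lemma derivable_lineE f x (t : R) j :
  derivable (fun s : R => f (x + s *: e_ j)) t 1 <-> derivable f (x + t *: e_ j) (e_ j).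
Proof.
suff E : (fun h : R => h^-1 *: (((fun s : R => f (x + s *: e_ j)) \o shift t) (h *: 1) - f (x +
  t *: e_ j)))
  = (fun h : R => h^-1 *: ((f \o shift (x + t *: e_ j)) (h *: e_ j) - f (x + t *: e_ j))).
  by split; rewrite /derivable => /=; [rewrite E|rewrite -E].
apply/funext => h /=; rewrite [h *: 1]mulr1 scalerDl.
by rewrite [h *: e_ j + (x + _)]addrCA.
Qed.

(** Along each line in direction j the exceptional points form a null set by the one-dimensional
    theorem, and Fubini assembles the lines; this relies on the measurability of [partial_dom]. *)
Lemma partial_dom_null f j : bdd_lipschitz f -> lebesgue_rV n (~` partial_dom f j) = 0%E.
Proof.
move=> fL; have cf := bdd_lipschitz_continuous fL.
have mE : measurable (~` partial_dom f j) by apply: measurableC; exact: measurable_partial_dom.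
apply: (@lebesgue_rV_null_lines R n j) => // x.
have mL : measurable ((fun t : R => x + t *: e_ j) @^-1` (~` partial_dom f j)).
  by rewrite -[X in measurable X]setTI; apply: measurable_line.
apply: measure_negligible => //.
apply: (@negligibleS _ _ _ lebesgue_measure [set t | ~ derivable (fun s : R => f (x +
  s *: e_ j)) t 1]).
  by move=> t /= ndt; rewrite derivable_lineE.
apply: locally_lipschitz_ae_derivable => M.
have [L LP] := fL (`|x| + `|M|); exists `|L| => s t sM tM.
have B (r : R) : `|r| <= M -> `|x + r *: e_ j| <= `|x| + `|M|.
  move=> rM; apply: le_trans (ler_normD _ _) _; rewrite lerD2l normrZ.
  by rewrite (le_trans (ler_piMr _ (norm_delta_le1 j)))// (le_trans rM)// ler_norm.
apply: le_trans (LP _ _ (B _ sM) (B _ tM)) _.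
rewrite opprD addrACA subrr add0r -scalerBl normrZ.
apply: (@le_trans _ _ (`|L| * (`|s - t| * `|e_ j|)));
  first by rewrite ler_wpM2r ?mulr_ge0// ler_norm.
by rewrite ler_wpM2l// ler_piMr// norm_delta_le1.
Qed.

Lemma partial_dom_ae f : bdd_lipschitz f ->
  {ae lebesgue_rV n, forall x, forall j, partial_dom f j x}.
Proof.
move=> fL; apply: filter_forall => j; exists (~` partial_dom f j); split => //.
  by apply: measurableC; exact: measurable_partial_dom (bdd_lipschitz_continuous fL).
exact: partial_dom_null.
Qed.

(** Cutting to 0 outside the domain removes the default values of the derivative and makes the
    function a measurable limit of difference quotients. *)
Definition partial_ae j f := partial j f \_ (partial_dom f j).

Lemma measurable_partial_ae j f : continuous f -> measurable_fun setT (partial_ae j f).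
Proof.
move=> cf; apply/(measurable_restrictT _ (measurable_partial_dom j cf)).
apply: (@measurable_fun_cvg _ _ _ _ (fun k x => (k.+1%:R^-1)^-1 * (f (x +
  k.+1%:R^-1 *: e_ j) - f x))).
  move=> k; apply: measurable_funTS; apply: continuous_measurable_rV.
  apply: contM; first exact: cont_cst.
  apply: contB => //; apply: (@cont_comp _ _ _ (fun x => x + k.+1%:R^-1 *: e_ j) f) => //.
  apply: cont_rV => i; under eq_fun do rewrite rVDE.
  by apply: contD; [exact: cont_coord|exact: cont_cst].
move=> x dx; apply: partial_dom_cvg => //; exact: cvg_harmonic.
Qed.

End partial_ae.

(** * Vanishing integral of a partial derivative with compact support *)

Section box.
Context {R : realType} {n : nat}.
Implicit Types (f : 'rV[R]_n -> R) (x : 'rV[R]_n).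
Local Notation e_ j := (delta_mx (ord0 : 'I_1) j : 'rV[R]_n).

Definition box (M : R) := [set x : 'rV[R]_n | forall i, `[- M, M]%classic (x ord0 i)].

Lemma measurable_box M : measurable (box M).
Proof.
rewrite (_ : box M = \bigcap_(i in [set: 'I_n])
    ((fun v : 'rV[R]_n => v ord0 i) @^-1` `[- M, M])); last first.
  by apply/seteqP; split => v /= h i; [move=> _; exact: h|exact: h].
apply: fin_bigcap_measurable => // i _.
by rewrite -[X in measurable X]setTI; apply: measurable_coord.
Qed.

Lemma lebesgue_box_lty M : (lebesgue_rV n (box M) < +oo)%E.
Proof.
rewrite /box (@lebesgue_rV_box R n (fun=> `[- M, M]%classic)) => [|i]; last exact: measurable_itv.
rewrite big_const_ord; elim: n => [|k IH] /=; first exact: ltry.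
apply: lte_mul_pinfty => //; rewrite lebesgue_measure_itv /=; case: ifP => // _.
Qed.

Lemma mem_box M x : `|x| <= M -> box M x.
Proof.
by move=> xM i /=; rewrite in_itv /= -ler_norml (le_trans (coord_le_norm x i)).
Qed.

Lemma integrable_box f M C : measurable_fun setT f -> (forall x, `|f x| <= C) ->
  (forall x, ~ box M x -> f x = 0) -> (lebesgue_rV n).-integrable setT (EFin \o f).
Proof.
move=> mf fC f0.
have -> : EFin \o f = (EFin \o f) \_ (box M).
  apply/funext => x; rewrite patchE; case: ifPn => // xM; rewrite /= f0//.
  by move=> h; move: xM; rewrite mem_set.
apply/(integrable_mkcond _ (measurable_box M)).
apply: measurable_bounded_integrable; first exact: measurable_box.
- exact: lebesgue_box_lty.
- exact: measurable_funTS.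
- by exists C; split; [exact: num_real|move=> r Cr x _; exact: le_trans (fC x) (ltW Cr)].
Qed.

Lemma integral_rV_translate_real j (t : R) f : measurable_fun setT f ->
  (\int[lebesgue_rV n]_x (f (x + t *: e_ j))%:E = \int[lebesgue_rV n]_x (f x)%:E)%E.
Proof.
move=> mf; pose fE : 'rV[R]_n -> \bar R := fun x => (f x)%:E.
have mfE : measurable_fun setT fE by exact/measurable_EFinP.
rewrite integralE [RHS]integralE; congr (_ - _)%E.
  have := @integral_rV_translate R n j t fE^\+%E (measurable_funepos mfE) (fun x => funepos_ge0
    fE x).
  by apply: etrans; apply: eq_integral => x _; rewrite !funeposE.
have := @integral_rV_translate R n j t fE^\-%E (measurable_funeneg mfE) (fun x => funeneg_ge0 fE x).
by apply: etrans; apply: eq_integral => x _; rewrite !funenegE.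
Qed.

(** Difference quotients have integral 0 by translation invariance. They are bounded by |L| and
    supported in a fixed box, so dominated convergence passes to the limit. *)
Lemma integral_partial_ae j f (L M C : R) : (forall x y, `|f x - f y| <= L * `|x - y|) ->
  (forall x, `|f x| <= C) ->
  (forall x, M <= `|x| -> f x = 0) ->
  (lebesgue_rV n).-integrable setT (fun x => (partial_ae j f x)%:E) /\
  (\int[lebesgue_rV n]_x (partial_ae j f x)%:E = 0)%E.
Proof.
move=> fL bdf f0.
have bf := lipschitz_bdd fL.
have cf := lipschitz_continuous_rV fL.
have mf := continuous_measurable_rV cf.
pose t k : R := k.+1%:R^-1.
have t0 k : 0 < t k by rewrite /t invr_gt0.
have t1 k : t k <= 1 by rewrite /t invf_le1// ler1n.
pose g k x := (t k)^-1 * (f (x + t k *: e_ j) - f x).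
have mfs k : measurable_fun setT (fun x => f (x + t k *: e_ j)).
  exact: (measurableT_comp mf (measurable_translate _)).
have mg k : measurable_fun setT (g k).
  by apply: measurable_funM => //; apply: measurable_funB.
(* A step of length at most 1 moves the support by at most 1, hence the box of size M + 1 for all k
   at once. *)
have gb k x : ~ box (M + 1) x -> f x = 0 /\ f (x + t k *: e_ j) = 0.
  move=> nb; have xM : M + 1 < `|x| by rewrite ltNge; apply: contra_notN nb; exact: mem_box.
  split; apply: f0; first by apply: ltW; apply: le_lt_trans xM; rewrite lerDl.
  have h : `|x| <= `|x + t k *: e_ j| + `|t k *: e_ j|
    by rewrite -{1}[x](addrK (t k *: e_ j)) (le_trans (ler_normB _ _)).
  have h2 : `|t k *: e_ j| <= 1.
    by rewrite normrZ gtr0_norm// (le_trans (ler_piMr _ (norm_delta_le1 j)))// ltW.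
  by move: h h2 xM; move: `|_| `|_| `|_| => a b c; lra.
have L0 x y : 0 <= L * `|x - y| by apply: le_trans (fL x y).
have gL k x : `|g k x| <= `|L|.
  rewrite /g normrM normfV (gtr0_norm (t0 k)) mulrC ler_pdivrMr//.
  apply: le_trans (fL _ _) _; rewrite addrAC subrr add0r normrZ (gtr0_norm (t0 k)).
  apply: (@le_trans _ _ (`|L| * (t k * `|e_ j|)));
    first by rewrite ler_wpM2r ?mulr_ge0 ?ler_norm// ltW.
  by rewrite ler_wpM2l// ler_piMr ?norm_delta_le1// ltW.
have if0 : (lebesgue_rV n).-integrable setT (EFin \o f).
  by apply: (@integrable_box f (M + 1) _ mf bdf) => x /(gb 0%N)[].
have ifs k : (lebesgue_rV n).-integrable setT (EFin \o (fun x => f (x + t k *: e_ j))).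
  by apply: (@integrable_box _ (M + 1) _ (mfs k) (fun x => bdf _)) => x /(gb k)[].
have ig k : (\int[lebesgue_rV n]_x (g k x)%:E = 0)%E.
  under eq_integral do rewrite /g EFinM EFinB.
  have iB := integrableB measurableT (ifs k) if0.
  rewrite (integralZl measurableT iB) (integralB measurableT (ifs k) if0).
  rewrite [X in (X - _)%E](integral_rV_translate_real j (t k) mf) subee ?mule0//.
  exact: integrable_fin_num if0.
have mp := measurable_partial_ae j cf.
have ib : (lebesgue_rV n).-integrable setT (EFin \o (fun x => `|L| * \1_(box (M + 1)) x)).
  apply: (@integrable_box _ (M + 1) `|L|).
  - by apply: measurable_funM => //; apply: measurable_indic; exact: measurable_box.
  - by move=> x; rewrite indicE; case: (_ \in _); rewrite ?mulr1 ?mulr0 ?normr_id ?normr0.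
  - by move=> x nb; rewrite indicE memNset// mulr0.
have [//|||||h1 _ h2] := @dominated_convergence _ _ R (lebesgue_rV n) setT measurableT (fun k x
  => (g k x)%:E)
  (fun x => (partial_ae j f x)%:E) (EFin \o (fun x => `|L| * \1_(box (M + 1)) x)).
- by move=> k; exact/measurable_EFinP.
- exact/measurable_EFinP.
- exists (~` partial_dom f j); split.
  + by apply: measurableC; exact: measurable_partial_dom.
  + exact: partial_dom_null.
  + move=> x /= nc dx; apply: nc => _; rewrite /partial_ae patchE mem_set//.
    apply: cvg_EFin; first by apply: nearW.
    apply: partial_dom_cvg => //; last exact: cvg_harmonic.
    by move=> k; rewrite gt_eqF.
- exact: ib.
- apply: aeW => x k _ /=; rewrite lee_fin indicE.
  case: (boolP (x \in _)) => [_|/negP nb]; first by rewrite mulr1.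
  have [|a b] := gb k x; first by move=> bx; apply: nb; rewrite inE.
  by rewrite /g a b subrr mulr0 normr0 mulr0.
split => //; move: h2; under eq_fun do rewrite ig.
by move=> /cvg_lim <- //; rewrite lim_cst.
Qed.

End box.

(** * Extension, products and bounds for Lipschitz functions *)

Section lipschitz_rV.
Context {R : realType} {n : nat}.
Implicit Types (f v : 'rV[R]_n -> R) (x y z : 'rV[R]_n) (K : set 'rV[R]_n).

Lemma lipschitz_inP f K : [lipschitz f x | x in K] <->
  exists L : R, forall x y, K x -> K y -> `|f x - f y| <= L * `|x - y|.
Proof.
split=> [[N [_ h]]|[L h]].
  exists (N + 1) => x y Kx Ky; have := h (N + 1); rewrite ltrDl => /(_ ltr01).
  by move=> /(_ (x, y)); apply.
exists L; split; first exact: num_real.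
by move=> N LN -[x y] [/= Kx Ky]; apply: le_trans (h _ _ Kx Ky) _; rewrite ler_wpM2r// ltW.
Qed.

(** Nothing is known of f outside K. A globally Lipschitz g that agrees with it there can be
    integrated by parts over the whole space, and on the open set K it has the same partial
    derivatives as f. *)
Lemma mcshane_extension f K (L : R) :
  (forall x y, K x -> K y -> `|f x - f y| <= L * `|x - y|) ->
  exists2 g : 'rV[R]_n -> R, (forall x, K x -> g x = f x) &
  exists M : R, forall x y, `|g x - g y| <= M * `|x - y|.
Proof.
move=> fL; have [[z0 Kz0]|K0] := pselect (exists z, K z); last first.
  exists (fun=> 0); first by move=> x Kx; case: K0; exists x.
  by exists 0 => x y; rewrite subrr normr0 mul0r.
pose M := `|L|.
have fM x y : K x -> K y -> `|f x - f y| <= M * `|x - y|.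
  by move=> Kx Ky; apply: le_trans (fL _ _ Kx Ky) _; rewrite ler_wpM2r// ler_norm.
pose E x := [set f z + M * `|x - z| | z in K].
have E0 x : E x !=set0 by exists (f z0 + M * `|x - z0|); exists z0.
have Elb x : has_lbound (E x).
  exists (f z0 - M * `|x - z0|) => _ [z Kz <-].
  have := fM z0 z Kz0 Kz; have : M * `|z0 - z| <= M * `|x - z| + M * `|x - z0|.
    rewrite -mulrDr ler_wpM2l ?normr_ge0// [leRHS]addrC [X in _ <= X + _]distrC.
    exact: ler_distD.
  by move=> h /ler_normlP [_]; move: h; move: (M * _) (M * _) (M * _) => a b c; lra.
exists (fun x => inf (E x)) => [x Kx|].
  apply/le_anti/andP; split.
    by apply: ge_inf => //; exists x => //; rewrite subrr normr0 mulr0 addr0.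
  apply: lb_le_inf => // _ [z Kz <-]; have := fM x z Kx Kz => /ler_normlP[_].
  by move: (M * _) => a; lra.
exists M => x y; wlog h : x y / inf (E y) <= inf (E x).
  by move=> W; case: (leP (inf (E y)) (inf (E x))) => [/W//|/ltW/W];
    rewrite distrC [`|x - y|]distrC.
rewrite ger0_norm ?subr_ge0// lerBlDl -lerBlDr.
apply: lb_le_inf => // _ [z Kz <-]; rewrite lerBlDr.
apply: le_trans (_ : f z + M * `|x - z| <= _); first by apply: ge_inf => //; exists z.
by rewrite -addrA lerD2l -mulrDr ler_wpM2l ?normr_ge0// [leRHS]addrC; exact: ler_distD.
Qed.

Lemma cont_bounded_ball f (M : R) : continuous f ->
  exists2 C : R, 0 <= C & forall x, `|x| <= M -> `|f x| <= C.
Proof.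
move=> cf; have [M0|M0] := ltP M 0.
  by exists 0 => // x xM; have := le_lt_trans (le_trans (normr_ge0 x) xM) M0; rewrite ltxx.
have [||x _ xmax] := @EVT_max_rV R n (fun x => `|f x|) [set z | `|z - 0| <= M] _
  (@cball_compact _ _ 0 M).
- by exists 0 => /=; rewrite subrr normr0.
- by apply: continuous_subspaceT; exact: cont_norm.
exists `|f x| => // y yM; apply: xmax; apply/mem_set => /=; by rewrite subr0.
Qed.

Lemma C1_lipschitz_of_bound v (P : set 'rV[R]_n) (B : R) : C1 v -> 0 <= B ->
  (forall x y (t : R), P x -> P y -> 0 <= t <= 1 -> P (x + t *: (y - x))) ->
  (forall x i, P x -> `|partial i v x| <= B) ->
  forall x y, P x -> P y -> `|v x - v y| <= n%:R * B * `|x - y|.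
Proof.
move=> Cv B0 cP bP x y Px Py; rewrite distrC.
have [t t01] := C1_MVT x (y - x) Cv; rewrite subrKC => ->.
apply: le_trans (dotrV_le _ _) _; rewrite [`|x - y|]distrC mulrAC -mulrA ler_wpM2l// mulrC.
rewrite mulrC ler_wpM2l//; apply: norm_le_coord => // i; rewrite mxE.
by apply: bP; exact: cP.
Qed.

Lemma C1_bdd_lipschitz v : C1 v -> bdd_lipschitz v.
Proof.
move=> Cv M.
have /choice[B BP] i : exists C : R, 0 <= C /\ forall x, `|x| <= M -> `|partial i v x| <= C.
  by have [C C0 CP] := cont_bounded_ball M (Cv i).2; exists C.
pose C := \sum_i B i; have C0 : 0 <= C by apply: sumr_ge0 => i _; exact: (BP i).1.
exists (n%:R * C); apply: (@C1_lipschitz_of_bound v [set x | `|x| <= M] C Cv C0).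
  move=> x y t /= xM yM /andP[t0 t1].
  have -> : x + t *: (y - x) = (1 - t) *: x + t *: y
    by rewrite scalerBr scalerBl scale1r -addrA [- _ + _]addrC.
  apply: le_trans (ler_normD _ _) _; rewrite !normrZ (ger0_norm t0) ger0_norm ?subr_ge0//.
  apply: (@le_trans _ _ ((1 - t) * M + t * M)); last by rewrite -mulrDl subrK mul1r.
  by apply: lerD; rewrite ler_wpM2l// subr_ge0.
move=> x i /= xM; apply: le_trans ((BP i).2 x xM) _.
by rewrite /C (bigD1 i)//= lerDl sumr_ge0// => j _; exact: (BP j).1.
Qed.

Lemma partial_near0 v i x : (\forall y \near x, v y = 0) -> partial i v x = 0.
Proof.
move=> v0; have N : \forall y \near x, (fun=> 0 : R) y = v y.
  by apply: nbhs_imp v0 => y ->.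
have D : partial_dom (fun=> 0 : R) i x by exact: derivable_cst.
by have [_ <-] := partial_dom_near N D; rewrite partialE derive_cst.
Qed.

Lemma near_norm_gt x (M : R) : M < `|x| -> \forall y \near x, M < `|y|.
Proof.
move=> xM; apply/nbhs_ballP; exists (`|x| - M); first by rewrite /= subr_gt0.
move=> y; rewrite -ball_normE /= => h.
have h2 : `|x| <= `|x - y| + `|y| by rewrite -{1}[x](subrK y) ler_normD.
by move: h h2; move: `|x| `|y| `|x - y| => a b c; lra.
Qed.

Lemma C1_support_lipschitz v (M : R) : C1 v -> (forall x, M < `|x| -> v x = 0) ->
  exists L C : R, (forall x, `|v x| <= C) /\ (forall x y, `|v x - v y| <= L * `|x - y|)
   /\ (forall x i, `|partial i v x| <= C) /\ (forall x i, M < `|x| -> partial i v x = 0).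
Proof.
move=> Cv v0.
have p0 x i : M < `|x| -> partial i v x = 0.
  move=> xM; apply: partial_near0; have := near_norm_gt xM.
  by apply: nbhs_imp => y; exact: v0.
have [C C0 CP] := cont_bounded_ball M (C1_continuous Cv).
have /choice[B BP] i : exists C : R, 0 <= C /\ forall x, `|x| <= M -> `|partial i v x| <= C.
  by have [C' C'0 C'P] := cont_bounded_ball M (Cv i).2; exists C'.
pose D := C + \sum_i B i.
have S0 : 0 <= \sum_i B i by apply: sumr_ge0 => i _; exact: (BP i).1.
have D0 : 0 <= D by rewrite addr_ge0.
have vD x : `|v x| <= D.
  case: (leP `|x| M) => xM; last by rewrite v0// normr0.
  by rewrite (le_trans (CP x xM))// lerDl.
have pD x i : `|partial i v x| <= D.
  case: (leP `|x| M) => xM; last by rewrite p0// normr0.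
  rewrite (le_trans ((BP i).2 x xM))// /D (bigD1 i)//= addrCA lerDl addr_ge0// sumr_ge0// => j _.
  exact: (BP j).1.
exists (n%:R * D), D; split => //; split; last by split.
by move=> x y; apply: (@C1_lipschitz_of_bound v setT D).
Qed.

(** Since f may be unbounded, the usual product estimate is centred at a point of the ball that
    supports v, where f is bounded; if neither point lies there, both products vanish. *)
Lemma lipschitz_mul_support f v (Lf Lv C M : R) :
  (forall x y, `|f x - f y| <= Lf * `|x - y|) ->
  (forall x y, `|v x - v y| <= Lv * `|x - y|) -> (forall x, `|v x| <= C) ->
  (forall x, M < `|x| -> v x = 0) ->
  exists L B : R, (forall x y, `|f x * v x - f y * v y| <= L * `|x - y|) /\ (forall x,
    `|f x * v x| <= B).
Proof.
move=> fL vL vC v0.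
have [B B0 BP] := cont_bounded_ball M (lipschitz_continuous_rV fL).
exists (B * `|Lv| + `|Lf| * C), (B * C); split; last first.
  move=> x; case: (leP `|x| M) => xM; last first.
    by rewrite v0// mulr0 normr0 mulr_ge0// (le_trans _ (vC x)).
  by rewrite normrM ler_pM// BP.
have C0 : 0 <= C by apply: le_trans (vC 0).
have fL' x y : `|f x - f y| <= `|Lf| * `|x - y| by apply: le_trans (fL x y) _;
  rewrite ler_wpM2r// ler_norm.
have vL' x y : `|v x - v y| <= `|Lv| * `|x - y| by apply: le_trans (vL x y) _;
  rewrite ler_wpM2r// ler_norm.
have main x y : `|x| <= M -> `|f x * v x - f y * v y| <= (B * `|Lv| + `|Lf| * C) * `|x - y|.
  move=> xM; rewrite (_ : _ - _ = f x * (v x - v y) + (f x - f y) * v y); last by ring.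
  apply: le_trans (ler_normD _ _) _; rewrite [leRHS]mulrDl !normrM; apply: lerD.
    by rewrite -mulrA ler_pM// BP.
  by rewrite mulrAC ler_pM// mulr_ge0.
move=> x y; case: (leP `|x| M) => xM; first exact: main.
case: (leP `|y| M) => yM; first by rewrite distrC [`|x - y|]distrC; exact: main.
by rewrite !v0// !mulr0 subrr normr0 mulr_ge0// addr_ge0// mulr_ge0.
Qed.

End lipschitz_rV.

(** * Integration by parts *)

Section transfer.
Context {R : realType} {n : nat}.
Variable psi : 'rV[R]_n -> R.
Hypothesis sm : smooth psi.
Hypothesis pdh : forall x, posdef (hess psi x).
Implicit Types (v : 'rV[R]_n -> R) (x y : 'rV[R]_n).
Local Notation e_ j := (delta_mx (ord0 : 'I_1) j : 'rV[R]_n).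
Local Notation T := (grad (legendre psi)).

Let K := range (grad psi).

Let TK y : T (grad psi y) = y. Proof. exact: grad_legendre. Qed.

(** The function v read in the coordinates of K. Extension by 0 makes it a function on the whole
    space, to be used for compactly supported v. *)
Definition transfer v : 'rV[R]_n -> R := (v \o T) \_ K.

Lemma transferE v y : transfer v (grad psi y) = v y.
Proof. by rewrite /transfer patchE mem_set /= ?TK//; exists y. Qed.

Lemma transfer_near y v : \forall x \near grad psi y, v (T x) = transfer v x.
Proof.
have := near_range_grad sm pdh y.
by apply: nbhs_imp => x [z _ <-]; rewrite transferE TK.
Qed.

Let dtransfer v j y := dotrV (e_ j *m invmx (hess psi y)) (grad v y).

Lemma is_derive_transfer v j y : C1 v ->
  is_derive (grad psi y) (e_ j) (transfer v) (dtransfer v j y).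
Proof.
move=> Cv; have d : is_derive (grad psi y) (e_ j) (v \o T) (dtransfer v j y).
  have H := C1_chain Cv (fun i => inv_grad_is_derive sm pdh TK y (e_ j) i).
  by rewrite TK in H.
have e0 : e_ j != 0.
  by apply/eqP => /(congr1 (fun v : 'rV[R]_n => v ord0 j)); rewrite !mxE !eqxx => /eqP;
    rewrite oner_eq0.
apply: (@near_eq_is_derive _ _ _ (v \o T)) d.
exact: transfer_near.
Qed.

Lemma partial_transfer v j y : C1 v -> partial j (transfer v) (grad psi y) =
  \sum_(a < n) invmx (hess psi y) j a * partial a v y.
Proof.
move=> Cv; rewrite partialE; case: (is_derive_transfer j y Cv) => _ ->.
rewrite /dtransfer /dotrV; apply: eq_bigr => a _; by rewrite -rowE !mxE.
Qed.

Section support.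
Variables (v : 'rV[R]_n -> R) (M : R).
Hypotheses (Cv : C1 v) (v0 : forall y, M < `|y| -> v y = 0).

Let C := grad psi @` [set y | `|y - 0| <= M].

Let compactC : compact C.
Proof. by apply: continuous_compact; [apply: continuous_subspaceT;
  exact: cont_grad|exact: cball_compact]. Qed.

Let closedC : closed C.
Proof. by apply: compact_closed => //; exact: norm_hausdorff. Qed.

Let transfer_out x : ~ C x -> transfer v x = 0.
Proof.
move=> nC; have [[y _ yx]|nK] := pselect (K x); last first.
  by rewrite /transfer patchE memNset.
rewrite -yx transferE v0// ltNge; apply/negP => yM; apply: nC; exists y => //=.
by rewrite subr0.
Qed.

Let near_out x : ~ C x -> \forall x' \near x, transfer v x' = 0.
Proof.
move=> nC; have oC : open (~` C) by rewrite openC.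
have := open_nbhs_nbhs (conj oC nC).
by apply: nbhs_imp => x'; exact: transfer_out.
Qed.

(** The image C of the ball under [grad psi] is a compact part of the open set K. On C the inverse
    map gives the derivatives; off C the function vanishes in a neighbourhood, so nothing happens at
    the boundary of K. *)
Let C1_transfer : C1 (transfer v).
Proof.
move=> j; split=> x.
  have [[y _ <-]|nC] := pselect (C x); first by case: (is_derive_transfer j y Cv).
  have N : \forall y \near x, (fun=> 0 : R) y = transfer v y.
    by have := near_out nC; apply: nbhs_imp => y ->.
  have D : partial_dom (fun=> 0 : R) j x by exact: derivable_cst.
  by have [] := partial_dom_near N D.
have [[y _ <-]|nC] := pselect (C x); last first.
  rewrite /continuous_at partial_near0; last exact: near_out.
  apply: cvg_dist => e e0; have oC : open (~` C) by rewrite openC.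
  have := open_nbhs_nbhs (conj oC nC).
  apply: nbhs_imp => x' nC'.
  by rewrite partial_near0 ?subrr ?normr0//; exact: near_out.
rewrite /continuous_at partial_transfer//.
pose g y := \sum_(a < n) invmx (hess psi y) j a * partial a v y.
have cg : continuous g.
  apply: cont_sum => a; apply: contM; last exact: (Cv a).2.
  exact: cont_invhess.
have cgT : g (T x) @[x --> grad psi y] --> g y.
  have := @cvg_comp_at _ _ _ T g (grad psi y); rewrite TK; apply; last exact: cg.
  exact: (inv_grad_cvg sm pdh TK).
apply: cvg_dist => e e0; have /cvgr_dist_lt/(_ _ e0) N1 := cgT.
have N2 := near_range_grad sm pdh y.
apply: (@filterS2 _ (nbhs (grad psi y)) (@nbhs_filter _ _)) N1 N2 => x' h [z _ zx].
by move: h; rewrite -zx partial_transfer// TK.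
Qed.

Lemma transfer_C1 : [/\ C1 (transfer v), forall x j, ~ K x -> partial j (transfer v) x = 0 &
  exists M' : R, forall x, M' < `|x| -> transfer v x = 0].
Proof.
split; first exact: C1_transfer.
  move=> x j nK; apply: partial_near0; apply: near_out => -[y _ yx]; apply: nK.
  by exists y.
have [B [_ BP]] := compact_bounded compactC; exists (B + 1) => x xB; apply: transfer_out => Cx.
by have := BP (B + 1); rewrite ltrDl => /(_ ltr01 x Cx) /=; rewrite leNgt xB.
Qed.

End support.

End transfer.

Section products.
Context {R : realType} {n : nat}.
Implicit Types (f v : 'rV[R]_n -> R) (x y : 'rV[R]_n).
Local Notation e_ j := (delta_mx (ord0 : 'I_1) j : 'rV[R]_n).

Lemma partial_mul f v j x : partial_dom f j x -> partial_dom v j x ->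
  partial_dom (fun y => f y * v y) j x /\
  partial j (fun y => f y * v y) x = partial j f x * v x + f x * partial j v x.
Proof.
move=> df dv; have := is_deriveME (DeriveDef df erefl) (DeriveDef dv erefl).
by rewrite -!partialE => -[d1 d2]; split => //; rewrite partialE.
Qed.

Lemma C1_partial_dom v j x : C1 v -> partial_dom v j x.
Proof. by move=> Cv; exact: (Cv j).1. Qed.

Lemma partial_aeE f j x : partial_dom f j x -> partial_ae j f x = partial j f x.
Proof. by move=> dx; rewrite /partial_ae patchE mem_set. Qed.

Lemma partial_ae_bound f j (L : R) x : (forall x y, `|f x - f y| <= L * `|x - y|) ->
  `|partial_ae j f x| <= `|L|.
Proof.
move=> fL; rewrite /partial_ae patchE; case: ifPn => [/set_mem dx|_]; last by rewrite normr0.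
have t0 (k : nat) : 0 < k.+1%:R^-1 :> R by rewrite invr_gt0.
have C := @partial_dom_cvg R n f j x (fun k => k.+1%:R^-1) dx (fun k => lt0r_neq0 (t0 k))
  (@cvg_harmonic R).
have cl : closed [set t : R | `|t| <= `|L|].
  rewrite (_ : [set _ | _] = (fun t : R => `|t|) @^-1` [set t | t <= `|L|])//.
  by apply: closed_comp; [move=> z _; exact: norm_continuous|exact: closed_le].
apply: (@closed_cvg _ _ _ _ _ (fun t : R => `|t| <= `|L|) cl _ _ C); apply: nearW => k /=.
rewrite invrK normrM ger0_norm ?ler0n// mulrC -ler_pdivlMr ?ltr0Sn//.
apply: le_trans (fL _ _) _; rewrite addrAC subrr add0r normrZ (gtr0_norm (t0 k)) mulrCA mulrC.
rewrite ler_wpM2r ?(ltW (t0 k))//.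
apply: (@le_trans _ _ (`|L| * `|e_ j|)); first by rewrite ler_wpM2r// ler_norm.
by rewrite ler_piMr// norm_delta_le1.
Qed.

End products.

(** * Transport of the measure [mu] to K and the weak divergence identity *)

Section moment_measure.
Context {R : realType} {n : nat}.
Variable psi : 'rV[R]_n -> R.
Hypothesis sm : smooth psi.
Hypothesis pdh : forall x, posdef (hess psi x).
Variable m : {measure set 'rV[R]_n -> \bar R}.
Hypothesis mE : (m : set 'rV[R]_n -> \bar R) = mu psi.
Implicit Types (u v f : 'rV[R]_n -> R) (x y : 'rV[R]_n).
Local Notation e_ j := (delta_mx (ord0 : 'I_1) j : 'rV[R]_n).
Local Notation T := (grad (legendre psi)).
Local Notation leb := (lebesgue_rV n).

Let K := range (grad psi).

Lemma measurable_range_grad : measurable K.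
Proof. by apply: open_measurable_rV; exact: open_range_grad. Qed.
Let mK := measurable_range_grad.

Lemma measurable_grad : measurable_fun setT (grad psi).
Proof. by apply: continuous_measurable_rVrV; exact: cont_grad. Qed.

Let w x := expR (-1) * rho psi x.
Let w0 x : 0 <= w x. Proof. by rewrite mulr_ge0 ?expR_ge0// ltW// rho_gt0. Qed.
Let mw : measurable_fun setT w.
Proof. by apply: measurable_funM => //; apply: continuous_measurable_rV; exact: cont_rho. Qed.

Lemma ge0_integral_moment (h : 'rV[R]_n -> \bar R) : measurable_fun setT h ->
  (forall x, (0 <= h x)%E) ->
  (\int[m]_y h (grad psi y) = (expR (-1))%:E * \int[leb]_(x in K) h x)%E.
Proof.
move=> mh h0.
have mhg : measurable_fun setT (h \o grad psi) by exact: (measurableT_comp mh measurable_grad).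
have nuE A : measurable A -> m A = (\int[leb]_(x in A) (w x)%:E)%E by rewrite mE.
transitivity (\int[m]_y (h \o grad psi) y)%E => //.
rewrite (ge0_integral_density mw w0 nuE mhg (fun x => h0 _)).
rewrite -(grad_substitution sm pdh mh h0) -ge0_integralZl//; first last.
- by move=> y _; rewrite mule_ge0// lee_fin ltW// rho_gt0.
- apply: emeasurable_funM => //; apply/measurable_EFinP.
  by apply: continuous_measurable_rV; exact: cont_rho.
by apply: eq_integral => y _; rewrite /w EFinM muleCA.
Qed.

Lemma integral_moment f : measurable_fun setT f -> leb.-integrable K (EFin \o f) ->
  m.-integrable setT (fun y => (f (grad psi y))%:E) /\
  (\int[m]_y (f (grad psi y))%:E = (expR (-1))%:E * \int[leb]_(x in K) (f x)%:E)%E.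
Proof.
move=> mf fi; pose fE : 'rV[R]_n -> \bar R := fun x => (f x)%:E.
have mfE : measurable_fun setT fE by exact/measurable_EFinP.
have mfg : measurable_fun setT (fE \o grad psi) by exact: (measurableT_comp mfE measurable_grad).
split.
  apply/integrableP; split => //.
  have := @ge0_integral_moment (fun x => `|fE x|%E) (measurableT_comp (@abse_measurable R setT)
    mfE) (fun x => abse_ge0 _).
  move=> ->; case/integrableP: fi => _ fi.
  by apply: lte_mul_pinfty => //; rewrite lee_fin expR_ge0.
rewrite integralE [in RHS]integralE.
have p1 : (\int[m]_y ((fun y => (f (grad psi y))%:E)^\+ y) =
  (expR (-1))%:E * \int[leb]_(x in K) (fE^\+ x))%E.
  rewrite -(ge0_integral_moment (measurable_funepos mfE) (fun x => funepos_ge0 fE x)).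
  by apply: eq_integral => y _; rewrite !funeposE.
have p2 : (\int[m]_y ((fun y => (f (grad psi y))%:E)^\- y) =
  (expR (-1))%:E * \int[leb]_(x in K) (fE^\- x))%E.
  rewrite -(ge0_integral_moment (measurable_funeneg mfE) (fun x => funeneg_ge0 fE x)).
  by apply: eq_integral => y _; rewrite !funenegE.
rewrite p1 p2 -muleBr//.
by apply: fin_num_adde_defl; rewrite fin_numN; exact: (integrable_neg_fin_num mK fi).
Qed.

Section divergence.
Variables (u chi g : 'rV[R]_n -> R) (Lg M : R).
Hypotheses (su : smooth u) (Cchi : C1 chi) (chi0 : forall y, M < `|y| -> chi y = 0).
Hypothesis gL : forall x y, `|g x - g y| <= Lg * `|x - y|.

Let A y := \sum_(j < n) partial_ae j g (grad psi y) * partial j u y.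

Let v j y := partial j u y * chi y.

Let Cv j : C1 (v j).
Proof.
have Cu := smooth_C1 (smooth_partial j su).
move=> i; have d x := is_deriveME (DeriveDef ((Cu i).1 x) erefl) (DeriveDef ((Cchi i).1 x) erefl).
split; first by move=> x; case: (d x).
have -> : partial i (v j) = fun x => partial i (partial j u) x * chi x +
  partial j u x * partial i chi x.
  by apply/funext => x; rewrite !partialE; case: (d x).
apply: contD; apply: contM.
- exact: (Cu i).2.
- exact: C1_continuous.
- exact: C1_continuous.
- exact: (Cchi i).2.
Qed.

Let v0 j y : M < `|y| -> v j y = 0.
Proof. by move=> yM; rewrite /v chi0// mulr0. Qed.

Let phi j := transfer psi (v j).

Let W1 j x := partial_ae j g x * phi j x.
Let W2 j x := g x * partial j (phi j) x.

Let bg : bdd_lipschitz g := lipschitz_bdd gL.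
Let cg : continuous g := lipschitz_continuous_rV gL.

(** The product of g and [phi j] is Lipschitz with compact support, so its j-th partial derivative
    integrates to 0, and the product rule splits it wherever g has a partial derivative. *)
Let slice j : [/\ leb.-integrable setT (EFin \o W1 j), leb.-integrable setT (EFin \o W2 j) &
  (\int[leb]_x (W1 j x + W2 j x)%:E = 0)%E].
Proof.
have [Cphi _ [M' phi0]] := transfer_C1 sm pdh (Cv j) (@v0 j).
have [L [C [phiC [phiL [dphiC dphi0]]]]] := C1_support_lipschitz Cphi phi0.
have [L' [B [gphiL gphiB]]] := lipschitz_mul_support gL phiL phiC phi0.
have C0 : 0 <= C by apply: le_trans (phiC 0).
have gphi0 x : `|M'| + 1 <= `|x| -> g x * phi j x = 0.
  move=> h; have xM : M' < `|x| by apply: lt_le_trans h; apply: (le_lt_trans (ler_norm M'));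
    rewrite ltrDl.
  by rewrite /phi phi0// mulr0.
have [ip i0] := integral_partial_ae j gphiL gphiB gphi0.
have nbox x : ~ box M' x -> M' < `|x|.
  by move=> nb; rewrite ltNge; apply: contra_notN nb; exact: mem_box.
have i1 : leb.-integrable setT (EFin \o W1 j).
  apply: (@integrable_box _ _ _ M' (`|Lg| * C)).
  - apply: measurable_funM; first exact: measurable_partial_ae.
    by apply: continuous_measurable_rV; exact: C1_continuous.
  - move=> x; rewrite /W1 normrM.
    exact: (ler_pM (normr_ge0 _) (normr_ge0 _) (partial_ae_bound j x gL) (phiC x)).
  - by move=> x /nbox xM; rewrite /W1 /phi phi0// mulr0.
have [B' B'0 gB'] := cont_bounded_ball M' cg.
have i2 : leb.-integrable setT (EFin \o W2 j).
  apply: (@integrable_box _ _ _ M' (B' * C)).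
  - by apply: measurable_funM; apply: continuous_measurable_rV => //; exact: (Cphi j).2.
  - move=> x; case: (leP `|x| M') => xM; first by rewrite normrM ler_pM// gB'.
    by rewrite /W2 dphi0// mulr0 normr0 mulr_ge0.
  - by move=> x /nbox xM; rewrite /W2 dphi0// mulr0.
split => //; rewrite -[RHS]i0; apply: ae_eq_integral => //.
- by case/integrableP: (integrableD measurableT i1 i2).
- by case/integrableP: ip.
exists (~` partial_dom g j); split.
- by apply: measurableC; exact: measurable_partial_dom.
- exact: partial_dom_null.
move=> x /= h dx; apply: h => _.
have [d1 d2] := partial_mul dx (@C1_partial_dom _ _ _ j x Cphi).
by rewrite /W1 /W2 (partial_aeE dx) (partial_aeE d1) d2.
Qed.

Let W x := \sum_(j < n) (W1 j x + W2 j x).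

Let integrable_sumW (F : 'I_n -> 'rV[R]_n -> R) : (forall j, leb.-integrable setT (EFin \o F j)) ->
  leb.-integrable setT (EFin \o (fun x => \sum_(j < n) F j x)).
Proof.
move=> iF; rewrite (_ : EFin \o _ = fun x => (\sum_(j < n) (EFin \o F j) x)%E); last first.
  by apply/funext => x; rewrite /= sumEFin.
exact: integrable_sum.
Qed.

Let measurable_of_integrable (f : 'rV[R]_n -> R) : leb.-integrable setT (EFin \o f) ->
  measurable_fun setT f.
Proof. by case/integrableP => /measurable_EFinP. Qed.

Let Lchi y := chi y * laplacian psi u y + gradprod psi u chi y.

Let W1E y : \sum_(j < n) W1 j (grad psi y) = chi y * A y.
Proof.
rewrite /A mulr_sumr; apply: eq_bigr => j _; rewrite /W1 /phi (transferE sm pdh) /v; ring.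
Qed.

Let W2E y : \sum_(j < n) W2 j (grad psi y) = g (grad psi y) * Lchi y.
Proof.
rewrite /W2 -mulr_sumr; congr (_ * _).
rewrite /Lchi /laplacian /gradprod mulr_sumr -big_split /=; apply: eq_bigr => j _.
rewrite /phi (partial_transfer sm pdh)// mulr_sumr -big_split /=; apply: eq_bigr => a _.
have Cu := smooth_C1 (smooth_partial j su).
have [_ ->] := partial_mul (@C1_partial_dom _ _ _ a y Cu) (@C1_partial_dom _ _ _ a y Cchi).
by rewrite mulrDr; congr (_ + _); ring.
Qed.

(* The divergence of the fields phi j is chi * laplacian u + <grad u, grad chi>
   in the y coordinates. *)
Lemma weak_divergence :
  [/\ m.-integrable setT (fun y => (chi y * A y)%:E),
      m.-integrable setT (fun y => (g (grad psi y) * Lchi y)%:E) &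
  (\int[m]_y (chi y * A y)%:E + \int[m]_y (g (grad psi y) * Lchi y)%:E = 0)%E].
Proof.
have iK (f : 'rV[R]_n -> R) : leb.-integrable setT (EFin \o f) -> leb.-integrable K (EFin \o f).
  by apply: integrableS.
have i1 := integrable_sumW (fun j => let: And3 a _ _ := slice j in a).
have i2 := integrable_sumW (fun j => let: And3 _ b _ := slice j in b).
have [j1 e1] := integral_moment (measurable_of_integrable i1) (iK _ i1).
have [j2 e2] := integral_moment (measurable_of_integrable i2) (iK _ i2).
have j1' : m.-integrable setT (fun y => (chi y * A y)%:E).
  by apply: eq_integrable j1 => // y _; rewrite W1E.
have j2' : m.-integrable setT (fun y => (g (grad psi y) * Lchi y)%:E).
  by apply: eq_integrable j2 => // y _; rewrite W2E.
have e1' : (\int[m]_y (chi y * A y)%:E = (expR (-1))%:E * \int[leb]_(x in K) (\sum_(j < n) W1 j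
  x)%:E)%E.
  by rewrite -e1; apply: eq_integral => y _; rewrite W1E.
have e2' : (\int[m]_y (g (grad psi y) * Lchi y)%:E = (expR (-1))%:E * \int[leb]_(x in K)
  (\sum_(j < n) W2 j x)%:E)%E.
  by rewrite -e2; apply: eq_integral => y _; rewrite W2E.
split; [exact: j1'|exact: j2'|].
clear j1 j2 e1 e2 j1' j2'; rewrite e1' e2' -muleDr//; last first.
  by apply: fin_num_adde_defr; apply: integrable_fin_num => //; exact: iK.
rewrite -integralD//; [|exact: iK|exact: iK].
rewrite (_ : (\int[leb]_(x in K) _)%E = 0%E) ?mule0//.
(* The fields [phi j] and their derivatives vanish off K, so the integral extends to the whole space
   without boundary terms. *)
rewrite (_ : (\int[leb]_(x in K) _)%E = \int[leb]_x (W x)%:E)%E; last first.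
  rewrite integral_mkcond; apply: eq_integral => x _; rewrite patchE; case: ifPn => [_|/negP nK].
    by rewrite -EFinD /W big_split.
  have {}nK : ~ K x by move=> h; apply: nK; rewrite inE.
  rewrite /W big1// => j _; rewrite /W1 /W2.
  have [Cphi dphi _] := transfer_C1 sm pdh (Cv j) (@v0 j).
  by rewrite /phi dphi// /transfer patchE memNset// !mulr0 addr0.
transitivity (\sum_(j < n) \int[leb]_x (W1 j x + W2 j x)%:E)%E.
  under eq_integral do rewrite /W -sumEFin.
  rewrite integral_sum// => j; have [a b _] := slice j.
  by have := integrableD measurableT a b; apply: eq_integrable => // x _; rewrite /= EFinD.
by rewrite big1// => j _; have [_ _ ->] := slice j.
Qed.

End divergence.

End moment_measure.

(** * Cutoff functions of class C^1 *)

Section cutoff.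
Context {R : realType} {n : nat}.
Implicit Types (x y : 'rV[R]_n).

(** The squared positive part is of class C^1, the regularity asked of a cutoff here. *)
Definition pos_sqr (s : R) : R := Num.max 0 s ^+ 2.

Lemma pos_sqr_taylor (s h : R) : `|pos_sqr (s + h) - pos_sqr s - 2 * Num.max 0 s * h| <= h ^+ 2.
Proof.
rewrite /pos_sqr /Num.max; case: (ltP 0 s); case: (ltP 0 (s + h)) => h1 h2.
- by rewrite ler_norml; apply/andP; split; nra.
- by rewrite ler_norml; apply/andP; split; nra.
- by rewrite ler_norml; apply/andP; split; nra.
- by rewrite ler_norml; apply/andP; split; nra.
Qed.

Lemma is_derive_pos_sqr (s : R) : is_derive s 1 pos_sqr (2 * Num.max 0 s).
Proof.
suff H : (fun h : R => h^-1 *: ((pos_sqr \o shift s) (h *: 1) - pos_sqr s)) @ 0^' --> 2 *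
  Num.max 0 s.
  by apply: DeriveDef; [apply/cvg_ex; exists (2 * Num.max 0 s)|exact: cvg_lim H].
apply/cvgrPdist_le => e e0; near=> h.
have h0 : h != 0 by near: h; exact: nbhs_dnbhs_neq.
have he : `|h| < e by near: h; exact: dnbhs0_lt.
have /= := pos_sqr_taylor s h.
rewrite [h *: 1]mulr1 [h + s]addrC [h^-1 *: _]/(h^-1 * _).
set a := pos_sqr _; set b := pos_sqr s; set c := 2 * _ => H.
rewrite (_ : c - h^-1 * (a - b) = - (h^-1 * (a - b - c * h))); last by field.
rewrite normrN normrM normfV mulrC ler_pdivrMr ?normr_gt0//.
apply: le_trans H _; rewrite -(ger0_norm (sqr_ge0 h)) normrX expr2 ler_wpM2r// ltW.
Unshelve. all: by end_near. Qed.

(** It is built on the squared Euclidean norm because the norm [|y|] is the sup norm, which is not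
    differentiable. *)
Definition cutoff (k : nat) y : R := pos_sqr (1 - k.+1%:R^-1 * dotrV y y).

Lemma sqr_norm_le_dotrV y : `|y| ^+ 2 <= dotrV y y.
Proof.
have d0 : 0 <= dotrV y y by apply: sumr_ge0 => i _; rewrite -expr2 sqr_ge0.
rewrite -[leRHS]sqr_sqrtr// ler_pXn2r ?nnegrE ?sqrtr_ge0//.
apply: norm_le_coord; first exact: sqrtr_ge0.
move=> i; rewrite -sqrtr_sqr ler_sqrt// /dotrV (bigD1 i)//= -expr2 lerDl.
by apply: sumr_ge0 => j _; rewrite -expr2 sqr_ge0.
Qed.

Lemma dotrV_ge0 y : 0 <= dotrV y y.
Proof. exact: le_trans (sqr_ge0 _) (sqr_norm_le_dotrV y). Qed.

Lemma cutoff_support k y : k.+1%:R < `|y| -> cutoff k y = 0.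
Proof.
move=> h; have k1 : 1 <= k.+1%:R :> R by rewrite ler1n.
(* The support has Euclidean radius sqrt (k+1), which is at most k+1; the cruder radius avoids the
   root. *)
have : k.+1%:R <= dotrV y y.
  apply: le_trans (sqr_norm_le_dotrV y); apply: le_trans (ltW h) _.
  by rewrite expr2 ler_peMl// ltW// (le_lt_trans k1).
move=> hd; rewrite /cutoff /pos_sqr max_l ?expr0n//.
by rewrite subr_le0 mulrC ler_pdivlMr ?mul1r// ltr0n.
Qed.

Lemma cutoff01 k y : 0 <= cutoff k y <= 1.
Proof.
rewrite /cutoff /pos_sqr sqr_ge0 /= expr_le1// ?le_max ?lexx//.
by rewrite ge_max ler01 lerBlDr lerDl mulr_ge0 ?dotrV_ge0.
Qed.

Lemma cutoff_C1 k : C1 (cutoff k).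
Proof.
pose c : R := k.+1%:R^-1.
have dd i y : is_derive y (delta_mx ord0 i) (fun y => dotrV y y) (y ord0 i + y ord0 i).
  rewrite (_ : y ord0 i + y ord0 i = \sum_j ((delta_mx ord0 i : 'rV[R]_n) ord0 j * y ord0 j +
    y ord0 j * (delta_mx ord0 i : 'rV[R]_n) ord0 j)).
    by apply: is_derive_sumE => j; apply: is_deriveME; exact: is_derive_coord.
  rewrite big_split /= -/(dotrV (delta_mx ord0 i) y) -/(dotrV y (delta_mx ord0 i)).
  by rewrite [dotrV y _]dotrVC !dotrV_delta.
have d i y : is_derive y (delta_mx ord0 i) (cutoff k) (2 * Num.max 0 (1 - c * dotrV y y) * (-
  (c * (y ord0 i + y ord0 i)))).
  apply: (@is_derive_compR _ _ (fun y => 1 - c * dotrV y y) pos_sqr); last exact: is_derive_pos_sqr.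
  rewrite -[X in is_derive _ _ _ X]add0r.
  exact: (is_deriveBE (is_derive_cst (1 : R) y _) (is_deriveCE c (dd i y))).
move=> i; split; first by move=> y; case: (d i y).
have -> : partial i (cutoff k) = fun y => 2 * Num.max 0 (1 - c * dotrV y y) * (- (c * (y ord0 i
  + y ord0 i))).
  by apply/funext => y; rewrite partialE; case: (d i y).
have cdot : continuous (fun y => dotrV y y).
  by apply: cont_sum => j; apply: contM; exact: cont_coord.
apply: contM.
  apply: contM; first exact: cont_cst.
  apply: (@cont_comp _ _ _ (fun y => 1 - c * dotrV y y) (fun s => Num.max 0 s)).
    by apply: contB; [exact: cont_cst|apply: contM; [exact: cont_cst|exact: cdot]].
  by move=> s; apply: continuous_max; [exact: cvg_cst|exact: cvg_id].
apply: contN; apply: contM; first exact: cont_cst.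
by apply: contD; exact: cont_coord.
Qed.

Lemma cutoff_cvg y : cutoff k y @[k --> \oo] --> (1 : R).
Proof.
have cp : continuous pos_sqr.
  by move=> s; apply: differentiable_continuous; apply/derivable1_diffP;
    case: (is_derive_pos_sqr s).
have E : pos_sqr 1 = 1 by rewrite /pos_sqr max_r ?expr1n// ler01.
have : (fun k => 1 - k.+1%:R^-1 * dotrV y y) @ \oo --> (1 - 0 * dotrV y y : R).
  apply: cvgB; first exact: cvg_cst.
  by apply: cvgMl; exact: cvg_harmonic.
rewrite mul0r subr0 => H; have := cvg_comp _ _ H (cp 1); rewrite E; exact.
Qed.

End cutoff.

Section has_integral.
Context d (T : measurableType d) (R : realType) (m : {measure set T -> \bar R}).
Implicit Types (f g : T -> R) (a b : R).

(** Integrability bundled with a real value, so that linear relations between integrals become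
    identities in R. *)
Definition has_integral f a := m.-integrable setT (EFin \o f) /\ (\int[m]_x (f x)%:E = a%:E)%E.

Lemma integrable_has_integral f : m.-integrable setT (EFin \o f) -> exists a, has_integral f a.
Proof.
move=> fi; exists (fine (\int[m]_x (f x)%:E)); split => //.
by rewrite fineK//; exact: (integrable_fin_num measurableT fi).
Qed.

Lemma eq_has_integral f g a : f =1 g -> has_integral f a -> has_integral g a.
Proof. by move=> /funext ->. Qed.

Lemma has_integralD f g a b : has_integral f a -> has_integral g b ->
  has_integral (fun x => f x + g x) (a + b).
Proof.
move=> [fi fa] [gi gb]; have i := integrableD measurableT fi gi; split.
  by apply: eq_integrable i.
by rewrite EFinD -fa -gb -integralD.
Qed.

Lemma has_integralZ f a c : has_integral f a -> has_integral (fun x => c * f x) (c * a).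
Proof.
move=> [fi fa]; have i := integrableZl measurableT c fi; split.
  by apply: eq_integrable i.
by rewrite EFinM -fa -integralZl.
Qed.

Lemma has_integralB f g a b : has_integral f a -> has_integral g b ->
  has_integral (fun x => f x - g x) (a - b).
Proof.
move=> fa gb; have := has_integralD fa (has_integralZ (-1) gb); rewrite mulN1r.
by apply: eq_has_integral => x; rewrite mulN1r.
Qed.

Lemma ae_eq_has_integral f g a : measurable_fun setT g -> {ae m, forall x, f x = g x} ->
  has_integral f a -> has_integral g a.
Proof.
move=> mg fg [fi fa].
have mgE : measurable_fun setT (fun x => (g x)%:E : \bar R) by exact/measurable_EFinP.
have fgE : ae_eq m setT (EFin \o f) (EFin \o g) by apply: filterS fg => x + _ /= => ->.
split.
  apply/integrableP; split => //; case/integrableP: (fi) => mf foo.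
  rewrite (le_lt_trans _ foo)// le_eqVlt; apply/orP; left; apply/eqP.
  apply: ae_eq_integral => //; [exact: measurableT_comp|exact: measurableT_comp|].
  by apply: filterS fgE => x h Tx; exact: (congr1 abse (esym (h Tx))).
rewrite -fa; apply: ae_eq_integral => //; first by case/integrableP: fi.
by apply: filterS fgE => x h Tx; exact: (esym (h Tx)).
Qed.

Lemma has_integral_bounded_mul f g a (C : R) : measurable_fun setT f -> (forall x, `|f x| <= C) ->
  has_integral g a -> exists b, has_integral (fun x => f x * g x) b.
Proof.
move=> mf fC [gi _]; apply: integrable_has_integral.
have bf : [bounded f x | x in setT].
  by exists C; split; [exact: num_real|move=> r Cr x _; exact: le_trans (fC x) (ltW Cr)].
by apply: eq_integrable (integrableMr measurableT mf bf gi).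
Qed.

End has_integral.

(** * Comparison of A with <grad u, grad F> under a cutoff *)

Section pairing.
Context {R : realType} {n : nat}.
Variable psi : 'rV[R]_n -> R.
Hypothesis sm : smooth psi.
Hypothesis pdh : forall x, posdef (hess psi x).
Variable m : {measure set 'rV[R]_n -> \bar R}.
Hypothesis mE : (m : set 'rV[R]_n -> \bar R) = mu psi.
Variables (u g : 'rV[R]_n -> R) (Lg : R).
Hypothesis su : smooth u.
Hypothesis gL : forall x y, `|g x - g y| <= Lg * `|x - y|.
Implicit Types (x y : 'rV[R]_n) (h : 'rV[R]_n -> R).
Local Notation e_ j := (delta_mx (ord0 : 'I_1) j : 'rV[R]_n).

Let F y := g (grad psi y).

Let bdd_grad M : exists2 C : R, 0 <= C & forall x y, `|x| <= M -> `|y| <= M ->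
  `|grad psi x - grad psi y| <= C * `|x - y|.
Proof.
have /choice[B BP] i : exists C : R, 0 <= C /\ forall x y, `|x| <= M -> `|y| <= M ->
    `|partial i psi x - partial i psi y| <= C * `|x - y|.
  have [C CP] := C1_bdd_lipschitz (smooth_C1 (smooth_partial i sm)) M; exists `|C|;
    split => // x y xM yM.
  by apply: le_trans (CP x y xM yM) _; rewrite ler_wpM2r// ler_norm.
exists (\sum_i B i); first by apply: sumr_ge0 => i _; exact: (BP i).1.
move=> x y xM yM; apply: norm_le_coord.
  by rewrite mulr_ge0// sumr_ge0// => i _; exact: (BP i).1.
move=> i; have -> : (grad psi x - grad psi y) ord0 i = partial i psi x - partial i psi y
  by rewrite !mxE.
apply: le_trans ((BP i).2 x y xM yM) _; rewrite ler_wpM2r// (bigD1 i)//= lerDl sumr_ge0// => j _.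
exact: (BP j).1.
Qed.

Let bF : bdd_lipschitz F.
Proof.
move=> M; have [C C0 CP] := bdd_grad M; exists (`|Lg| * C) => x y xM yM.
apply: le_trans (gL _ _) _; apply: (@le_trans _ _ (`|Lg| * `|grad psi x - grad psi y|)).
  by rewrite ler_wpM2r// ler_norm.
by rewrite -mulrA ler_wpM2l// CP.
Qed.

Lemma cont_pullback : continuous F.
Proof. exact: bdd_lipschitz_continuous bF. Qed.

Let m_null A : measurable A -> lebesgue_rV n A = 0%E -> m A = 0%E.
Proof.
move=> mA A0; rewrite mE /mu; apply: null_set_integral => //.
apply: measurable_funTS; apply/measurable_EFinP; apply: measurable_funM => //.
by apply: continuous_measurable_rV; exact: cont_rho.
Qed.

Let F_ae : {ae m, forall y, forall j, partial_dom F j y}.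
Proof.
apply: filter_forall => j; exists (~` partial_dom F j).
have mD : measurable (~` partial_dom F j).
  by apply: measurableC; apply: measurable_partial_dom; exact: cont_pullback.
by split => //; apply: m_null => //; exact: partial_dom_null.
Qed.

Variables (chi : 'rV[R]_n -> R) (M : R).
Hypothesis Cchi : C1 chi.
Hypothesis chi0 : forall y, M < `|y| -> chi y = 0.
Hypothesis ibp_F : Defs.integration_by_parts psi u F.
Hypothesis ibp_Fchi : Defs.integration_by_parts psi u (fun y => F y * chi y).

Let A y := \sum_(j < n) partial_ae j g (grad psi y) * partial j u y.

(** By [weak_divergence] the integral of chi A is minus that of F (chi L u + <grad u, grad chi>).
    The hypothesis on F chi trades the integral of F chi L u for minus that of <grad u, grad (F
    chi)>, and the product rule, valid almost everywhere, leaves chi <grad u, grad F>. *)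
Lemma pairing_cutoff : exists a, has_integral m (fun y => chi y * A y) a /\
  has_integral m (fun y => chi y * gradprod psi u F y) a.
Proof.
have [w1 w2 w0] := weak_divergence sm pdh mE su Cchi chi0 gL.
have [a ha] := integrable_has_integral w1; have [b hb] := integrable_has_integral w2.
have ab : a + b = 0 by move: w0; rewrite ha.2 hb.2 -EFinD => -[].
have [i1 i2 i3] := ibp_Fchi; rewrite -mE in i1 i2 i3.
have [c hc] := integrable_has_integral i1; have [d hd] := integrable_has_integral i2.
have cd : c = - d by move: i3; rewrite hc.2 hd.2 -EFinN => -[].
have he : has_integral m (fun y => F y * gradprod psi u chi y) (b - c).
  by apply: eq_has_integral (has_integralB hb hc) => y; rewrite /F; ring.
exists a; split => //.
have -> : a = d - (b - c) by rewrite -(addrK b a) ab cd; ring.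
have mchi : measurable_fun setT chi by apply: continuous_measurable_rV; exact: C1_continuous.
(* This supplies the measurability of [gradprod psi u F], in which the derivatives of F take default
   values on a null set. *)
have [_ iF _] := ibp_F; rewrite -mE in iF.
apply: (@ae_eq_has_integral _ _ _ _ (fun y => gradprod psi u (fun y => F y * chi y) y - F y *
  gradprod psi u chi y)).
- apply: measurable_funM => //; case/integrableP: iF => /measurable_EFinP mG _; exact: mG.
- apply: filterS F_ae => y Fy; rewrite /gradprod !mulr_sumr -sumrB; apply: eq_bigr => i _.
  rewrite !mulr_sumr -sumrB; apply: eq_bigr => j _.
  have [_ ->] := partial_mul (Fy j) (@C1_partial_dom _ _ _ j y Cchi); ring.
- exact: has_integralB.
Qed.

End pairing.

(** * The lower bound for the integral of Q *)

Section lower_bound.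
Context {R : realType} {n : nat}.
Variable psi : 'rV[R]_n -> R.
Hypothesis sm : smooth psi.
Hypothesis pdh : forall x, posdef (hess psi x).
Hypothesis lc : log_concave (rho psi).
Variable m : {measure set 'rV[R]_n -> \bar R}.
Hypothesis mE : (m : set 'rV[R]_n -> \bar R) = mu psi.
Implicit Types (x y : 'rV[R]_n) (u h v f : 'rV[R]_n -> R).
Local Notation e_ j := (delta_mx (ord0 : 'I_1) j : 'rV[R]_n).
Local Notation leb := (lebesgue_rV n).

Let K := range (grad psi).

Lemma cont_laplacian u : smooth u -> continuous (laplacian psi u).
Proof.
move=> su; apply: cont_sum => i; apply: cont_sum => j; apply: contM; first exact: cont_invhess.
by apply: C1_continuous; apply: smooth_C1; do 2 apply: smooth_partial.
Qed.

Lemma cont_gradprod u h : smooth u -> smooth h -> continuous (gradprod psi u h).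
Proof.
move=> su sh; apply: cont_sum => i; apply: cont_sum => j; apply: contM; first apply: contM.
- exact: cont_invhess.
- by apply: C1_continuous; apply: smooth_C1; apply: smooth_partial.
- by apply: C1_continuous; apply: smooth_C1; apply: smooth_partial.
Qed.

Lemma measurable_transfer v : continuous v -> measurable_fun setT (transfer psi v).
Proof.
move=> cv; apply/(measurable_restrictT _ (measurable_range_grad sm pdh)).
apply: cont_measurable_rV; first exact: open_range_grad.
move=> _ [y _ <-]; have TK := grad_legendre sm pdh.
apply: (@cvg_comp_at _ _ _ (grad (legendre psi)) v); rewrite TK; last exact: cv.
exact: (inv_grad_cvg sm pdh TK).
Qed.

Variables (u f g : 'rV[R]_n -> R) (Lg : R).
Hypothesis su : smooth u.
Hypothesis sG : smooth (gradprod psi u u).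
Hypothesis sL : smooth (laplacian psi u).
Hypothesis gL : forall x y, `|g x - g y| <= Lg * `|x - y|.
Hypothesis gf : forall x, K x -> g x = f x.

Let A y := \sum_(j < n) partial_ae j g (grad psi y) * partial j u y.
Let P y := - 2 * A y - gamma2 psi u y.

Let cgamma2 : continuous (gamma2 psi u).
Proof.
apply: contB; last exact: cont_gradprod.
by apply: contM; [exact: cont_cst|exact: cont_laplacian].
Qed.

Let bg : bdd_lipschitz g := lipschitz_bdd gL.
Let cg : continuous g := lipschitz_continuous_rV gL.

Let Pt x := - 2 * (\sum_(j < n) partial_ae j g x * transfer psi (partial j u) x) - transfer psi
  (gamma2 psi u) x.

Let PtE y : Pt (grad psi y) = P y.
Proof.
rewrite /Pt /P transferE//; congr (_ * _ - _).
by apply: eq_bigr => j _; rewrite transferE.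
Qed.

(** Since Q is nonnegative, the positive part of the lower bound is still below it, and its integral
    makes sense without integrability of A. *)
Let h x : \bar R := (Num.max 0 (Pt x))%:E.

Let mh : measurable_fun setT h.
Proof.
apply/measurable_EFinP; apply: measurable_maxr => //; apply: measurable_funB;
  last exact: measurable_transfer.
apply: measurable_funM => //; apply: measurable_sum => j; apply: measurable_funM.
  exact: measurable_partial_ae.
by apply: measurable_transfer; apply: C1_continuous; apply: smooth_C1; exact: smooth_partial.
Qed.

Let h0 x : (0 <= h x)%E. Proof. by rewrite lee_fin le_max lexx. Qed.

Let E := \bigcap_(j in [set: 'I_n]) partial_dom g j.

Let mEs : measurable E.
Proof. by apply: fin_bigcap_measurable => // j _; exact: measurable_partial_dom. Qed.

Let partial_f j x : K x -> partial_dom g j x -> partial j f x = partial_ae j g x.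
Proof.
move=> Kx dx; rewrite partial_aeE//.
have N : \forall y \near x, g y = f y.
  have := open_nbhs_nbhs (conj (open_range_grad sm pdh) Kx).
  by apply: nbhs_imp => y; exact: gf.
by have [_ <-] := partial_dom_near N dx.
Qed.

(** The comparison with the possibly nonmeasurable Q must hold at every point. So h is set to 0 off
    E, where g lacks a partial derivative: this leaves its integral unchanged, and there [Q_ge0]
    suffices. *)
Lemma integral_Q_ge :
  (\int[m]_y (Num.max 0 (P y))%:E <= (expR (-1))%:E * \int[leb]_(x in K) Q psi x (grad f x))%E.
Proof.
have -> : (\int[m]_y (Num.max 0 (P y))%:E = \int[m]_y h (grad psi y))%E.
  by apply: eq_integral => y _; rewrite /h PtE.
rewrite (ge0_integral_moment sm pdh mE mh h0) lee_wpmul2l ?lee_fin ?expR_ge0//.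
have mK := measurable_range_grad sm pdh.
have -> : (\int[leb]_(x in K) h x = \int[leb]_(x in K) (h \_ E) x)%E.
  apply: ae_eq_integral => //.
  - exact: measurable_funTS.
  - apply: measurable_funTS; apply/(measurable_restrictT _ mEs); exact: measurable_funTS.
  have := partial_dom_ae bg.
  by apply: filterS => x Ex _; rewrite patchE mem_set// => j _; exact: Ex.
apply: ge0_le_integral_nonmeas => x Kx; first by rewrite patchE; case: ifP.
rewrite patchE; case: ifPn => [/set_mem Ex|_]; last exact: Q_ge0.
case: Kx Ex => y _ <- Ex; rewrite /h PtE /Num.max; case: ltP => _; last exact: Q_ge0.
have := Q_ge sm (rho_gt0 sm pdh) y (grad f (grad psi y)) pdh lc su.
rewrite (_ : dotrV _ _ = A y)//; apply: eq_bigr => j _.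
by rewrite !mxE partial_f//; [exists y|exact: Ex].
Qed.

Variable p : R.
Let G := gradprod psi u (fun y => g (grad psi y)).
Hypothesis iP : has_integral m (fun y => - 2 * G y - gamma2 psi u y) p.
Hypothesis iGam : m.-integrable setT (EFin \o gamma2 psi u).
Hypothesis ibp_F : Defs.integration_by_parts psi u (fun y => g (grad psi y)).
Hypothesis ibp_Fchi : forall k,
  Defs.integration_by_parts psi u (fun y => g (grad psi y) * cutoff k y).

Let mchi k : measurable_fun setT (@cutoff R n k).
Proof. by apply: continuous_measurable_rV; apply: C1_continuous; exact: cutoff_C1. Qed.

Let chi1 k y : `|@cutoff R n k y| <= 1.
Proof. by have /andP[c0 c1] := cutoff01 k y; rewrite ger0_norm. Qed.

(** Under the cutoff, G may be replaced by A through [pairing_cutoff]; then a product of P with a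
    number in [0, 1] is at most the positive part of P. *)
Let cutoff_le k : (\int[m]_y (cutoff k y * (- 2 * G y - gamma2 psi u y))%:E <= \int[m]_y
  (Num.max 0 (P y))%:E)%E.
Proof.
have [a [ha hG]] := pairing_cutoff sm pdh mE su gL (cutoff_C1 k) (@cutoff_support R n k) ibp_F
  (ibp_Fchi k).
have [q hq] := integrable_has_integral iGam.
have [qk hqk] := has_integral_bounded_mul (mchi k) (chi1 k) hq.
have h1 : has_integral m (fun y => cutoff k y * (- 2 * G y - gamma2 psi u y)) (- 2 * a - qk).
  apply: eq_has_integral (has_integralB (has_integralZ (-2) hG) hqk) => y; rewrite /G; ring.
have h2 : has_integral m (fun y => cutoff k y * P y) (- 2 * a - qk).
  by apply: eq_has_integral (has_integralB (has_integralZ (-2) ha) hqk) => y; rewrite /P /A; ring.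
rewrite h1.2 -h2.2; case: h2 => i2 _.
pose q' y : R := cutoff k y * P y.
have E1 : (\int[m]_y (q' y)%:E <= \int[m]_y ((EFin \o q')^\+ y))%E.
  rewrite [leLHS](integralE _ _ (EFin \o q')) leeBlDr ?leeDl//.
    exact: integral_ge0.
  exact: (integrable_neg_fin_num measurableT i2).
apply: le_trans E1 _; apply: ge0_le_integral_nonmeas => [y _|y _]; first exact: funepos_ge0.
rewrite funeposE /= -EFin_max lee_fin ge_max !le_max lexx /= andbT.
have /andP[c0 c1] := cutoff01 k y; case: (leP (P y) 0) => P0.
  by rewrite mulr_ge0_le0.
by rewrite ler_piMl ?orbT// ltW.
Qed.

(** The bound of [cutoff_le] is uniform in k, and the left side converges by dominated convergence
    because G and [gamma2], unlike A, enter through an integrable combination. *)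
Lemma energy_bound : (p%:E <= (expR (-1))%:E * \int[leb]_(x in K) Q psi x (grad f x))%E.
Proof.
apply: le_trans integral_Q_ge; have [i iE] := iP.
pose q y := - 2 * G y - gamma2 psi u y.
have mq : measurable_fun setT q by case/integrableP: i => /measurable_EFinP.
have [||||| _ _ C] := @dominated_convergence _ _ R m setT measurableT (fun k y => (cutoff k y *
  q y)%:E)
  (fun y => (q y)%:E) (fun y => `|(q y)%:E|%E).
- by move=> k; apply/measurable_EFinP; apply: measurable_funM.
- exact/measurable_EFinP.
- apply: aeW => y _; apply: cvg_EFin; first exact: nearW.
  by rewrite -[X in _ --> X]mul1r; apply: cvgMl; exact: cutoff_cvg.
- exact: integrable_abse.
- by apply: aeW => y k _; rewrite lee_fin normrM ler_piMl.
have cvgC : cvg ((fun k => \int[m]_y (cutoff k y * q y)%:E)%E @ \oo) by apply/cvg_ex; eexists;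
  exact: C.
have N : \forall k \near \oo, (\int[m]_y (cutoff k y * q y)%:E <= \int[m]_y (Num.max 0 (P y))%:E)%E.
  by apply: nearW => k; exact: cutoff_le.
have : (limn (fun k => \int[m]_y (cutoff k y * q y)%:E) <= \int[m]_y (Num.max 0 (P y))%:E)%E
  by apply: lime_le.
by rewrite (cvg_lim (@ereal_hausdorff R) C) iE.
Qed.

End lower_bound.

(** * Integrability on a bounded domain and the final inequality *)

Section bounded_domain.
Context {R : realType} {n : nat}.
Implicit Types (K : set 'rV[R]_n) (psi f u : 'rV[R]_n -> R).

Lemma bounded_set_box K : bounded_set K -> exists M : R, forall x, K x -> `|x| <= M.
Proof. by move=> [M [_ h]]; exists (M + 1); apply: h; rewrite ltrDl. Qed.

Lemma integrable_bounded_set K f : measurable K -> bounded_set K -> continuous f ->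
  (lebesgue_rV n).-integrable K (EFin \o f).
Proof.
move=> mK bK cf; have [M KM] := bounded_set_box bK.
apply: measurable_bounded_integrable => //.
- apply: le_lt_trans (@lebesgue_box_lty R n M); apply: le_measure; rewrite ?inE//.
    exact: measurable_box.
  by move=> x Kx; apply: mem_box; exact: KM.
- by apply: measurable_funTS; exact: continuous_measurable_rV.
- have [C C0 CP] := cont_bounded_ball M cf.
  by exists C; split; [exact: num_real|move=> r Cr x Kx; exact: le_trans (CP x (KM x Kx)) (ltW Cr)].
Qed.

(** This is what admits F times a cutoff as a test function in the regularity hypothesis: read on K
    it is the product of g with a compactly supported C^1 function. *)
Lemma transfer_lipschitz psi (g v : 'rV[R]_n -> R) (Lg M : R) : smooth psi ->
  (forall x, posdef (hess psi x)) ->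
  (forall x y, `|g x - g y| <= Lg * `|x - y|) -> C1 v -> (forall y, M < `|y| -> v y = 0) ->
  [lipschitz (fun y => g (grad psi y) * v y) (grad (legendre psi) x) | x in range (grad psi)].
Proof.
move=> sm pdh gL Cv v0; have [CT _ [M' T0]] := transfer_C1 sm pdh Cv v0.
have [L [C [TC [TL _]]]] := C1_support_lipschitz CT T0.
have [L' [_ [H _]]] := lipschitz_mul_support gL TL TC T0.
apply/lipschitz_inP; exists L' => _ _ [x _ <-] [y _ <-].
by have := H (grad psi x) (grad psi y); rewrite !transferE// !grad_legendre.
Qed.

End bounded_domain.

Theorem theorem1p4 (R : realType) (n : nat)
  (K : set 'rV[R]_n) (psi : 'rV[R]_n -> R)
  (hK : convex_body K)
  (psi_smooth : smooth psi)
  (psi_convex : @convex_function R 'rV[R]_n setT psi)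
  (psi_transport : logconcave_transport psi K)
  (psi_regular : regular_at_infinity psi K)
  (f : 'rV[R]_n -> R)
  (f_lip : [lipschitz f x | x in K]) :
  (\int[lebesgue_rV n]_(x in K) (f x)%:E = 0)%E ->
  (\int[lebesgue_rV n]_(x in K) (f x ^+ 2)%:E
     <= \int[lebesgue_rV n]_(x in K) Q psi x (grad f x))%E.
Proof.
move=> f0; case: hK => bK _ _; case: psi_transport => rho0 lc KE.
have pdh := convex_hess_posdef psi_smooth psi_convex rho0.
have sm := psi_smooth.
have KE' : K = range (grad psi) by rewrite -KE.
have mK : measurable K by rewrite KE'; exact: measurable_range_grad.
have [L0 fL] : exists L, forall x y, K x -> K y ->
  `|f x - f y| <= L * `|x - y| by apply/lipschitz_inP.
have [g gf [Lg gL]] := mcshane_extension fL.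
have cg := lipschitz_continuous_rV gL.
have mw : measurable_fun setT (fun x => expR (-1) * rho psi x).
  by apply: measurable_funM => //; apply: continuous_measurable_rV; exact: cont_rho.
have w0 x : 0 <= expR (-1) * rho psi x by rewrite mulr_ge0 ?expR_ge0// ltW.
have [m mE'] := @density_measure _ _ R (lebesgue_rV n) _ mw w0.
have mE : (m : set 'rV[R]_n -> \bar R) = mu psi by rewrite mE'.
have [X [[Xs _] [ibpX ibpL] [Xc Xop] [_ dense]]] := psi_regular.
pose F y := g (grad psi y); pose e1 : R := expR (-1).
have e10 : 0 < e1 := expR_gt0 _.
have cF : continuous F by exact: (cont_pullback sm gL).
have cg2 : continuous (fun x => g x ^+ 2).
  by rewrite (_ : (fun x => g x ^+ 2) = fun x => g x * g x)//; exact: contM.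
have igK : (lebesgue_rV n).-integrable (range (grad psi)) (EFin \o g).
  by rewrite -KE'; exact: integrable_bounded_set.
have ig2K : (lebesgue_rV n).-integrable (range (grad psi)) (EFin \o (fun x => g x ^+ 2)).
  by rewrite -KE'; exact: integrable_bounded_set.
have [iF intF] := integral_moment sm pdh mE (continuous_measurable_rV cg) igK.
have [iF2 intF2] := integral_moment sm pdh mE (continuous_measurable_rV cg2) ig2K.
have Kfg (h : R -> R) : (\int[lebesgue_rV n]_(x in K) (h (f x))%:E = \int[lebesgue_rV n]_(x in
  K) (h (g x))%:E)%E.
  by apply: eq_integral => x /set_mem Kx; rewrite gf.
have [c hc] := integrable_has_integral iF2.
have HF : L2_mean0 psi F.
  split; first exact: continuous_measurable_rV.
    by rewrite -mE; case: hc => _ ->; exact: ltry.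
  by rewrite -mE intF -KE' -(Kfg id) f0 mule0.
(* The constant c is the integral of F^2 against the measure m, whose normalization contributes the
   factor [e1]. *)
have f2E : (\int[lebesgue_rV n]_(x in K) (f x ^+ 2)%:E)%E = (e1^-1 * c)%:E.
  rewrite (Kfg (fun t => t ^+ 2)) KE'; case: hc => _; rewrite intF2 -/e1.
  have := integrable_fin_num (measurable_range_grad sm pdh) ig2K.
  move=> /fineK <- => -[<-]; congr (_%:E).
  by rewrite mulKf// gt_eqF.
have main (e : R) : 0 < e ->
    ((c - e ^+ 2)%:E <= e1%:E * \int[lebesgue_rV n]_(x in K) Q psi x (grad f x))%E.
  move=> e0; have [u Xu ue] := dense F HF e e0.
  rewrite -mE in ue.
  have su := Xs u Xu; have [XL XG] := Xop u Xu.
  have lipF : [lipschitz F (grad (legendre psi) x) | x in K].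
    apply/lipschitz_inP; exists Lg => x y; rewrite KE' => -[a _ <-] [b _ <-].
    by rewrite /F !grad_legendre.
  have ibpF := ibpL u F Xu lipF.
  have ibpFchi k : Defs.integration_by_parts psi u (fun y => g (grad psi y) * cutoff k y).
    apply: ibpL => //; rewrite KE'.
    exact: (transfer_lipschitz sm pdh gL (cutoff_C1 k) (@cutoff_support R n k)).
  (* Testing |grad u|^2 against the constant 1 shows that its laplacian has integral 0, and testing
     u against L u turns the other half of [gamma2] into (L u)^2; so [gamma2] has integral b1, the
     integral of (L u)^2. *)
  have [l1 l2 l3] := ibpX _ _ XG (Xc 1).
  have [p1 p2 p3] := ibpX _ _ Xu XL.
  have [q1 q2 q3] := ibpF.
  rewrite -mE in l1 l2 l3 p1 p2 p3 q1 q2 q3.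
  have [a1 ha1] := integrable_has_integral l1.
  have [b1 hb1] := integrable_has_integral p1; have [b2 hb2] := integrable_has_integral p2.
  have [d1 hd1] := integrable_has_integral q1; have [d2 hd2] := integrable_has_integral q2.
  have a10 : a1 = 0.
    move: l3; rewrite ha1.2.
    have -> : (\int[m]_x (gradprod psi (gradprod psi u u) (cst 1) x)%:E = 0)%E.
      apply: integral0_eq => x _; congr (_%:E); rewrite /gradprod big1// => i _;
        rewrite big1// => j _.
      by rewrite [partial j (cst 1) x]partialE derive_cst mulr0.
    by rewrite oppe0 => -[].
  have bb : b1 = - b2 by move: p3; rewrite hb1.2 hb2.2 -EFinN => -[].
  have dd : d1 = - d2 by move: q3; rewrite hd1.2 hd2.2 -EFinN => -[].
  have hGam : has_integral m (gamma2 psi u) b1.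
    have -> : b1 = 2^-1 * a1 - b2 by rewrite a10 bb; ring.
    apply: eq_has_integral (has_integralB (has_integralZ 2^-1 ha1) hb2) => y.
    by rewrite /gamma2 mul1r.
  have hP : has_integral m (fun y => - 2 * gradprod psi u F y - gamma2 psi u y) (2 * d1 - b1).
    have -> : 2 * d1 - b1 = - 2 * d2 - b1 by rewrite dd; ring.
    exact: has_integralB (has_integralZ (-2) hd2) hGam.
  (* Expanding the square shows that 2 d1 - b1, the value in [hP], is c minus the integral of (L u -
     F)^2, hence at least c - e^2. *)
  have hsq : has_integral m (fun y => (laplacian psi u y - F y) ^+ 2) (b1 - 2 * d1 + c).
    apply: eq_has_integral (has_integralD (has_integralB hb1 (has_integralZ 2 hd1)) hc) => y.
    rewrite /F; ring.
  rewrite hsq.2 lte_fin in ue.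
  have := energy_bound sm pdh lc mE su (Xs _ XG) (Xs _ XL) gL (f := f) _ hP hGam.1 ibpF ibpFchi.
  rewrite -KE' => /(_ gf); apply: le_trans.
  by rewrite lee_fin; lra.
rewrite f2E; have I0 : (0 <= \int[lebesgue_rV n]_(x in K) Q psi x (grad f x))%E.
  by apply: integral_ge0 => x _; exact: Q_ge0.
(* The integral of Q may be infinite, in which case the bound is trivial. *)
move: I0 main; case: (\int[lebesgue_rV n]_(x in K) Q psi x (grad f x))%E => [r _|_ _|//];
  last exact: leey.
move=> main; rewrite lee_fin ler_pdivrMl//; apply/ler_addgt0Pr => e e0.
(* The error in [main] is quadratic, so the square root turns it into an arbitrary positive e. *)
have := main (Num.sqrt e); rewrite sqrtr_gt0 => /(_ e0).
by rewrite (sqr_sqrtr (ltW e0)) -EFinM lee_fin lerBlDr.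
Qed.
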